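(* Let $X$ be a compact metric space which is an AANR and whose covering dimension satisfies $\dim(X)>1$. Let $\mathbb{D}^2=\{z\in\mathbb{C}:|z|\leq 1\}$. Then there exist continuous maps $f:\mathbb{D}^2\rightarrow X$ and $g:X\rightarrow\mathbb{D}^2$ such that $\|g\circ f-\mathrm{id}_{\mathbb{D}^2}\|_{\infty}=\sup_{z\in\mathbb{D}^2}|g(f(z))-z|<1$.
   Context: A compact metric space $X$ is an AANR (approximative absolute neighbourhood retract, in the sense of Clapp) if for every compact metric space $Y$ and every topological embedding $\iota:X\to Y$, and for every $\epsilon>0$, there exist a closed neighbourhood $U$ of $\iota(X)$ in $Y$ and a continuous map $r:U\to X$ with $d(x,r(\iota(x)))<\epsilon$ for all $x\in X$. $\dim$ denotes covering dimension. *)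

(* Defs.v *)
From HB Require Import structures.
From mathcomp Require Import all_boot all_order all_algebra.
From mathcomp Require Import all_classical all_reals all_analysis.
Set Implicit Arguments. Unset Strict Implicit. Unset Printing Implicit Defensive.
Import Order.TTheory GRing.Theory Num.Theory.
Import numFieldNormedType.Exports.
Local Open Scope classical_set_scope.
Local Open Scope ring_scope.

Definition embedding (X Y : topologicalType) (i : X -> Y) : Prop :=
  [/\ continuous i, injective i &
      forall A : set X, open A ->
        exists B : set Y, open B /\ i @` A = range i `&` B].

(* AANR in the sense of Clapp, for a compact metric space X. *)
Definition AANR (R : realType) (X : metricType R) : Prop :=
  forall (Y : metricType R) (i : X -> Y),
    compact [set: Y] -> embedding i ->
    forall eps : R, 0 < eps ->
      exists U : set Y,
        [/\ closed U,
            (exists V : set Y, [/\ open V, range i `<=` V & V `<=` U]) &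
            exists r : Y -> X, {within U, continuous r} /\
              forall x : X, @mdist R X x (r (i x)) < eps].

Definition covdim_le (X : topologicalType) (n : nat) : Prop :=
  forall (k : nat) (U : 'I_k -> set X),
    (forall i, open (U i)) -> (forall x, exists i, U i x) ->
    exists (m : nat) (V : 'I_m -> set X),
      [/\ (forall j, open (V j)),
          (forall x, exists j, V j x),
          (forall j, exists i, V j `<=` U i) &
          forall (x : X) (S : {set 'I_m}),
            (forall j, j \in S -> V j x) -> (#|S| <= n.+1)%N].

(* The closed unit disk of C, with C identified with R x R (product
   topology = Euclidean topology). *)
Definition disk2 (R : realType) : set (R * R) :=
  [set z | z.1 ^+ 2 + z.2 ^+ 2 <= 1].

Definition cdist (R : realType) (z w : R * R) : R :=
  Num.sqrt ((z.1 - w.1) ^+ 2 + (z.2 - w.2) ^+ 2).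

(* Main.v *)
Require Import Defs.
From HB Require Import structures.
From mathcomp Require Import all_boot all_order all_algebra.
From mathcomp Require Import all_classical all_reals all_analysis.
From mathcomp Require Import zify ring lra.
Set Implicit Arguments. Unset Strict Implicit. Unset Printing Implicit Defensive.
Import Order.TTheory GRing.Theory Num.Theory.
Import numFieldNormedType.Exports.
Local Open Scope classical_set_scope.
Local Open Scope ring_scope.

(** Suppose that the conclusion fails. Then X contains no quad: there is no map F of the
    square into X with two distance functions d(-, z) and d(-, w) which separate the two
    pairs of opposite sides, since a truncation of the two functions would make the
    composition close to the identity. Consequently a map of a disk into X behaves like a
    map that factors through a tree: a component of a sublevel set of d(F, z) that stays
    away from three sides of a rectangle is cut off from them by a curve on which F is
    almost constant.

    Being an AANR, X lies in the convex compact space of 1-Lipschitz functions on X, and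
    some map of a neighbourhood of X to X almost fixes X. It turns chains of nearby points
    into paths, triangles and grids in X. Call two paths weakly homotopic if, at every
    scale e, their samplings are homotopic as edge paths of the Rips complex, and call a
    path reduced if it is constant wherever it runs through a weakly null loop. By Zorn's
    lemma every path is weakly homotopic to a reduced one, and the tree-like behaviour of
    disks shows that no weakly homotopic path can avoid a lifted point of a reduced path.
    So reduced triangles are tripods.

    Let U1, U2, U3 be an open cover of X, let lam be a Urysohn function which is 0 off
    U2 u U3 and 1 off U1, and let chi be a label telling U3 from U2 where lam is not
    small. The signed number of passages of a reduced path from high to low values of lam
    which enter at a labelled point is a cocycle on the small triangles of a fine net.
    The cocycle defines a map to the circle, and the preimages of three arcs refine the
    cover without triple points. Treating all triples of members of a finite open cover
    gives dim X <= 1. *)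

(** The model is a one-dimensional continuum, whose reduced paths are the geodesics of an R-tree, a
    kind of universal covering. X need not be locally contractible, and the almost retraction moves
    points, so exact homotopies are out of reach. Weak homotopy replaces them: it is tested by
    finite chains at each scale, and it is a closed condition on the end points of paths, so that
    statements true up to every error become exact by compactness of an interval. A pair (P, t), up
    to weak homotopy of the prefix of P up to t, plays the part of a point of the covering: this is
    a lifted point. The three sets correspond to the residues 0, 1, -1 modulo 3. Off U1 nearby
    points are high, off U2 those that matter are labelled, off U3 none of them is. In each case the
    cocycle is explicit, and the lifted heights stay in an interval of length 1 disjoint from the
    open unit arcs around one residue. Since the composition need only be at distance less than 1
    from the identity, g may have a tiny image: it suffices that it pushes points inwards. *)

Ltac slim := repeat match goal with H : forall x : ?A, @?B x |- _ => clear H end.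
Ltac slra := slim; lra.
Ltac snra := slim; nra.


(** * Edge-path homotopy of chains at a fixed scale *)

Section Chains.
Context {R : realType} {X : metricType R}.
Local Notation d := (@mdist R X).
Implicit Types (e : R) (x y z : X) (u v : seq X).

Definition nr e x y := d x y < e.

(* Edge-path homotopy in the Rips complex of scale [e]; a path is the list of its vertices. *)
Inductive ht e : seq X -> seq X -> Prop :=
| ht_refl u : ht e u u
| ht_sym u v : ht e u v -> ht e v u
| ht_trans v u w : ht e u v -> ht e v w -> ht e u w
| ht_dup u x v : ht e (u ++ x :: v) (u ++ [:: x, x & v])
| ht_ins u x z y v : nr e x y -> nr e x z -> nr e z y ->
    ht e (u ++ [:: x, y & v]) (u ++ [:: x, z, y & v]).

Lemma nr_sym e x y : nr e x y = nr e y x.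
Proof. by rewrite /nr metric_sym. Qed.

Lemma nrxx e x : 0 < e -> nr e x x.
Proof. by rewrite /nr mdistxx. Qed.

Lemma nr_le e e' x y : e <= e' -> nr e x y -> nr e' x y.
Proof. by move=> ee' H; apply: lt_le_trans H ee'. Qed.

Lemma ht_le e e' u v : e <= e' -> ht e u v -> ht e' u v.
Proof.
move=> ee'; elim=> {u v} [u|u v _|v u w _ H1 _ H2|u x v|u x z y v *].
- exact: ht_refl.
- exact: ht_sym.
- exact: ht_trans H1 H2.
- exact: ht_dup.
- by apply: ht_ins; exact: nr_le ee' _.
Qed.

Lemma ht_catl e w u v : ht e u v -> ht e (w ++ u) (w ++ v).
Proof.
elim=> {u v} [u|u v _|v u w' _ H1 _ H2|u x v|u x z y v *].
- exact: ht_refl.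
- exact: ht_sym.
- exact: ht_trans H1 H2.
- rewrite !catA; exact: ht_dup.
- by rewrite !catA; apply: ht_ins.
Qed.

Lemma ht_catr e w u v : ht e u v -> ht e (u ++ w) (v ++ w).
Proof.
elim=> {u v} [u|u v _|v u w' _ H1 _ H2|u x v|u x z y v *].
- exact: ht_refl.
- exact: ht_sym.
- exact: ht_trans H1 H2.
- rewrite -!catA; exact: ht_dup.
- by rewrite -!catA; apply: ht_ins.
Qed.

Lemma ht_cat e u u' v v' : ht e u u' -> ht e v v' -> ht e (u ++ v) (u' ++ v').
Proof. by move=> H1 H2; apply: (ht_trans (ht_catr v H1)); apply: ht_catl. Qed.

Lemma ht_cons e x u v : ht e u v -> ht e (x :: u) (x :: v).
Proof. exact: (ht_catl [:: x]). Qed.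

Lemma ht_dup0 e x v : ht e [:: x, x & v] (x :: v).
Proof. exact/ht_sym/(ht_dup e [::]). Qed.

Lemma ht_del0 e x y z v : nr e x y -> nr e x z -> nr e z y ->
  ht e [:: x, z, y & v] [:: x, y & v].
Proof. by move=> *; apply/ht_sym/(@ht_ins e [::]). Qed.

Lemma ht_rev e u v : ht e u v -> ht e (rev u) (rev v).
Proof.
elim=> {u v} [u|u v _|v u w' _ H1 _ H2|u x v|u x z y v xy xz zy].
- exact: ht_refl.
- exact: ht_sym.
- exact: ht_trans H1 H2.
- rewrite !rev_cat !rev_cons -!cats1 -!catA; exact: ht_dup.
- rewrite !rev_cat !rev_cons -!cats1 -!catA.
  by apply: ht_ins; rewrite nr_sym.
Qed.

Lemma ht_back e x u : 0 < e -> path (nr e) x u -> ht e ((x :: u) ++ rev (x :: u)) [:: x].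
Proof.
move=> e0; elim: u x => [|y u IH] x /=; first by move=> _; exact: ht_dup0.
case/andP=> xy /IH H.
rewrite rev_cons -cats1.
have -> : [:: x, y & u ++ rev (y :: u) ++ [:: x]] =
  [:: x] ++ ((y :: u) ++ rev (y :: u)) ++ [:: x] by rewrite /= catA.
apply: (ht_trans (ht_catl _ (ht_catr _ H))) => /=.
apply: (ht_trans (ht_del0 _ _ _ _)) => //; first exact: nrxx.
  by rewrite nr_sym.
exact: ht_dup0.
Qed.

(** Used for the part of a chain inside a small ball, which is dispensable at any scale above the
    diameter of the ball. *)
Lemma ht_collapse e x l y : (forall a b, a \in x :: rcons l y -> b \in x :: rcons l y -> nr e a b) ->
  ht e (x :: rcons l y) [:: x; y].
Proof.
elim: l => [|a l IH] /= H; first exact: ht_refl.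
apply: (@ht_trans _ (x :: rcons l y)); last first.
  apply: IH => b c bl cl; apply: H; rewrite in_cons; move: bl cl; rewrite !in_cons.
    by case/orP=> ->; rewrite ?orbT.
  by move=> _ /orP[] ->; rewrite ?orbT.
have [b [l' E]] : exists b l', rcons l y = b :: l'.
  by case: (l) => [|b l']; [exists y, [::]|exists b, (rcons l' y)].
have bin : b \in [:: x, a & rcons l y] by rewrite E !in_cons eqxx !orbT.
rewrite E; apply: ht_del0; apply: H => //; by rewrite !in_cons eqxx ?orbT.
Qed.

(** Two consecutive rungs of a ladder; the last condition is the diagonal that cuts the square into
    two triangles. *)
Definition lad e (p q : X * X) := [&& nr e p.1 q.1, nr e p.2 q.2, nr e p.1 p.2,
  nr e q.1 q.2 & nr e p.1 q.2].

Lemma ht_ladder e p (l : seq (X * X)) : nr e p.1 p.2 -> path (lad e) p l ->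
  ht e (rcons (map fst (p :: l)) (last p l).2) (p.1 :: map snd (p :: l)).
Proof.
elim: l p => [|q l IH] p pp /=; first by move=> _; exact: ht_refl.
case/andP=> /and5P[p1 p2 _ qq p12] /(IH _ qq) H.
apply: (ht_trans (ht_cons _ H)) => /=.
apply: (ht_trans (ht_del0 _ _ _ _)) => //.
exact/ht_sym/ht_del0.
Qed.

Lemma ht_chain e u v : 0 < e -> ht e u v -> sorted (nr e) u = sorted (nr e) v.
Proof.
move=> e0; elim=> {u v} [//|//|v u w _ -> _ -> //|u x v|u x z y v xy xz zy].
- rewrite !sorted_cat_cons; congr (_ && _) => /=; by rewrite nrxx.
- by rewrite !sorted_cat_cons /= xy xz zy.
Qed.

Lemma ht_head e u v x0 : ht e u v -> head x0 u = head x0 v.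
Proof. by elim=> {u v} [//|//|v u w _ -> _ -> //|[|? ?] x v|[|? ?] x z y v]. Qed.

Lemma ht_last e u v x0 : ht e u v -> last x0 u = last x0 v.
Proof. by elim=> {u v} [//|//|v u w _ -> _ -> //|u x v|u x z y v *]; rewrite !last_cat. Qed.

Lemma ht_size0 e u v : ht e u v -> (size u == 0%N) = (size v == 0%N).
Proof.
elim=> {u v} [//|//|v u w _ -> _ -> //|u x v|u x z y v *]; rewrite !size_cat /= !addnS //.
Qed.

(* A list read as an eventually constant sequence. *)
Definition fnx u x0 j := nth (last x0 u) u j.

(** A homotopy laid out as a grid: lists become rows, padded by their last entry. Column 0 and all
    late columns are constant, so that a lattice path can slide along them. *)
Definition rows e x0 (u v : seq X) := exists m (q : nat -> nat -> X),
  [/\ forall j, q 0%N j = fnx u x0 j, forall j, q m j = fnx v x0 j,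
      forall i j, (i < m)%N -> nr e (q i j) (q i.+1 j),
      forall i j, (i <= m)%N -> nr e (q i j) (q i j.+1) &
      (forall i, (i <= m)%N -> q i 0%N = head x0 u) /\
      (exists N, forall i j, (i <= m)%N -> (N <= j)%N -> q i j = last x0 u)].

Lemma fnx_near e x0 u j : 0 < e -> sorted (nr e) u -> nr e (fnx u x0 j) (fnx u x0 j.+1).
Proof.
move=> e0; case: u => [|x u]; first by rewrite /fnx !nth_default //= nrxx.
move=> s; rewrite /fnx /= -/(nth _ (x :: u) j) -/(nth _ (x :: u) j.+1).
have [jl|jl] := ltnP j (size u).
  exact: (pathP _ s).
rewrite (nth_default _ (s := u)) //.
have [->|jl'] := eqVneq j (size u); first by rewrite nth_last nrxx.
rewrite nth_default ?nrxx //=; lia.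
Qed.

Lemma fnx_head x0 u : fnx u x0 0%N = head x0 u.
Proof. by case: u. Qed.

Lemma fnx_last x0 u j : (size u <= j)%N -> fnx u x0 j = last x0 u.
Proof. by move=> uj; rewrite /fnx nth_default. Qed.

Lemma rows1 e x0 u v : 0 < e -> sorted (nr e) u -> sorted (nr e) v ->
  head x0 u = head x0 v -> last x0 u = last x0 v ->
  (forall j, nr e (fnx u x0 j) (fnx v x0 j)) -> rows e x0 u v.
Proof.
move=> e0 su sv hu lu H; exists 1%N, (fun i => if i == 0%N then fnx u x0 else fnx v x0).
split => //=.
- by case.
- by move=> i j _; case: ifP => _; exact: fnx_near.
- split; first by move=> i _; case: ifP; rewrite fnx_head.
  exists (maxn (size u) (size v)) => i j _; rewrite geq_max => /andP[uj vj].
  by case: ifP => _; rewrite fnx_last.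
Qed.

(** One elementary move displaces the later entries by one place, so for chains with small steps the
    padded lists stay pointwise near and can serve as consecutive rows. Moves make sense on any
    list; this is why [u] is assumed to be a chain. *)
Lemma ht_rows e x0 u v : 0 < e -> sorted (nr e) u -> ht e u v -> rows e x0 u v.
Proof.
move=> e0 su H; elim: H su => {u v}.
- by move=> u su; apply: rows1 => // j; exact: nrxx.
- move=> u v H IH sv; have := ht_chain e0 H; rewrite sv => /IH [m [q [q0 qm q1 q2 [qh [N qN]]]]].
  exists m, (fun i => q (m - i)%N); split => [j|j|i j im|i j im|].
  + by rewrite subn0.
  + by rewrite subnn.
  + by rewrite nr_sym (_ : m - i = (m - i.+1).+1)%N; [apply: q1|]; lia.
  + by apply: q2; lia.
  + rewrite -(ht_last x0 H) -(ht_head x0 H); split=> [i im|]; first by apply: qh; lia.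
    by exists N => i j im Nj; apply: qN => //; lia.
- move=> v u w H1 IH1 H2 IH2 su; have := ht_chain e0 H1; rewrite su => /esym sv.
  have [m [q [q0 qm q1 q2 [qh [N qN]]]]] := IH1 su.
  have [m' [q' [q0' qm' q1' q2' [qh' [N' qN']]]]] := IH2 sv.
  exists (m + m')%N, (fun i => if (i <= m)%N then q i else q' (i - m)%N).
  split=> [j|j|i j im|i j im|].
  + by rewrite leq0n.
  + case: leqP => mm; last by rewrite addKn.
    have m0 : m' = 0%N by lia.
    by rewrite m0 addn0 qm -q0' -m0.
  + case: (ltngtP i m) => im'; [exact: q1| |].
    * by rewrite (_ : (i.+1 - m = (i - m).+1)%N); [apply: q1'|]; lia.
    * have -> : (i.+1 - m = 1)%N by lia.
      rewrite im' qm -q0'; apply: q1'; lia.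
  + by case: leqP => im'; [exact: q2|apply: q2'; lia].
  + split=> [i im|]; first by case: leqP => im'; [exact: qh|rewrite qh' ?(ht_head x0 H1) //; lia].
    exists (maxn N N') => i j im; rewrite geq_max => /andP[Nj Nj'].
    by case: leqP => im'; [exact: qN|rewrite qN' ?(ht_last x0 H1) //; lia].
- move=> u x v su; have sv : sorted (nr e) (u ++ [:: x, x & v]).
    by rewrite -(ht_chain e0 (ht_dup e u x v)).
  apply: rows1 => //; [by case: (u)|by rewrite !last_cat|].
  move=> j; have [ju|ju] := leqP j (size u).
    have -> : fnx (u ++ [:: x, x & v]) x0 j = fnx (u ++ x :: v) x0 j.
      rewrite /fnx !last_cat /= !nth_cat; case: ltnP => // uj.
      by have -> : (j - size u = 0)%N by lia.
    exact: nrxx.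
  have -> : fnx (u ++ [:: x, x & v]) x0 j = fnx (u ++ x :: v) x0 j.-1.
    rewrite /fnx !last_cat /= !nth_cat.
    have -> : (j < size u)%N = false by lia.
    have -> : (j.-1 < size u)%N = false by lia.
    by have -> : (j - size u = (j.-1 - size u).+1)%N by lia.
  rewrite nr_sym; have {2}-> : j = j.-1.+1 by lia.
  exact: fnx_near.
- move=> u x z y v xy xz zy su.
  have sv : sorted (nr e) (u ++ [:: x, z, y & v]).
    by rewrite -(ht_chain e0 (ht_ins u v xy xz zy)).
  apply: rows1 => //; [by case: (u)|by rewrite !last_cat|].
  move=> j; have [ju|ju] := leqP j (size u).
    have -> : fnx (u ++ [:: x, z, y & v]) x0 j = fnx (u ++ [:: x, y & v]) x0 j.
      rewrite /fnx !last_cat /= !nth_cat; case: ltnP => // uj.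
      by have -> : (j - size u = 0)%N by lia.
    exact: nrxx.
  have [ju1|ju1] := eqVneq j (size u).+1.
    rewrite /fnx !last_cat !nth_cat.
    have -> : (j < size u)%N = false by lia.
    have -> /= : (j - size u = 1)%N by lia.
    by rewrite nr_sym.
  have -> : fnx (u ++ [:: x, z, y & v]) x0 j = fnx (u ++ [:: x, y & v]) x0 j.-1.
    rewrite /fnx !last_cat /= !nth_cat.
    have -> : (j < size u)%N = false by lia.
    have -> : (j.-1 < size u)%N = false by lia.
    have -> : (j - size u = (j - size u).-2.+2)%N by lia.
    by have -> /= : (j.-1 - size u = (j - size u).-2.+1)%N by lia.
  rewrite nr_sym; have {2}-> : j = j.-1.+1 by lia.
  exact: fnx_near.
Qed.

End Chains.

(** * Lattice paths in a grid of points with constant first column *)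

Section Lattice.
Context {R : realType} {X : metricType R}.
Local Notation d := (@mdist R X).
Variables (e : R) (m : nat) (q : nat -> nat -> X).
Hypothesis e0 : 0 < e.
Hypothesis qv : forall i j, (i < m)%N -> nr e (q i j) (q i.+1 j).
Hypothesis qh : forall i j, (i <= m)%N -> nr e (q i j) (q i j.+1).
Hypothesis qc : forall i, (i <= m)%N -> q i 0%N = q 0%N 0%N.

(* The lattice path from the constant column 0 to (i, j) along row i; every other lattice
   path to (i, j) is homotopic to it. *)
Definition pre i j := mkseq (q i) j.+1.
Arguments pre : simpl never.

Lemma preS i j : pre i j.+1 = rcons (pre i j) (q i j.+1).
Proof. by rewrite /pre -mkseqS. Qed.

Lemma pre_rcons i j : exists s, pre i j = rcons s (q i j).
Proof. by rewrite /pre mkseqS; eexists. Qed.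

Lemma nr_triangle e1 e2 x y z : nr e1 x y -> nr e2 y z -> @nr R X (e1 + e2) x z.
Proof.
by rewrite /nr => H1 H2; apply: le_lt_trans (metric_triangle _ y _) _; apply: ltrD.
Qed.

Lemma ht_backtrack (s : seq X) x y : nr (e + e) x y -> ht (e + e) (s ++ [:: x; y; x]) (rcons s x).
Proof.
move=> xy; rewrite -cats1; apply: ht_catl.
apply: (ht_trans (ht_del0 _ _ _ _)) => //; first by apply: nrxx; move: e0; lra.
  by rewrite nr_sym.
exact: ht_dup0.
Qed.

(** The strip between the two rows is a ladder. Its diagonals force the scale [e + e], and the
    constant column 0 removes the initial rung. *)
Lemma lat_up i j : (i < m)%N -> ht (e + e) (rcons (pre i j) (q i.+1 j)) (pre i.+1 j).
Proof.
move=> im.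
have ee : e <= e + e by move: e0; lra.
pose l := [seq (q i k, q i.+1 k) | k <- iota 1 j].
have H : path (lad (e + e)) (q i 0%N, q i.+1 0%N) l.
  rewrite {}/l; elim: j 0%N => [//|j IH] k /=; rewrite IH andbT /lad /=.
  have a1 := qv k im; have a2 := qv k.+1 im; have a3 := @qh i k (ltnW im); have a4 := qh k im.
  by rewrite (nr_le ee a1) (nr_le ee a2) (nr_le ee a3) (nr_le ee a4) (nr_triangle a1 a4).
have H0 : nr (e + e) (q i 0%N, q i.+1 0%N).1 (q i 0%N, q i.+1 0%N).2 by apply: nr_le ee (qv _ im).
have := ht_ladder H0 H; rewrite /= -/(mkseq _ _) => K.
have E1 : map fst l = [seq q i k | k <- iota 1 j] by rewrite /l -map_comp.
have E2 : map snd l = [seq q i.+1 k | k <- iota 1 j] by rewrite /l -map_comp.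
have E3 : (last (q i 0%N, q i.+1 0%N) l).2 = q i.+1 j.
  rewrite /l (last_map (fun k => (q i k, q i.+1 k))) /=; congr q.
  by case: (j) => // j'; rewrite (last_nth 0%N) size_iota -nth_behead nth_iota.
move: K; rewrite E1 E2 E3 => K.
rewrite /pre /mkseq /=; apply: (ht_trans K).
rewrite qc ?(ltnW im) // -(qc im); exact: ht_dup0.
Qed.

Lemma lat_down i j : (i < m)%N -> ht (e + e) (rcons (pre i.+1 j) (q i j)) (pre i j).
Proof.
move=> im; have H := ht_catr [:: q i j] (ht_sym (lat_up j im)); rewrite cats1 in H.
apply: (ht_trans H); have [s E] := pre_rcons i j; rewrite E -!cats1 -!catA /=.
rewrite cats1; apply: ht_backtrack; apply: nr_le (qv j im); move: e0; lra.
Qed.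

Lemma lat_vert i i' j : (i <= m)%N -> (i' <= m)%N -> (i <= i'.+1)%N -> (i' <= i.+1)%N ->
  ht (e + e) (rcons (pre i j) (q i' j)) (pre i' j).
Proof.
move=> im im' h1 h2; have [->|ii'] := eqVneq i i'.
  have [s E] := pre_rcons i' j; rewrite {1}E -!cats1 -catA /= E -cats1.
  by apply: ht_catl; exact: ht_dup0.
have [ii|ii] := ltnP i i'.
  have -> : i' = i.+1 by lia.
  by apply: lat_up; lia.
have -> : i = i'.+1 by lia.
by apply: lat_down; lia.
Qed.

Lemma lat_horiz i j j' : (i <= m)%N -> (j <= j'.+1)%N -> (j' <= j.+1)%N ->
  ht (e + e) (rcons (pre i j) (q i j')) (pre i j').
Proof.
move=> im h1 h2; have [->|jj'] := eqVneq j j'.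
  have [s E] := pre_rcons i j'; rewrite {1}E -!cats1 -catA /= E -cats1.
  by apply: ht_catl; exact: ht_dup0.
have [jj|jj] := ltnP j j'.
  have -> : j' = j.+1 by lia.
  by rewrite preS; exact: ht_refl.
have -> : j = j'.+1 by lia.
rewrite preS; have [s ->] := pre_rcons i j'; rewrite -!cats1 -!catA /= cats1.
apply: ht_backtrack; apply: nr_le (qh _ im); move: e0; lra.
Qed.

Definition king (a b : nat * nat) :=
  [&& (a.1 <= b.1.+1)%N, (b.1 <= a.1.+1)%N, (a.2 <= b.2.+1)%N & (b.2 <= a.2.+1)%N].

Lemma lat_king a b : (a.1 <= m)%N -> (b.1 <= m)%N -> king a b ->
  ht (e + e) (rcons (pre a.1 a.2) (q b.1 b.2)) (pre b.1 b.2).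
Proof.
case: a b => [i j] [i' j'] im im' /and4P[h1 h2 h3 h4]; cbn [fst snd] in *.
have n1 : nr e (q i j) (q i' j).
  have [->|?] := eqVneq i i'; first exact: nrxx.
  have [?|?] := ltnP i i'.
    by have -> : i' = i.+1; [lia|apply: qv; lia].
  by have -> : i = i'.+1; [lia|rewrite nr_sym; apply: qv; lia].
have n2 : nr e (q i' j) (q i' j').
  have [->|?] := eqVneq j j'; first exact: nrxx.
  have [?|?] := ltnP j j'.
    by have -> : j' = j.+1; [lia|apply: qh; lia].
  by have -> : j = j'.+1; [lia|rewrite nr_sym; apply: qh; lia].
have n3 := nr_triangle n1 n2.
apply: (@ht_trans _ _ _ (rcons (rcons (pre i j) (q i' j)) (q i' j'))).
  have [s E] := pre_rcons i j.
  have -> : rcons (pre i j) (q i' j') = s ++ [:: q i j; q i' j'] by rewrite E -!cats1 -catA.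
  have -> : rcons (rcons (pre i j) (q i' j)) (q i' j') = s ++ [:: q i j; q i' j; q i' j'].
    by rewrite E -!cats1 -!catA.
  by apply: ht_ins => //; [move: n1|move: n2]; apply: nr_le; move: e0; lra.
apply: (@ht_trans _ _ _ (rcons (pre i' j) (q i' j'))); last exact: lat_horiz.
rewrite -(cats1 (rcons _ _)) -(cats1 (pre i' j)); apply: ht_catr; exact: lat_vert.
Qed.

(** A grid is simply connected: the class of the image of a lattice path depends only on its end.
    The path [c], with diagonal steps allowed, is absorbed vertex by vertex into the standard
    path. *)
Lemma lat_path a (c : seq (nat * nat)) : (a.1 <= m)%N -> all (fun b => b.1 <= m)%N c ->
  path king a c ->
  ht (e + e) (pre a.1 a.2 ++ [seq q b.1 b.2 | b <- c]) (pre (last a c).1 (last a c).2).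
Proof.
elim: c a => [|b c IH] a am /=; first by rewrite cats0 => _ _; exact: ht_refl.
case/andP=> bm cm /andP[kab kc]; rewrite -cat_rcons.
apply: (ht_trans (ht_catr _ (lat_king am bm kab))); exact: IH.
Qed.

End Lattice.

Arguments pre : simpl never.

(** * Chains sampled from uniformly continuous paths *)

Section Sampling.
Context {R : realType} {X : metricType R}.
Local Notation d := (@mdist R X).
Implicit Types (e : R) (P : R -> X) (u v w s t : R) (l : seq R).

Definition uc P := forall e, 0 < e ->
  exists2 dl, 0 < dl & forall s t, `|s - t| < dl -> d (P s) (P t) < e.

Definition osc_lt e P s t :=
  s <= t /\ forall x y, s <= x <= t -> s <= y <= t -> d (P x) (P y) < e.

Fixpoint part e P u l v : Prop :=
  if l is t :: l' then osc_lt e P u t /\ part e P t l' v else u = v.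

Lemma osc_lt_sub e P s t x y : osc_lt e P s t -> s <= x -> x <= y -> y <= t -> osc_lt e P x y.
Proof.
move=> [st H] sx xy yt; split=> // a b /andP[a1 a2] /andP[b1 b2].
by apply: H; apply/andP; split; lra.
Qed.

Lemma osc_lt_le e e' P s t : e <= e' -> osc_lt e P s t -> osc_lt e' P s t.
Proof. by move=> ee [st H]; split=> // x y hx hy; apply: lt_le_trans (H _ _ hx hy) ee. Qed.

Lemma part_le e P u l v : part e P u l v -> u <= v.
Proof. by elim: l u => [|t l IH] u /= => [->|[[ut _] /IH]] //; exact: le_trans. Qed.

Lemma part_mono e e' P u l v : e <= e' -> part e P u l v -> part e' P u l v.
Proof.
move=> ee; elim: l u => [//|t l IH] u /= [f /IH H]; split=> //; exact: osc_lt_le f.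
Qed.

Lemma part_last e P u l v : part e P u l v -> last u l = v.
Proof. by elim: l u => [//|t l IH] u /= [_ /IH]. Qed.

Lemma part_cat e P u l w l' v : part e P u l w -> part e P w l' v -> part e P u (l ++ l') v.
Proof. by elim: l u => [|t l IH] u /= => [->//|[f /IH H] /H]. Qed.

Lemma part_near e P u l v : part e P u l v -> path (nr e) (P u) (map P l).
Proof.
elim: l u => [//|t l IH] u /= [[ut f] /IH ->]; rewrite andbT.
by apply: f; rewrite lexx ut.
Qed.

(** Passage to a common refinement: the smaller of the two first division points is inserted into
    the other list. This is a triangle move, because the oscillation on the longer cell is less than
    [e]. *)
Lemma part_uniq e P u l l' v : part e P u l v -> part e P u l' v ->
  ht e (map P (u :: l)) (map P (u :: l')).
Proof.
have [n] := ubnP (size l + size l')%N; elim: n u l l' => // n IH u l l' ln H H'.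
case: l l' ln H H' => [|t l] [|t' l'] ln.
- by move=> *; exact: ht_refl.
- move=> /= uv [[ut' _] H']; have E : t' = u.
    by apply/eqP; rewrite eq_le ut' andbT uv; exact: part_le H'.
  rewrite E; apply: ht_sym; apply: (ht_trans (ht_dup0 _ _ _)); apply: ht_sym.
  by apply: (IH u [::] l'); rewrite // -?E // E.
- move=> [[ut _] H] /= uv; have E : t = u.
    by apply/eqP; rewrite eq_le ut andbT uv; exact: part_le H.
  rewrite /= E; apply: (ht_trans (ht_dup0 _ _ _)).
  by apply: (IH u l [::]) => //; rewrite -{1}E.
- move=> [f H] [f' H'].
  wlog tt' : t l t' l' f f' H H' ln / t <= t'.
    move=> W; have [tt|tt] := leP t t'; first exact: W.
    by apply/ht_sym/W => //; [lia|exact: ltW].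
  have [ut g] := f; have [ut' g'] := f'.
  apply: (@ht_trans _ _ _ (map P [:: u, t, t' & l'])); last first.
    apply: ht_del0; apply: g'; rewrite ?lexx ?ut' ?tt' ?ut //.
  apply: (ht_cons (P u)); apply: (IH t l (t' :: l')) => //=.
  split=> //; exact: osc_lt_sub f' _ _ _.
Qed.

Lemma uc_osc_lt e P : uc P -> 0 < e ->
  exists2 dl, 0 < dl & forall s t, s <= t -> t - s < dl -> osc_lt e P s t.
Proof.
move=> uP e0; have [dl d0 H] := uP e e0; exists dl => // s t st stl; split=> // x y /andP[x1 x2] /andP[y1 y2].
by apply: H; rewrite ltr_norml; apply/andP; split; lra.
Qed.

Lemma part_ex e P u v : uc P -> 0 < e -> u <= v -> exists l, part e P u l v.
Proof.
move=> uP e0 uv; have [dl d0 H] := uc_osc_lt uP e0.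
have [n] : exists n : nat, v - u <= n%:R * (dl / 2).
  have h : 0 < dl / 2 by lra.
  exists (Num.truncn ((v - u) / (dl / 2))).+1; rewrite -ler_pdivrMr //; apply: ltW.
  exact: truncnS_gt.
elim: n u uv => [|n IH] u uv; first by rewrite mul0r => h; exists [::] => /=; lra.
rewrite -natr1 mulrDl mul1r => h; have [vu|uv'] := leP v (u + dl / 2).
  by exists [:: v] => /=; split=> //; apply: H => //; lra.
have [||l L] := IH (u + dl / 2); [lra|lra|].
by exists (u + dl / 2 :: l) => /=; split=> //; apply: H; lra.
Qed.

(* The chain of the values of [P] on some partition of [u, v] with oscillation less than [e];
   up to [ht] it does not depend on the partition. *)
Definition ch e P u v : seq X := map P (u :: xget [::] [set l | part e P u l v]).

Lemma chP e P u v : uc P -> 0 < e -> u <= v ->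
  exists2 l, part e P u l v & ch e P u v = map P (u :: l).
Proof.
move=> uP e0 uv; have [l L] := part_ex uP e0 uv.
exists (xget [::] [set l | part e P u l v]) => //.
exact: (@xgetPex _ [::] [set l | part e P u l v] (ex_intro _ l L)).
Qed.

Lemma ch_ht e P u v l : part e P u l v -> ht e (ch e P u v) (map P (u :: l)).
Proof.
move=> L; apply: (part_uniq (v := v)) => //.
exact: (@xgetPex _ [::] [set l | part e P u l v] (ex_intro _ l L)).
Qed.

Lemma ch_last e P u v x0 : uc P -> 0 < e -> u <= v -> last x0 (ch e P u v) = P v.
Proof.
by move=> uP e0 uv; have [l L ->] := chP uP e0 uv; rewrite /= last_map (part_last L).
Qed.

Lemma ch_rcons e P u v : uc P -> 0 < e -> u <= v -> exists s : seq X, ch e P u v = rcons s (P v).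
Proof.
move=> uP e0 uv; have := ch_last (P u) uP e0 uv; rewrite /ch /=.
set l := map _ _ => E; exists (belast (P u) l); by rewrite lastI E.
Qed.

Lemma ch_near e P u v : uc P -> 0 < e -> u <= v -> sorted (nr e) (ch e P u v).
Proof. by move=> uP e0 uv; have [l L ->] := chP uP e0 uv; exact: part_near L. Qed.

Lemma ht_glue e (x : X) (s t : seq X) : ht e (rcons s x ++ x :: t) (rcons s x ++ t).
Proof. by rewrite -!cats1 -!catA /=; apply: ht_catl; exact: ht_dup0. Qed.

Lemma ch_cat e P u w v : uc P -> 0 < e -> u <= w -> w <= v ->
  ht e (ch e P u w ++ ch e P w v) (ch e P u v).
Proof.
move=> uP e0 uw wv; have [l L E] := chP uP e0 uw; have [l' L' E'] := chP uP e0 wv.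
apply: ht_sym; apply: (ht_trans (ch_ht (part_cat L L'))).
have [s Es] := ch_rcons uP e0 uw.
apply: ht_sym; rewrite Es E' /=; apply: (ht_trans (ht_glue _ _ _ _)).
rewrite -Es E /= map_cat; exact: ht_refl.
Qed.

Lemma ch_le e e' P u v : uc P -> 0 < e -> e <= e' -> u <= v -> ht e' (ch e P u v) (ch e' P u v).
Proof.
move=> uP e0 ee uv; have [l L ->] := chP uP e0 uv; apply: ht_sym.
by apply: ch_ht; exact: part_mono L.
Qed.

Lemma ch_small e P u v : osc_lt e P u v -> ht e (ch e P u v) [:: P u; P v].
Proof. by move=> f; apply: (ch_ht (l := [:: v])). Qed.

Lemma ch_xx e P u : 0 < e -> ht e (ch e P u u) [:: P u].
Proof. by move=> e0; apply: (ch_ht (l := [::])). Qed.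

(** Reversal by a change of sign: [u, v] becomes [-v, -u], and reversing twice gives back the same
    function. *)
Definition opath P : R -> X := fun t => P (- t).

Lemma uc_opath P : uc P -> uc (opath P).
Proof.
move=> uP e e0; have [dl d0 H] := uP e e0; exists dl => // s t st; apply: H.
by rewrite -opprD normrN.
Qed.

Lemma osc_lt_opath e P s t : osc_lt e P s t -> osc_lt e (opath P) (- t) (- s).
Proof.
move=> [st f]; split; first lra.
by move=> x y /andP[x1 x2] /andP[y1 y2]; apply: f; apply/andP; split; lra.
Qed.

Lemma part_opath e P u l v : part e P u l v ->
  exists2 l', part e (opath P) (- v) l' (- u) & map (opath P) (- v :: l') = rev (map P (u :: l)).
Proof.
elim: l u => [|t l IH] u /=; first by move=> ->; exists [::]; rewrite //= /opath opprK.
move=> [f /IH[l' L' E]]; exists (rcons l' (- u)).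
  rewrite -cats1; apply: (part_cat L') => /=; split=> //; exact: osc_lt_opath.
have : map (opath P) (- v :: rcons l' (- u)) = rcons (map (opath P) (- v :: l')) (P u).
  by rewrite /= map_rcons {3}/opath opprK.
by move=> /= ->; rewrite rev_cons -[rev _]E.
Qed.

Lemma ch_opath e P u v : uc P -> 0 < e -> u <= v ->
  ht e (rev (ch e P u v)) (ch e (opath P) (- v) (- u)).
Proof.
move=> uP e0 uv; have [l L ->] := chP uP e0 uv; have [l' L' <-] := part_opath L.
by apply: ht_sym; exact: ch_ht.
Qed.

Lemma ch_back e P u v : uc P -> 0 < e -> u <= v ->
  ht e (ch e P u v ++ rev (ch e P u v)) [:: P u].
Proof. by move=> uP e0 uv; have := ch_near uP e0 uv; exact: ht_back. Qed.

End Sampling.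

Notation samples P u v := (fun e => ch e P u v).

(** * Piecewise linear interpolation by clamped ramps *)

Section PiecewiseLinear.
Context {R : realType}.
Implicit Types (x y : R) (a : nat -> R).

Definition clamp x : R := Num.max 0 (Num.min 1 x).

Lemma clamp_ge0 x : 0 <= clamp x.
Proof. by rewrite le_max lexx. Qed.

Lemma clamp_le1 x : clamp x <= 1.
Proof. by rewrite ge_max ler01 ge_min lexx. Qed.

Lemma clamp_id x : 0 <= x -> x <= 1 -> clamp x = x.
Proof. by move=> x0 x1; rewrite /clamp min_r // max_r. Qed.

Lemma clamp0 x : x <= 0 -> clamp x = 0.
Proof. by move=> x0; rewrite /clamp max_l // ge_min x0 orbT. Qed.

Lemma clamp1 x : 1 <= x -> clamp x = 1.
Proof. by move=> x0; rewrite /clamp min_l // max_r. Qed.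

Lemma clamp_cases x : [\/ x <= 0 /\ clamp x = 0, 1 <= x /\ clamp x = 1 |
  [/\ 0 <= x, x <= 1 & clamp x = x]].
Proof.
have [x0|x0] := leP x 0; first by apply: Or31; rewrite clamp0.
have [x1|x1] := leP 1 x; first by apply: Or32; rewrite clamp1.
by apply: Or33; split; [lra|lra|apply: clamp_id; lra].
Qed.

Lemma clamp_lip x y : `|clamp x - clamp y| <= `|x - y|.
Proof.
wlog xy : x y / x <= y.
  move=> H; have [/H//|/ltW /H] := leP x y; by rewrite distrC (distrC y).
have -> : `|x - y| = y - x by rewrite ler0_norm; lra.
rewrite ler_norml.
by case: (clamp_cases x) => [[? ->]|[? ->]|[? ? ->]];
  case: (clamp_cases y) => [[? ->]|[? ->]|[? ? ->]]; lra.
Qed.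

(** Interpolation of a 0, ..., a m at the integers 0, ..., m, constant outside [0, m]. As a sum of
    ramps it has a termwise Lipschitz bound. *)
Definition pl m a x : R := a 0%N + \sum_(i < m) (a i.+1 - a i) * clamp (x - i%:R).

Lemma plS m a x : pl m.+1 a x = pl m a x + (a m.+1 - a m) * clamp (x - m%:R).
Proof. by rewrite /pl big_ord_recr /= addrA. Qed.

Lemma pl_le0 m a x : x <= 0 -> pl m a x = a 0%N.
Proof.
move=> x0; rewrite /pl big1 ?addr0 // => i _; rewrite clamp0 ?mulr0 //.
have : 0 <= (i : nat)%:R :> R by []. lra.
Qed.

Lemma pl_ge m a x : m%:R <= x -> pl m a x = a m.
Proof.
elim: m => [|m IH] mx; first by rewrite /pl big_ord0 addr0.
by move: mx; rewrite -natr1 => mx; rewrite plS IH ?clamp1; lra.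
Qed.

(** The cell and [t] are the same for every [a], so several coordinates can be treated at once. The
    alternatives i = 0 and i.+1 = m cover arguments outside [0, m]. *)
Lemma pl_cell m x : (0 < m)%N -> exists i t, [/\ (i < m)%N, 0 <= t, t <= 1,
  (i%:R <= x \/ i = 0%N) /\ (x <= i.+1%:R \/ i.+1 = m) &
  forall a, pl m a x = (1 - t) * a i + t * a i.+1].
Proof.
elim: m => // m IH _; have [xm|xm] := leP x m%:R; last first.
  exists m, (clamp (x - m%:R)); split=> //; rewrite ?clamp_ge0 ?clamp_le1 //.
    by split; [left; exact: ltW|right].
  by move=> a; rewrite plS pl_ge ?(ltW xm) //; ring.
have [m0|m0] := posnP m.
  exists 0%N, 0; split=> //; first by split; right; rewrite ?m0.
  by move=> a; rewrite pl_le0; [ring|move: xm; rewrite m0].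
have [i [t [im t0 t1 [h1 h2] H]]] := IH m0.
exists i, t; split=> //; first exact: ltnW.
  split=> //; left; case: h2 => // E; by rewrite E.
move=> a; rewrite plS H clamp0 ?mulr0 ?addr0 //; lra.
Qed.

Lemma pl_lip m a L x y : (forall i, (i < m)%N -> `|a i.+1 - a i| <= L) ->
  `|pl m a x - pl m a y| <= m%:R * L * `|x - y|.
Proof.
elim: m => [|m IH] H; first by rewrite /pl !big_ord0 subrr normr0 !mul0r.
rewrite !plS.
have -> : pl m a x + (a m.+1 - a m) * clamp (x - m%:R) -
  (pl m a y + (a m.+1 - a m) * clamp (y - m%:R)) =
  (pl m a x - pl m a y) + (a m.+1 - a m) * (clamp (x - m%:R) - clamp (y - m%:R)) by ring.
apply: (le_trans (ler_normD _ _)); rewrite normrM -natr1 !mulrDl mul1r; apply: lerD.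
  by apply: IH => i im; apply: H; exact: ltnW.
apply: ler_pM => //; first exact: H.
have -> : x - y = x - m%:R - (y - m%:R) by ring.
exact: clamp_lip.
Qed.

Lemma pl_bound m a x u v : (forall i, (i <= m)%N -> u <= a i <= v) -> u <= pl m a x <= v.
Proof.
case: (posnP m) => [->|m0] H; first by rewrite /pl big_ord0 addr0 H.
have [i [t [im t0 t1 _ ->]]] := pl_cell x m0.
have /andP[h1 h2] := H i (ltnW im); have /andP[h3 h4] := H i.+1 im.
apply/andP; split; nra.
Qed.

End PiecewiseLinear.

(** * A parity argument for walls in a triangulated rectangle *)

Section Walls.
Local Open Scope nat_scope.
Local Notation V := (nat * nat)%type.
Implicit Types (p q v w : V).

Definition adj v w := [&& v.1 <= w.1.+1, w.1 <= v.1.+1, v.2 <= w.2.+1 & w.2 <= v.2.+1].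

Lemma adj_sym v w : adj v w = adj w v.
Proof. rewrite /adj; lia. Qed.

Definition conn (S : V -> Prop) v w :=
  exists s, [/\ path adj v s, last v s = w & forall x, x \in v :: s -> S x].

Lemma conn_refl (S : V -> Prop) v : S v -> conn S v v.
Proof. by move=> Sv; exists [::]; split=> // x; rewrite inE => /eqP ->. Qed.

Lemma conn_step (S : V -> Prop) v w x : conn S v w -> adj w x -> S x -> conn S v x.
Proof.
move=> [s [ps ls Ss]] wx Sx; exists (rcons s x); split.
- by rewrite rcons_path ps ls.
- by rewrite last_rcons.
- by move=> y; rewrite -rcons_cons mem_rcons inE => /orP[/eqP->//|]; exact: Ss.
Qed.

Lemma conn_end (S : V -> Prop) v w : conn S v w -> S w.
Proof. by move=> [s [_ <- H]]; apply: H; exact: mem_last. Qed.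

Lemma conn_start (S : V -> Prop) v w : conn S v w -> S v.
Proof. by move=> [s [_ _ H]]; apply: H; rewrite mem_head. Qed.

Lemma conn_sub (S S' : V -> Prop) v w : (forall x, S x -> S' x) -> conn S v w -> conn S' v w.
Proof. by move=> SS [s [h1 h2 h3]]; exists s; split=> // x /h3/SS. Qed.

Variables (A B : nat) (K : V -> Prop).
Definition inr v := v.1 <= A /\ v.2 <= B.
Hypothesis Ktop : forall b, b <= B -> ~ K (A, b).
Hypothesis Kleft : forall a, a <= A -> ~ K (a, 0).
Hypothesis Kright : forall a, a <= A -> ~ K (a, B).

(* A wall consists of crossing edges (p, q), with p in K and q not in K; one passes from an
   edge to another edge of the same triangle. *)
Inductive wall : V * V -> V * V -> Prop :=
| wall0 p q : K p -> ~ K q -> adj p q -> inr p -> inr q -> wall (p, q) (p, q)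
| wallq e p q q' : wall e (p, q) -> ~ K q' -> adj p q' -> adj q q' -> inr q' -> wall e (p, q')
| wallp e p p' q : wall e (p, q) -> K p' -> adj p' q -> adj p p' -> inr p' -> wall e (p', q).

(* Each triangle meets a union of walls in an even number of edges, so the number of
   bottom edges in such a union is even. *)
Lemma wall_bottom y0 : y0 <= B -> K (0, y0) -> exists p q p' q' l r,
  [/\ wall (p, q) (p', q'), q = (0, l) & q' = (0, r)] /\ (l < y0 < r).
Proof.
move=> y0B K0.
have wallP e p q : wall e (p, q) -> [/\ K p, ~ K q, adj p q, inr p & inr q].
  move E: (p, q) => f W; elim: W p q E => {e f}.
  - by move=> p q Kp Kq pq ip iq _ _ [-> ->].
  - move=> e p q q' _ IH Kq' pq' qq' iq' _ _ [-> ->]; have [Kp _ _ ip _] := IH _ _ erefl; by split.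
  - move=> e p p' q _ IH Kp' pq' qq' iq' _ _ [-> ->]; have [_ Kq _ _ iq] := IH _ _ erefl; by split.
(* Marked edges are those on a wall starting from an edge whose outer end is at the bottom, left of
   [y0]. *)
pose on p q := exists p0 q0 l, [/\ wall (p0, q0) (p, q), q0 = (0, l) & l < y0].
apply: contrapT => noR.
pose c v w := `[< on v w \/ on w v >].
pose k v := `[< K v >].
have csym v w : c v w = c w v by apply/asboolP/asboolP => -[]; tauto.
have ck v w : c v w -> k v != k w.
  move=> /asboolP[] [p0 [q0 [l [/wallP[h1 h2 _ _ _] _ _]]]];
  by rewrite /k (asboolT h1) (asboolF h2).
have cq u v w : k u -> ~~ k v -> ~~ k w -> adj u w -> adj v w -> inr w -> c u v -> c u w.
  move=> ku kv /asboolPn kw uw vw iw /asboolP[] [p0 [q0 [l [W h1 h2]]]]; apply/asboolP.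
    by left; exists p0, q0, l; split=> //; exact: wallq W _ _ _ _.
  by have [_ /asboolPn] := wallP _ _ _ W; rewrite -/(k u) ku.
have cp u v w : ~~ k u -> k v -> k w -> adj u w -> adj v w -> inr w -> c u v -> c u w.
  move=> ku kv /asboolP kw uw vw iw /asboolP[] [p0 [q0 [l [W h1 h2]]]]; apply/asboolP.
    by have [/asboolP] := wallP _ _ _ W; rewrite -/(k u) (negbTE ku).
  right; exists p0, q0, l; split=> //; apply: wallp W _ _ _ _ => //.
  by rewrite adj_sym.
(* A triangle with a crossing edge has exactly two of them, and a wall through one continues to the
   other; so the marks of the three sides add up to zero modulo 2. *)
have tri u v w : inr u -> inr v -> inr w -> adj u v -> adj v w -> adj u w ->
    c u v (+) c v w = c u w.
  move=> iu iv iw uv vw uw.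
  have n u' v' : k u' = k v' -> c u' v' = false.
    by move=> E; apply/negP => /ck; rewrite E eqxx.
  have [vu wv wu] : [/\ adj v u, adj w v & adj w u] by rewrite adj_sym uv adj_sym vw adj_sym uw.
  have odd1 x y z : inr x -> inr y -> inr z -> adj x y -> adj x z -> adj y z ->
      k x != k y -> k y = k z -> c x y = c x z.
    move=> ix iy iz xy xz yz kxy kyz; have zy : adj z y by rewrite adj_sym.
    case kx: (k x) (kxy) => ky.
      have ky' : ~~ k y by [].
      by apply/idP/idP; [apply: cq|apply: cq]; rewrite -?kyz // kyz.
    have ky' : k y by move: ky; case: (k y).
    by apply/idP/idP; [apply: cp|apply: cp]; rewrite -?kyz // ?kx.
  case: (eqVneq (k u) (k v)) => kuv.
    rewrite n // addFb; case: (eqVneq (k v) (k w)) => kvw; first by rewrite !n // kuv.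
    by rewrite csym (csym u); apply: odd1 => //; rewrite 1?eq_sym.
  case: (eqVneq (k v) (k w)) => kvw.
    by rewrite (n v w) // addbF; apply: odd1.
  have kuw : k u = k w by move: kuv kvw; case: (k u); case: (k v); case: (k w).
  by rewrite (n u w) // (csym u) (odd1 v u w) ?addbb // eq_sym.
pose H a b := c (a, b) (a, b.+1).
pose S a b := \big[addb/false]_(j < b) H a j.
(* Summing over the triangles between two rows compares the parities of their marks, up to the
   transversal edges at both ends. These are unmarked in the outer columns, so all rows have the
   parity 0 of the top row. *)
have SS a b : a < A -> b <= B -> S a b (+) S a.+1 b = c (a, 0) (a.+1, 0) (+) c (a, b) (a.+1, b).
  move=> aA; elim: b => [|b IH] bB; first by rewrite /S !big_ord0 !addbb.
  rewrite /S !big_ord_recr /= -/(S a b) -/(S a.+1 b) addbACA IH; last exact: ltnW.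
  rewrite -addbA; congr addb.
  have t1 : H a b (+) c (a, b.+1) (a.+1, b.+1) = c (a, b) (a.+1, b.+1).
    by apply: tri; rewrite /inr /adj /=; lia.
  have t2 : c (a, b) (a.+1, b) (+) H a.+1 b = c (a, b) (a.+1, b.+1).
    by apply: tri; rewrite /inr /adj /=; lia.
  move: t1 t2; rewrite -/(H a b) -/(H a.+1 b).
  by case: (H a b); case: (H a.+1 b); case: (c (a, b) (a.+1, b));
    case: (c (a, b.+1) _); case: (c (a, b) _).
have cF u v : ~ K u -> ~ K v -> c u v = false.
  by move=> Ku Kv; apply/negP => /ck; rewrite /k !asboolF.
have S0 a : a <= A -> S (A - a) B = false.
  elim: a => [|a IH] aA.
    rewrite subn0 /S big1 // => j _; apply: cF; apply: Ktop; [exact: ltnW|exact: ltn_ord].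
  have E : A - a = (A - a.+1).+1 by lia.
  have := @SS (A - a.+1) B; rewrite -E IH ?(ltnW aA) // addbF => ->; [|lia|exact: leqnn].
  by rewrite !cF //; (apply: Kleft || apply: Kright); lia.
(* Left of [y0] every crossing edge of the bottom row starts a wall and is marked, so the parity
   records membership in [K]; it is 1 at [y0]. *)
have SK b : b <= y0 -> S 0 b = k (0, b).
  elim: b => [|b IH] by0; first by rewrite /S big_ord0 /k asboolF //; exact: Kleft.
  rewrite /S big_ord_recr /= -/(S 0 b) IH; last exact: ltnW.
  rewrite /H.
  case: (eqVneq (k (0, b)) (k (0, b.+1))) => kb.
    by rewrite -kb; case: (boolP (c _ _)) => [/ck|]; rewrite ?kb ?eqxx // addbF.
  suff -> : c (0, b) (0, b.+1) by move: kb; case: (k _); case: (k _).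
  apply/asboolP; have ib : inr (0, b) /\ inr (0, b.+1) by rewrite /inr /=; lia.
  case: ib => ib ib'; case kb0: (k (0, b)) kb => kb.
    left; exists (0, b), (0, b.+1), b.+1; split=> //; last first.
      rewrite ltn_neqAle by0 andbT; apply/eqP => E; move: kb; rewrite /k E.
      by rewrite (asboolT K0).
    by apply: wall0 => //; [exact/asboolP|move: kb; rewrite eq_sym => kb; apply/asboolPn; move: kb; rewrite /k; case: `[< _ >]|rewrite /adj /=; lia].
  right; exists (0, b.+1), (0, b), b; split=> //.
  apply: wall0 => //; [apply/asboolP; move: kb; rewrite /k; by case: `[< _ >]|by move/asboolP; rewrite -/(k _) kb0|rewrite /adj /=; lia].
(* A marked bottom edge right of [y0] would complete the wanted wall. So the parity 1 survives up to
   column [B], against the value 0 obtained from the top. *)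
have SR b : y0 <= b -> b <= B -> S 0 b = true.
  elim: b => [|b IH] yb bB.
    have E : y0 = 0 by lia.
    by move: K0; rewrite E => /(Kleft (leq0n A)).
  case: (eqVneq y0 b.+1) => [E|ne]; first by rewrite SK ?E // -E /k asboolT.
  rewrite /S big_ord_recr /= -/(S 0 b) IH; [|lia|lia].
  suff -> : H 0 b = false by [].
  apply/negP => /asboolP Hc; apply: noR.
  have [p0 [q0 [l [p' [q' [r [W Eq Eq' ly [yr rb]]]]]]]] : exists p0 q0 l p' q' r,
     [/\ wall (p0, q0) (p', q'), q0 = (0, l), q' = (0, r), l < y0 & y0 <= r /\ r <= b.+1].
    case: Hc => [] [p0 [q0 [l [W h1 h2]]]].
      by exists p0, q0, l, (0, b), (0, b.+1), b.+1; split=> //; lia.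
    by exists p0, q0, l, (0, b.+1), (0, b), b; split=> //; lia.
  exists p0, q0, p', q', l, r; split=> //; rewrite ly /= ltn_neqAle yr andbT.
  by apply/eqP => E; have [_] := wallP _ _ _ W; rewrite Eq' -E => /(_ K0).
by have := S0 A (leqnn A); rewrite subnn SR.
Qed.

End Walls.

(** * Long walls produce quads *)

Section Exit.
Context {R : realType} {X : metricType R}.
Local Notation d := (@mdist R X).
Local Notation V := (nat * nat)%type.
Implicit Types (F : R -> R -> X).

Definition uc2 F := forall e, 0 < e -> exists2 dl, 0 < dl &
  forall x x' y y', `|x - x'| < dl -> `|y - y'| < dl -> d (F x y) (F x' y') < e.

Definition noquad := forall F, uc2 F -> forall (z w : X) (s c k : R), 0 < k ->
  ~ (forall t, 0 <= t <= 1 -> [/\ d (F 0 t) w <= c - k, c + k <= d (F 1 t) w,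
       d (F t 0) z <= s - k & s + k <= d (F t 1) z]).

Definition pos (n : nat) (a : nat) : R := a%:R / n%:R.

Lemma pos_adj n a b : (0 < n)%N -> (a <= b.+1)%N -> (b <= a.+1)%N -> `|pos n a - pos n b| <= n%:R^-1.
Proof.
move=> n0 ab ba; rewrite /pos -mulrBl normrM [`|n%:R^-1|]ger0_norm ?invr_ge0 //.
have h1 : a%:R <= b%:R + 1 :> R by rewrite natr1 ler_nat.
have h2 : b%:R <= a%:R + 1 :> R by rewrite natr1 ler_nat.
by rewrite ler_piMl ?invr_ge0 // ler_norml; apply/andP; split; lra.
Qed.

(** The chain becomes a polygon over [0, 1]. One constant [L] serves both as Lipschitz constant and
    as bound of the coordinates, which is the form that [lin_lip] needs. *)
Lemma chain_path n S v w : (0 < n)%N -> conn S v w -> exists (g1 g2 : R -> R) (L : R),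
  [/\ 0 <= L, (forall x y, `|g1 x - g1 y| <= L * `|x - y|) /\ (forall x y, `|g2 x - g2 y| <= L * `|x - y|),
   (forall x, `|g1 x| <= L) /\ (forall x, `|g2 x| <= L),
   [/\ g1 0 = pos n v.1, g2 0 = pos n v.2, g1 1 = pos n w.1 & g2 1 = pos n w.2] &
   forall x, exists2 u, S u & `|g1 x - pos n u.1| <= n%:R^-1 /\ `|g2 x - pos n u.2| <= n%:R^-1].
Proof.
move=> n0 [s [ps ls Ss]]; pose m := size s; pose c i := nth v (v :: s) i.
have adjc i : (i < m)%N -> adj (c i) (c i.+1) by move=> im; exact: (pathP v ps).
have Sc i : (i <= m)%N -> S (c i) by move=> im; apply: Ss; rewrite mem_nth.
pose g (pr : V -> nat) x := pl m (fun i => pos n (pr (c i))) (m%:R * clamp x).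
have lip (pr : V -> nat) : (forall a b, adj a b -> (pr a <= (pr b).+1)%N) ->
   forall x y, `|g pr x - g pr y| <= m%:R * n%:R^-1 * m%:R * `|x - y|.
  move=> hpr x y; apply: (le_trans (pl_lip (L := n%:R^-1) _ _ _)).
    by move=> i im; apply: pos_adj => //; apply: hpr; rewrite ?adjc // adj_sym adjc.
  rewrite -mulrBr normrM (ger0_norm (x := m%:R)) // !mulrA ler_wpM2l ?clamp_lip //.
have p1 (a b : V) : adj a b -> (a.1 <= b.1.+1)%N by case/and4P.
have p2 (a b : V) : adj a b -> (a.2 <= b.2.+1)%N by case/and4P.
have bnd (pr : V -> nat) : (forall a b, adj a b -> (pr a <= (pr b).+1)%N) ->
   forall x, `|g pr x| <= pos n (pr v) + m%:R * n%:R^-1 * m%:R.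
  move=> hpr x; have E : g pr x = g pr (clamp x).
    by rewrite /g (clamp_id (clamp_ge0 x) (clamp_le1 x)).
  have E0 : g pr 0 = pos n (pr v) by rewrite /g clamp0 // mulr0 pl_le0.
  have := lip pr hpr (clamp x) 0; rewrite -E E0 subr0 (ger0_norm (clamp_ge0 x)) => h.
  have p0 : 0 <= pos n (pr v) by rewrite divr_ge0.
  have -> : g pr x = pos n (pr v) + (g pr x - pos n (pr v)) by ring.
  apply: (le_trans (ler_normD _ _)); rewrite (ger0_norm p0) lerD2l; apply: (le_trans h).
  by rewrite ler_piMr ?clamp_le1 // !mulr_ge0 ?invr_ge0.
pose L := pos n v.1 + pos n v.2 + m%:R * n%:R^-1 * m%:R.
have L0 : 0 <= m%:R * n%:R^-1 * m%:R :> R by rewrite !mulr_ge0 ?invr_ge0.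
have v1 : 0 <= pos n v.1 by rewrite divr_ge0.
have v2 : 0 <= pos n v.2 by rewrite divr_ge0.
have E1 (pr : V -> nat) : g pr 0 = pos n (pr v) by rewrite /g clamp0 // mulr0 pl_le0.
have E2 (pr : V -> nat) : g pr 1 = pos n (pr w).
  by rewrite /g clamp1 // mulr1 pl_ge // /c nth_last /= ls.
exists (g fst), (g snd), L; split => //.
- rewrite /L; lra.
- split=> x y; [apply: (le_trans (lip fst p1 _ _))|apply: (le_trans (lip snd p2 _ _))];
  by rewrite ler_wpM2r // /L; lra.
- split=> x; [apply: (le_trans (bnd fst p1 x))|apply: (le_trans (bnd snd p2 x))]; rewrite /L; lra.
- move=> x; have [m0|m0] := posnP m.
    exists (c 0%N); first exact: Sc.
    by rewrite /g m0 /pl !big_ord0 !addr0 !subrr normr0 invr_ge0.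
  have [i [t [im t0 t1 _ E]]] := pl_cell (m%:R * clamp x) m0.
  exists (c i); first by apply: Sc; exact: ltnW.
  have aux (pr : V -> nat) : (forall a b, adj a b -> (pr a <= (pr b).+1)%N) ->
      `|g pr x - pos n (pr (c i))| <= n%:R^-1.
    move=> hpr; rewrite /g E.
    have -> : (1 - t) * pos n (pr (c i)) + t * pos n (pr (c i.+1)) - pos n (pr (c i)) =
      t * (pos n (pr (c i.+1)) - pos n (pr (c i))) by ring.
    rewrite normrM (ger0_norm t0); apply: le_trans (ler_piMl _ t1) _ => //.
    by apply: pos_adj => //; apply: hpr; rewrite ?adjc // adj_sym adjc.
  by split; [exact: (aux fst)|exact: (aux snd)].
Qed.

Lemma uc2_comp F (G1 G2 : R -> R -> R) (L : R) : uc2 F -> 0 <= L ->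
  (forall x x' y y', `|G1 x y - G1 x' y'| <= L * (`|x - x'| + `|y - y'|)) ->
  (forall x x' y y', `|G2 x y - G2 x' y'| <= L * (`|x - x'| + `|y - y'|)) ->
  uc2 (fun x y => F (G1 x y) (G2 x y)).
Proof.
move=> uF L0 h1 h2 e e0; have [dl d0 H] := uF e e0.
have L1 : 0 < 2 * (L + 1) by lra.
exists (dl / (2 * (L + 1))); first by rewrite divr_gt0.
move=> x x' y y' xx yy; have K : L * (`|x - x'| + `|y - y'|) < dl.
  move: xx yy; rewrite !ltr_pdivlMr // => xx yy.
  have := normr_ge0 (x - x'); have := normr_ge0 (y - y'); nra.
by apply: H; [apply: le_lt_trans (h1 _ _ _ _) K|apply: le_lt_trans (h2 _ _ _ _) K].
Qed.

Lemma lin_lip (L : R) (a b : R -> R) : 0 <= L ->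
  (forall x y, `|a x - a y| <= L * `|x - y|) -> (forall x y, `|b x - b y| <= L * `|x - y|) ->
  (forall x, `|a x| <= L) -> (forall x, `|b x| <= L) ->
  forall x x' y y', `|((1 - clamp y) * b x + clamp y * a x) -
      ((1 - clamp y') * b x' + clamp y' * a x')| <= (2 * L) * (`|x - x'| + `|y - y'|).
Proof.
move=> L0 la lb ba bb x x' y y'.
have -> : ((1 - clamp y) * b x + clamp y * a x) - ((1 - clamp y') * b x' + clamp y' * a x') =
  (1 - clamp y) * (b x - b x') + clamp y * (a x - a x') + (clamp y - clamp y') * (a x' - b x') by ring.
have c0 := clamp_ge0 y; have c1 := clamp_le1 y; have c1' : 0 <= 1 - clamp y by lra.
apply: (le_trans (ler_normD _ _)); rewrite [leRHS]mulrDr; apply: lerD.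
  apply: (le_trans (ler_normD _ _)); rewrite !normrM (ger0_norm c0) (ger0_norm c1').
  have := la x x'; have := lb x x'; have := normr_ge0 (x - x').
  have := normr_ge0 (a x - a x'); have := normr_ge0 (b x - b x').
  set p := `|_|; set q := `|_|; set r := `|_|; move=> *; nra.
rewrite normrM mulrC; apply: ler_pM => //; last exact: clamp_lip.
apply: (le_trans (ler_normB _ _)); have := ba x'; have := bb x'; lra.
Qed.

(* A low chain and a high chain with nearby ends span a square by straight lines; if the
   values of [F] at the two ends were far apart, this square would be a quad. *)
Lemma no_long_wall F n (z : X) (c1 c2 om th : R) (v0 v1 q0 q1 : V) :
  noquad -> uc2 F -> (0 < n)%N -> c1 < c2 -> 0 < om ->
  (forall x x' y y', `|x - x'| <= n%:R^-1 -> `|y - y'| <= n%:R^-1 ->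
     d (F x y) (F x' y') <= (c2 - c1) / 4) ->
  (forall x x' y y', `|x - x'| <= th -> `|y - y'| <= th -> d (F x y) (F x' y') <= om / 3) ->
  conn (fun v => d (F (pos n v.1) (pos n v.2)) z <= c1) v0 v1 ->
  conn (fun v => c2 <= d (F (pos n v.1) (pos n v.2)) z) q0 q1 ->
  `|pos n v0.1 - pos n q0.1| <= th -> `|pos n v0.2 - pos n q0.2| <= th ->
  `|pos n v1.1 - pos n q1.1| <= th -> `|pos n v1.2 - pos n q1.2| <= th ->
  d (F (pos n q0.1) (pos n q0.2)) (F (pos n q1.1) (pos n q1.2)) < om.
Proof.
move=> nq uF n0 c12 om0 osc1 oscth cB cA t1 t2 t3 t4; rewrite ltNge; apply/negP => far.
have [b1 [b2 [LB [LB0 [lb1 lb2] [bb1 bb2] [b10 b20 b11 b21] nB]]]] := chain_path n0 cB.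
have [a1 [a2 [LA [LA0 [la1 la2] [ba1 ba2] [a10 a20 a11 a21] nA]]]] := chain_path n0 cA.
pose L := LA + LB.
have w1 (K K' r : R) : 0 <= K' -> `|r| <= K -> `|r| <= K + K' by move=> *; slra.
have w2 (K K' r s : R) : 0 <= K' -> `|r| <= K * `|s| -> `|r| <= (K + K') * `|s|.
  by move=> k0 h; rewrite mulrDl; apply: w1 => //; rewrite mulr_ge0.
have L0 : 0 <= L by rewrite addr_ge0.
pose G1 x y := (1 - clamp y) * b1 x + clamp y * a1 x.
pose G2 x y := (1 - clamp y) * b2 x + clamp y * a2 x.
have uG : uc2 (fun x y => F (G1 x y) (G2 x y)).
  apply: (@uc2_comp _ _ _ (2 * L)) => //; first by rewrite mulr_ge0.
  - apply: lin_lip => //; rewrite /L.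
    + by move=> x y; apply: w2.
    + by move=> x y; rewrite (addrC LA); apply: w2.
    + by move=> x; apply: w1.
    + by move=> x; rewrite (addrC LA); apply: w1.
  - apply: lin_lip => //; rewrite /L.
    + by move=> x y; apply: w2.
    + by move=> x y; rewrite (addrC LA); apply: w2.
    + by move=> x; apply: w1.
    + by move=> x; rewrite (addrC LA); apply: w1.
(* The left and right sides stay within om / 3 of points at distance at least [om], which leaves om
   / 6 on either side of om / 2. The low and high sides miss [c1] and [c2] by at most a quarter of
   c2 - c1, which leaves a quarter on either side of the mean. *)
pose k := Num.min (om / 6) ((c2 - c1) / 4).
have k0 : 0 < k by rewrite lt_min; apply/andP; split; slra.
have k1 : k <= om / 6 by rewrite ge_min lexx.
have k2 : k <= (c2 - c1) / 4 by rewrite ge_min lexx orbT.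
have cvx (t p q th' : R) : 0 <= t <= 1 -> `|p - q| <= th' -> `|(1 - t) * p + t * q - q| <= th'.
  move=> /andP[t0 t1'] pq; have -> : (1 - t) * p + t * q - q = (1 - t) * (p - q) by ring.
  have h : 0 <= 1 - t by slra.
  rewrite normrM (ger0_norm h); apply: le_trans pq; rewrite ler_piMl //; slra.
apply: (nq _ uG z (F (pos n q0.1) (pos n q0.2)) ((c1 + c2) / 2) (om / 2) k k0) => t tt.
case/andP: (tt) => tt0 tt1.
rewrite /G1 /G2 (clamp0 (lexx 0)) (clamp1 (lexx 1)) (clamp_id tt0 tt1).
rewrite b10 b20 a10 a20 b11 b21 a11 a21 !subr0 !subrr !mul1r !mul0r !addr0 !add0r.
split.
- have := oscth _ _ _ _ (cvx t _ _ th tt t1) (cvx t _ _ th tt t2); slra.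
- have := oscth _ _ _ _ (cvx t _ _ th tt t3) (cvx t _ _ th tt t4).
  set p := F _ _ => h; have := metric_triangle (F (pos n q0.1) (pos n q0.2)) p (F (pos n q1.1) (pos n q1.2)).
  rewrite (metric_sym (F (pos n q0.1) (pos n q0.2)) p); slra.
- have [u Su [h1 h2]] := nB t; have := osc1 _ _ _ _ h1 h2.
  have := metric_triangle (F (b1 t) (b2 t)) (F (pos n u.1) (pos n u.2)) z; slra.
- have [u Su [h1 h2]] := nA t; have := osc1 _ _ _ _ h1 h2.
  rewrite metric_sym; have := metric_triangle (F (pos n u.1) (pos n u.2)) (F (a1 t) (a2 t)) z; slra.
Qed.

End Exit.

Lemma mono_stationary (g : nat -> nat) B : (forall j, g j <= g j.+1)%N -> (forall j, g j <= B)%N ->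
  exists2 j, (j <= B)%N & g j = g j.+1.
Proof.
move=> gm gB; apply: contrapT => no.
suff H j : (j <= B.+1)%N -> (j <= g j)%N by have := H B.+1 (leqnn _); have := gB B.+1; lia.
elim: j => // j IH jB; have := IH (ltnW jB); have := gm j.
have : g j <> g j.+1 by move=> E; apply: no; exists j.
lia.
Qed.

Lemma eq_divn_le k a b : (0 < k)%N -> (a %/ k = b %/ k)%N -> (a < b + k)%N.
Proof.
move=> k0 ab; rewrite {1}(divn_eq a k) ab {2}(divn_eq b k).
by rewrite -addnA ltn_add2l; apply: ltn_addl; exact: ltn_pmod.
Qed.

(** * Components of sublevel sets in a filled rectangle *)

Section Exit2.
Context {R : realType} {X : metricType R}.
Local Notation d := (@mdist R X).
Local Notation V := (nat * nat)%type.

Lemma nat_above (x : R) : exists2 n : nat, (0 < n)%N & x < n%:R.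
Proof. by exists (Num.truncn x).+1 => //; exact: truncnS_gt. Qed.

Lemma inv_below (x : R) : 0 < x -> exists2 n : nat, (0 < n)%N & n%:R^-1 < x.
Proof.
move=> x0; have [n n0 h] := nat_above x^-1; exists n => //.
have n1 : 0 < n%:R :> R by rewrite ltr0n.
by rewrite -[x]invrK ltf_pV2 // posrE invr_gt0.
Qed.

(* The levels are so numerous that two consecutive ones have the same pairs of cells joined
   by a low chain; this yields the low chain facing a wall of the upper level. *)
Lemma component_exit (F : R -> R -> X) (m N : nat) (z : X) (eps om : R) (y0 : nat) :
  @noquad R X -> uc2 F -> 0 < eps -> 0 < om -> (y0 <= N)%N -> d (F 0 y0%:R) z <= eps ->
  exists2 n : nat, (0 < n)%N & let f v := F (pos n v.1) (pos n v.2) in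
    (exists2 w : V, conn (fun v => inr (m * n) (N * n) v /\ d (f v) z <= 2 * eps) (0, y0 * n)%N w &
       [\/ w.1 = (m * n)%N, w.2 = 0%N | w.2 = (N * n)%N]) \/
    (exists l r, [/\ (l < y0 * n < r)%N, eps <= d (f (0, l)%N) z &
       conn (fun v => inr (m * n) (N * n) v /\ d (f (0, l)%N) (f v) < om) (0, l)%N (0, r)%N]).
Proof.
move=> nq uF e0 om0 y0N hz.
(* The order of choices matters: the coarse mesh [n0] comes from [om] and fixes the number [B] of
   pairs of cells, hence the number of levels and the gap [g] between them. The refinement [k] comes
   last and makes F vary little compared with [g]. *)
have om3 : 0 < om / 3 by slra.
have [d1 d10 osc1] := uF _ om3.
have [n0 n00 n0d] := inv_below d10.
pose cell := ('I_(m * n0).+1 * 'I_(N * n0).+1)%type.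
pose B := #|{: cell * cell}|; pose M := B.+1.
pose c (j : nat) : R := eps + eps * j%:R / M.+1%:R.
have M0 : 0 < M.+1%:R :> R by rewrite ltr0n.
pose g := eps / M.+1%:R; have g0 : 0 < g by rewrite divr_gt0.
have cS j : c j.+1 = c j + g by rewrite /c /g -natr1 mulrDr mulr1 mulrDl addrA.
have c_ge j : eps <= c j by rewrite /c lerDl !mulr_ge0 ?invr_ge0 // ltW.
have c_le j : (j <= M)%N -> c j <= 2 * eps.
  move=> jM; have h : j%:R / M.+1%:R <= 1 :> R by rewrite ler_pdivrMr // mul1r ler_nat; exact: leqW.
  have -> : 2 * eps = eps + eps by ring.
  by rewrite /c lerD2l -mulrA; exact: ler_piMr (ltW e0) h.
have g4 : 0 < g / 4 by slra.
have [d2 d20 osc2] := uF _ g4.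
have [k k0 kd] := inv_below d20.
pose n := (n0 * k)%N; have nn : (0 < n)%N by rewrite muln_gt0 n00.
have n0R : 0 < n0%:R :> R by rewrite ltr0n.
have kR : 0 < k%:R :> R by rewrite ltr0n.
have nR : 0 < n%:R :> R by rewrite ltr0n.
have nd : n%:R^-1 < d2.
  apply: le_lt_trans kd; rewrite lef_pV2 ?posrE // ler_nat /n; exact: leq_pmull.
exists n => // f.
pose C j v := inr (m * n) (N * n) v /\ d (f v) z <= c j.
have CS j v : C j v -> C j.+1 v by move=> [h1 h2]; split=> //; rewrite cS; slra.
pose S j := finset (fun tt : cell * cell => `[< exists v v', [/\ (v.1 %/ k = tt.1.1)%N, (v.2 %/ k = tt.1.2)%N,
   (v'.1 %/ k = tt.2.1)%N, (v'.2 %/ k = tt.2.2)%N & conn (C j) v v'] >]).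
have SS j : S j \subset S j.+1.
  apply/fintype.subsetP => tt; rewrite !finset.in_set => /asboolP[v [v' [h1 h2 h3 h4 h5]]]; apply/asboolP.
  by exists v, v'; split=> //; apply: conn_sub h5 => x; exact: CS.
have [||j jB Ej] := @mono_stationary (fun j => #|S j|) B.
- by move=> j; apply: subset_leq_card.
- by move=> j; exact: max_card.
have {Ej} ES : S j = S j.+1 by apply/eqP; rewrite eqEcard SS -Ej leqnn.
(* The component is taken at the higher level [j.+1]: walls around it have outer values at least c
   j.+1, while by [ES] the cells that it joins are also joined at level [j]. *)
pose K v := conn (C j.+1) (0, y0 * n)%N v.
have Kin v : K v -> C j.+1 v by exact: conn_end.
have [[w Kw hw]|no] := pselect (exists2 w, K w & [\/ w.1 = (m * n)%N, w.2 = 0%N | w.2 = (N * n)%N]).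
  left; exists w => //; apply: conn_sub Kw => v [h1 h2]; split=> //.
  apply: (le_trans h2); exact: c_le.
right.
have K1 b : (b <= N * n)%N -> ~ K (m * n, b)%N.
  by move=> _ h; apply: no; exists (m * n, b)%N => //; constructor 1.
have K2 a : (a <= m * n)%N -> ~ K (a, 0)%N.
  by move=> _ h; apply: no; exists (a, 0)%N => //; constructor 2.
have K3 a : (a <= m * n)%N -> ~ K (a, N * n)%N.
  by move=> _ h; apply: no; exists (a, N * n)%N => //; constructor 3.
have K0 : K (0, y0 * n)%N.
  apply: conn_refl; split; first by split=> //=; rewrite leq_mul2r y0N orbT.
  apply: le_trans (c_ge _); apply: le_trans hz; rewrite /f /pos /= mul0r natrM mulfK //.
  exact: lt0r_neq0.
have y0n : (y0 * n <= N * n)%N by rewrite leq_mul2r y0N orbT.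
have [p [q [p' [q' [l [r [[W Eq Eq'] lr]]]]]]] := wall_bottom K1 K2 K3 y0n K0.
have outK p1 q1 : K p1 -> ~ K q1 -> adj p1 q1 -> inr (m * n) (N * n) q1 -> c j.+1 <= d (f q1) z.
  move=> Kp Kq pq iq; rewrite leNgt; apply/negP => h; apply: Kq.
  by apply: conn_step Kp pq _; split=> //; exact: ltW.
pose QS v := [/\ inr (m * n) (N * n) v, c j.+1 <= d (f v) z & exists p1, wall (m * n) (N * n) K (p, q) (p1, v)].
have inv ea eb : wall (m * n) (N * n) K ea eb -> ea = (p, q) ->
   [/\ K eb.1, ~ K eb.2, adj eb.1 eb.2, conn (C j.+1) p eb.1 & conn QS q eb.2].
  elim=> {ea eb}.
  - move=> p1 q1 Kp Kq pq ip iq [E1 E2]; subst p1 q1; split=> //=.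
      by apply: conn_refl; exact: Kin.
    apply: conn_refl; split=> //; first exact: outK Kp Kq pq iq.
    by exists p; exact: wall0.
  - move=> e p1 q1 q2 W1 IH Kq2 pq2 qq2 iq2 E; have [Kp1 Kq1 a1 cp cq] := IH E; split=> //.
    apply: (conn_step cq qq2); split=> //; first exact: outK Kp1 Kq2 pq2 iq2.
    by exists p1; rewrite -E; exact: (wallq W1 Kq2 pq2 qq2 iq2).
  - move=> e p1 p2 q1 W1 IH Kp2 pq2 pp2 ip2 E; have [Kp1 Kq1 a1 cp cq] := IH E; split=> //.
    by apply: conn_step cp pp2 _; exact: Kin.
have sub_pos a b x : (a %/ k = b %/ k)%N -> (b <= x.+1)%N -> (x <= b.+1)%N ->
    `|pos n a - pos n x| <= n0%:R^-1 :> R.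
  move=> ab bx xb.
  have h1 : (a <= x + k)%N by move: (eq_divn_le k0 ab) bx xb; clear; lia.
  have h2 : (x <= a + k)%N by move: (eq_divn_le k0 (esym ab)) bx xb; clear; lia.
  have -> : n0%:R^-1 = k%:R / n%:R :> R.
    by rewrite /n natrM invfM mulrCA mulfV ?mulr1 // lt0r_neq0.
  rewrite /pos -mulrBl normrM [`|n%:R^-1|]ger0_norm ?invr_ge0 ?(ltW nR) //.
  rewrite ler_pM2r ?invr_gt0 // ler_norml; move: h1 h2; rewrite -!(ler_nat R) !natrD => *.
  by apply/andP; split; slra.
have cellP v : inr (m * n) (N * n) v -> exists t : cell, (v.1 %/ k = t.1)%N /\ (v.2 %/ k = t.2)%N.
  move=> [v1 v2].
  have h1 : (v.1 %/ k < (m * n0).+1)%N.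
    by rewrite ltnS -(mulnK (m * n0) k0) leq_div2r // -mulnA.
  have h2 : (v.2 %/ k < (N * n0).+1)%N.
    by rewrite ltnS -(mulnK (N * n0) k0) leq_div2r // -mulnA.
  by exists (Ordinal h1, Ordinal h2).
(* The inner side of the wall joins the cells of [p] and [p1] at level [j.+1], so some chain joins
   the same cells at level [j]. It is lower than the outer side of the wall by the gap [g], and its
   ends are within 1 / n0 of those of the outer side, as [no_long_wall] requires. *)
have small v : QS v -> d (f q) (f v) < om.
  move=> [iv hv [p1 W1]]; have [/= Kp1 _ a1 cp cq] := inv _ _ W1 erefl.
  have W0 : K p /\ adj p q.
    have aux ea eb : wall (m * n) (N * n) K ea eb -> K ea.1 /\ adj ea.1 ea.2 by elim.
    exact: aux W1.
  case: W0 => Kp apq.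
  have [t [t1 t2]] := cellP p (Kin _ Kp).1; have [t' [t1' t2']] := cellP p1 (Kin _ Kp1).1.
  have : (t, t') \in S j.+1 by rewrite finset.in_set; apply/asboolP; exists p, p1.
  rewrite -ES finset.in_set => /asboolP[v0 [v1 [/= h1 h2 h3 h4 h5]]].
  have /and4P[b1 b2 b3 b4] := apq; have /and4P[b1' b2' b3' b4'] := a1.
  apply: (@no_long_wall _ _ F n z (c j) (c j.+1) om n0%:R^-1 v0 v1 q v) => //.
  - by rewrite cS; slra.
  - move=> x x' y y' xx yy; rewrite cS; apply: ltW; have -> : (c j + g - c j) / 4 = g / 4 by slra.
    by apply: osc2; apply: le_lt_trans nd.
  - by move=> x x' y y' xx yy; apply: ltW; apply: osc1; apply: le_lt_trans n0d.
  - by apply: conn_sub h5 => x [].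
  - by apply: conn_sub cq => x [].
  - by apply: (sub_pos _ p.1); rewrite ?h1 ?t1.
  - by apply: (sub_pos _ p.2); rewrite ?h2 ?t2.
  - by apply: (sub_pos _ p1.1); rewrite ?h3 ?t1'.
  - by apply: (sub_pos _ p1.2); rewrite ?h4 ?t2'.
have [/= Kp' Kq' a' cp cq] := inv _ _ W erefl.
exists l, r; split=> //.
  have [_ h _] := conn_start cq; rewrite -Eq; apply: le_trans h; exact: c_ge.
rewrite -Eq -Eq'; apply: conn_sub cq => v Qv; split; first by case: Qv.
exact: small.
Qed.

End Exit2.

(** * Weak homotopy and its stability under limits *)

Section Limits.
Context {R : realType} {X : metricType R}.
Local Notation d := (@mdist R X).
Implicit Types (P Q : R -> X) (A B : R -> seq X).

(** Compactness of [a, b], for conditions that get stronger as [n] decreases: the supremum of the x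
    to the right of which there are solutions at every scale is a cluster point of solutions. *)
Lemma cluster_itv (A : R -> R -> Prop) (a b : R) :
  (forall n n' t, 0 < n' -> n' <= n -> A n' t -> A n t) ->
  (forall n, 0 < n -> exists2 t, a <= t <= b & A n t) ->
  exists2 t0, a <= t0 <= b & forall n, 0 < n -> exists t, [/\ a <= t <= b, `|t - t0| < n & A n t].
Proof.
move=> mon ex.
pose E := [set x | a <= x <= b /\ forall n, 0 < n -> exists2 t, x <= t <= b & A n t].
have [t1 /andP[at1 t1b] _] := ex 1 ltr01.
have Ea : E a by split; [rewrite lexx (le_trans at1)|].
have ubE : ubound E b by move=> x [/andP[]].
have hs : has_sup E by split; [exists a|exists b].
have aS : a <= sup E by apply: sup_upper_bound.
have Sb : sup E <= b by apply: ge_sup => //; exists a.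
exists (sup E); first by rewrite aS Sb.
move=> n n0; have [x [xab Ex] xS] := sup_adherent n0 hs.
have xle : x <= sup E by apply: sup_upper_bound.
case/andP: xab => ax xb.
have [bS|Sb'] := leP b (sup E + n / 2).
  have [t /andP[xt tb] At] := Ex n n0; exists t; split=> //; first by rewrite tb (le_trans ax).
  by rewrite ltr_norml; apply/andP; split; slra.
have nE : ~ E (sup E + n / 2).
  by move=> /(sup_upper_bound hs); slra.
have [n1 [n10 no]] : exists n1, 0 < n1 /\ forall t, sup E + n / 2 <= t -> t <= b -> ~ A n1 t.
  apply: contrapT => H; apply: nE; split; first by apply/andP; split; slra.
  move=> n1 n10; apply: contrapT => H1; apply: H; exists n1; split=> // t t1' t2 At.
  by apply: H1; exists t => //; rewrite t1' t2.
have m0 : 0 < Num.min n n1 by rewrite lt_min n0.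
have [t /andP[xt tb] At] := Ex _ m0.
have tn : t < sup E + n / 2.
  by rewrite ltNge; apply/negP => h; apply: (no t h tb); apply: mon At; rewrite // ge_min lexx orbT.
exists t; split=> //; first by rewrite tb (le_trans ax).
  by rewrite ltr_norml; apply/andP; split; slra.
by apply: mon At => //; rewrite ge_min lexx.
Qed.

(* Weak homotopy of families of chains indexed by the scale. *)
Definition W A B := forall e, 0 < e -> ht e (A e) (B e).
Definition coh A := forall e e', 0 < e -> e <= e' -> ht e' (A e) (A e').

Lemma W_sym A B : W A B -> W B A.
Proof. by move=> H e e0; apply/ht_sym/H. Qed.

Lemma W_trans B A C : W A B -> W B C -> W A C.
Proof. by move=> H1 H2 e e0; apply: ht_trans (H1 _ e0) (H2 _ e0). Qed.

Lemma coh_nil : coh (fun _ => [::]).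
Proof. by move=> *; exact: ht_refl. Qed.

Lemma coh_ch P u v : uc P -> u <= v -> coh (samples P u v).
Proof. by move=> uP uv e e' e0 ee; apply: ch_le. Qed.

Lemma ch_close P e : uc P -> 0 < e -> exists2 rho, 0 < rho &
  forall u s s', u <= s -> u <= s' -> `|s - s'| < rho ->
    nr e (P s) (P s') /\ ht e (ch e P u s ++ [:: P s']) (ch e P u s').
Proof.
move=> uP e0; have [dl d0 H] := uc_osc_lt uP e0; exists dl => // u s s' us us' ss.
have ss2 : s - s' < dl /\ s' - s < dl by move: ss; rewrite ltr_norml => /andP[]; split; lra.
case: ss2 => h1 h2; have [le|/ltW le] := leP s s'.
  have f := H _ _ le h2; split; first by apply: f.2; rewrite lexx le.
  apply: ht_sym; apply: (ht_trans (ht_sym (ch_cat uP e0 us le))).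
  apply: (ht_trans (ht_catl _ (ch_small f))).
  by have [q ->] := ch_rcons uP e0 us; exact: ht_glue.
have f := H _ _ le h1; have n1 : nr e (P s) (P s') by apply: f.2; rewrite lexx le.
split=> //; apply: (ht_trans (ht_catr _ (ht_sym (ch_cat uP e0 us' le)))).
apply: (ht_trans (ht_catr _ (ht_catl _ (ch_small f)))).
have [q ->] := ch_rcons uP e0 us'; rewrite -catA.
apply: (ht_trans (ht_glue _ _ _ _)); rewrite -cats1 -catA; apply: ht_catl => /=.
apply: (ht_trans (ht_del0 _ _ _ _)) => //; first exact: nrxx.
  by rewrite nr_sym.
exact: ht_dup0.
Qed.

Lemma W_last A B P Q u s w s' : uc P -> uc Q -> u <= s -> w <= s' ->
  W (fun e => A e ++ ch e P u s) (fun e => B e ++ ch e Q w s') -> P s = Q s'.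
Proof.
move=> uP uQ us ws' /(_ 1 ltr01) /(ht_last (P s)).
by rewrite !last_cat !ch_last.
Qed.

Lemma ht_del_mid e (q t : seq X) (x y z : X) : nr e x z -> nr e x y -> nr e y z ->
  ht e (rcons q x ++ [:: y, z & t]) (rcons q x ++ z :: t).
Proof.
by move=> *; rewrite -cats1 -!catA /=; apply: ht_catl; exact: ht_del0.
Qed.

(** Weak homotopy is tested at positive scales only, hence is closed: a relation at scale [n]
    between points near the ends gives one at scale e between the ends, once [n] is at most e / 2
    and both paths move little in between. *)
Lemma W_limit A B P Q u w s s' : coh A -> coh B -> uc P -> uc Q -> u <= s -> w <= s' ->
  (forall n, 0 < n -> exists s1 s2, [/\ u <= s1, w <= s2, `|s1 - s| < n, `|s2 - s'| < n &
     nr n (P s1) (Q s2) /\ ht n (B n ++ ch n Q w s2) (A n ++ ch n P u s1 ++ [:: Q s2])]) ->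
  W (fun e => A e ++ ch e P u s) (fun e => B e ++ ch e Q w s').
Proof.
move=> cA cB uP uQ us ws' H.
have E : P s = Q s'.
  apply: contrapT => ne.
  have d0 : 0 < d (P s) (Q s') by rewrite mdist_gt0; apply/eqP.
  have d3 : 0 < d (P s) (Q s') / 3 by slra.
  have [r1 r10 c1] := uP _ d3; have [r2 r20 c2] := uQ _ d3.
  pose n := Num.min (d (P s) (Q s') / 3) (Num.min r1 r2).
  have n0 : 0 < n by rewrite !lt_min d3 r10.
  have [s1 [s2 [_ _ h1 h2 [h3 _]]]] := H n n0.
  move: h1 h2 h3; rewrite /n /nr !lt_min => /and3P[_ h1 _] /and3P[_ _ h2] /and3P[h3 _ _].
  have := c1 _ _ h1; have := c2 _ _ h2; have := metric_triangle (P s) (P s1) (Q s').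
  have := metric_triangle (P s1) (Q s2) (Q s'); rewrite (metric_sym (P s) (P s1)); slra.
move=> e e0; have e2 : 0 < e / 2 by slra.
have [r1 r10 c1] := ch_close uP e2; have [r2 r20 c2] := ch_close uQ e2.
pose n := Num.min (e / 2) (Num.min r1 r2).
have n0 : 0 < n by rewrite !lt_min e2 r10.
have ne : n <= e / 2 by rewrite ge_min lexx.
have [s1 [s2 [us1 ws2 h1 h2 [h3 h4]]]] := H n n0.
move: h1 h2; rewrite /n !lt_min => /and3P[_ h1 _] /and3P[_ _ h2].
have [k1 k2] := c1 u s1 s us1 us h1; have [k3 k4] := c2 w s2 s' ws2 ws' h2.
have ee : e / 2 <= e by slra.
have nee : n <= e by slra.
have LA := ch_le uP e2 ee us; have LB := ch_le uQ e2 ee ws'.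
apply: ht_sym.
apply: (@ht_trans _ _ _ (B e ++ ch (e / 2) Q w s')); first by apply: ht_catl; exact: ht_sym.
apply: (@ht_trans _ _ _ (B e ++ ch (e / 2) Q w s2 ++ [:: Q s'])).
  by apply: ht_catl; apply: ht_le ee _; exact: ht_sym.
apply: (@ht_trans _ _ _ ((B n ++ ch n Q w s2) ++ [:: Q s'])).
  rewrite catA; apply: ht_catr; apply: ht_sym; apply: ht_cat; first exact: cB.
  by apply: ht_le ee _; exact: ch_le.
apply: (ht_trans (ht_catr _ (ht_le nee h4))).
apply: (@ht_trans _ _ _ (A e ++ ch (e / 2) P u s)); last first.
  by apply: ht_catl.
rewrite -!catA; apply: ht_cat; first exact: cA.
apply: (@ht_trans _ _ _ (ch n P u s1 ++ [:: Q s'])).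
  have [q ->] := ch_rcons uP n0 us1; apply: ht_del_mid.
  - by apply: nr_le ee _; rewrite -E.
  - exact: nr_le nee h3.
  - exact: nr_le ee k3.
apply: ht_le ee _; rewrite -E; apply: ht_trans k2; apply: ht_catr; exact: ch_le.
Qed.

End Limits.

(** * Lifted points of reduced paths cannot be avoided *)

Section Unavoid.
Context {R : realType} {X : metricType R}.
Local Notation d := (@mdist R X).
Local Notation V := (nat * nat)%type.
Implicit Types (P : R -> X).

Definition grid_filling := forall eps : R, 0 < eps -> exists2 dl : R, 0 < dl &
  forall m N (q : nat -> nat -> X),
    (forall i j, (i < m)%N -> nr dl (q i j) (q i.+1 j)) ->
    (forall i j, (i <= m)%N -> nr dl (q i j) (q i j.+1)) ->
    exists2 F, uc2 F & forall i j (x y : R), (i <= m)%N -> (j <= N)%N ->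
      i%:R <= x <= i.+1%:R -> j%:R <= y <= j.+1%:R -> d (F x y) (q i j) < eps.

(** That the loop of [P] on [s, t] is weakly null is expressed by comparing two prefixes from [u],
    the form in which lifted points are compared everywhere else. *)
Definition reduced P u v := forall s t, u <= s -> s <= t -> t <= v ->
  W (samples P u s) (samples P u t) -> forall x, s <= x <= t -> P x = P s.

Lemma ball_collapse e (z x y : X) l : (forall a, a \in x :: rcons l y -> d a z < e / 2) ->
  ht e (x :: rcons l y) [:: x; y].
Proof.
move=> H; apply: ht_collapse => a b /H ha /H hb; rewrite /nr.
have := metric_triangle a z b; rewrite (metric_sym z b); lra.
Qed.

Lemma locate (tau : nat -> R) n t : tau 0%N <= t -> t <= tau n.+1 ->
  exists2 j, (j <= n)%N & tau j <= t <= tau j.+1.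
Proof.
move=> t0; elim: n => [|n IH] tn; first by exists 0%N => //; rewrite t0.
have [/IH [j jn h]|h] := leP t (tau n.+1); first by exists j => //; exact: leqW.
by exists n.+1 => //; rewrite tn ltW.
Qed.

Lemma part_osc_lt e P u l v : 0 < e -> part e P u l v ->
  forall k, osc_lt e P (nth v (u :: l) k) (nth v (u :: l) k.+1).
Proof.
move=> e0; elim: l u => [|t l IH] u /=.
  move=> -> k; have -> : nth v [:: v] k = v by case: k => // k; rewrite nth_default.
  rewrite (nth_default v (s := [::])) //; split=> // x y hx hy.
  have -> : x = v by apply/eqP; rewrite eq_le andbC.
  have -> : y = v by apply/eqP; rewrite eq_le andbC.
  by rewrite mdistxx.
by move=> [f L] [|k]; [|exact: IH].
Qed.

Lemma part_tau e P (tau : nat -> R) i j : (forall k, osc_lt e P (tau k) (tau k.+1)) ->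
  part e P (tau i) [seq tau k | k <- iota i.+1 j] (tau (i + j)%N).
Proof.
move=> f; elim: j i => [|j IH] i /=; first by rewrite addn0.
by split=> //; rewrite -addSnnS.
Qed.

Lemma tau_mono e P (tau : nat -> R) i j : (forall k, osc_lt e P (tau k) (tau k.+1)) -> (i <= j)%N -> tau i <= tau j.
Proof. by move=> f /subnKC <-; exact: part_le (part_tau i (j - i) f). Qed.

Lemma fnx_map P x0 u l v j : last u l = v -> fnx (map P (u :: l)) x0 j = P (nth v (u :: l) j).
Proof.
move=> lv; rewrite /fnx /= -/(map P (u :: l)) last_map lv.
have [jl|jl] := ltnP j (size (u :: l)); first by rewrite (nth_map v).
by rewrite !nth_default ?size_map.
Qed.

Definition rnd n (v : V) : V := (v.1 %/ n, v.2 %/ n)%N.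

Lemma divn_step n a b : (0 < n)%N -> (a <= b.+1)%N -> (a %/ n <= (b %/ n).+1)%N.
Proof.
move=> n0 ab; apply: (leq_trans (leq_div2r n ab)).
rewrite -[X in (_ <= X)%N](mulnK _ n0); apply: leq_div2r; exact: ltn_ceil.
Qed.

Lemma rnd_conn n S v w : (0 < n)%N -> conn S v w -> exists c, [/\ path king (rnd n v) c,
  last (rnd n v) c = rnd n w & forall x, x \in rnd n v :: c -> exists2 v', S v' & x = rnd n v'].
Proof.
move=> n0 [s [ps ls Ss]]; exists (map (rnd n) s); split.
- rewrite path_map; apply: sub_path ps => a b /and4P[h1 h2 h3 h4].
  by rewrite /king /= !divn_step.
- by rewrite last_map ls.
- by move=> x; rewrite -map_cons => /mapP[v' /Ss Sv' ->]; exists v'.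
Qed.

Lemma pos_rnd n a : (0 < n)%N -> ((a %/ n)%N%:R : R) <= (pos n a : R) <= (a %/ n).+1%:R.
Proof.
move=> n0; have nR : 0 < n%:R :> R by rewrite ltr0n.
rewrite /pos ler_pdivlMr // ler_pdivrMr // -!natrM !ler_nat leq_trunc_div /=.
by rewrite ltnW // ltn_ceil.
Qed.

(** Closeness of [L] to a lifted point: besides an entry near P t, the part of [L] up to it must be
    in the class of the prefix of [P]. Passing by P t in another class does not count. *)
Definition meets P u t (n : R) (L : seq X) := exists L1 x L2,
  [/\ L = L1 ++ x :: L2, nr n x (P t) & ht n (ch n P u t) (L1 ++ [:: x; P t])].

Lemma pre_take (q : nat -> nat -> X) i (L : seq X) x0 j e : (forall j, q i j = fnx L x0 j) ->
  (0 < size L)%N -> exists j', [/\ (j' < size L)%N, q i j = nth x0 L j' &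
    ht e (pre q i j) (take j' L ++ [:: nth x0 L j'])].
Proof.
move=> qi L0.
suff [h1 h2] : q i j = nth x0 L (minn j (size L).-1) /\
    ht e (pre q i j) (take (minn j (size L).-1) L ++ [:: nth x0 L (minn j (size L).-1)]).
  by exists (minn j (size L).-1); split=> //; move: L0; clear; lia.
elim: j => [|j [qj H]].
  rewrite min0n take0 qi fnx_head nth0; split=> //.
  by rewrite /pre /mkseq /= qi fnx_head; exact: ht_refl.
have [jL|jL] := ltnP j.+1 (size L).
  have -> : minn j.+1 (size L).-1 = j.+1 by move: jL; clear; lia.
  split; first by rewrite qi /fnx; exact: set_nth_default.
  have -> : pre q i j.+1 = take j.+1 L ++ [:: nth x0 L j.+1]; last exact: ht_refl.
  rewrite cats1 -take_nth // /pre; apply: (@eq_from_nth _ x0).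
    by rewrite size_mkseq size_takel.
  move=> k; rewrite size_mkseq => kj; rewrite nth_mkseq // nth_take // qi /fnx.
  apply: set_nth_default; exact: leq_trans kj jL.
have E : minn j.+1 (size L).-1 = minn j (size L).-1 by move: jL L0; clear; lia.
have E2 : minn j (size L).-1 = (size L).-1 by move: jL L0; clear; lia.
have E3 : q i j.+1 = q i j by rewrite qi fnx_last // qj E2 nth_last; case: (L) L0.
rewrite E E3; split=> //; apply: ht_trans H; rewrite preS E3.
have [s ->] := pre_rcons q i j; rewrite -cats1 -!cats1 -catA; apply: ht_catl; exact: ht_dup0.
Qed.

(** Suppose that chains avoid the lifted point at arbitrarily small scales. The homotopy to such a
    chain is a grid, filled by a map of a rectangle. A component of a sublevel set around the point
    over [t] reaches neither the side of [L] nor a constant side, so a wall cuts it off. The wall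
    makes a piece of [P] around [t] almost null; in the limit it is weakly null, and [P] would be
    constant there. *)
Lemma unavoid P u v t : @noquad R X -> grid_filling -> uc P -> reduced P u v -> u <= t -> t <= v ->
  forall n, 0 < n -> exists2 e, 0 < e & forall L, ht e (ch e P u v) L -> meets P u t n L.
Proof.
move=> nq gf uP rP ut tv n0 n00; apply: contrapT => bad.
have {}bad e : 0 < e -> exists2 L, ht e (ch e P u v) L & ~ meets P u t n0 L.
  move=> e0; apply: contrapT => H; apply: bad; exists e => // L hL; apply: contrapT => H'.
  by apply: H; exists L.
have uv : u <= v by apply: le_trans tv.
pose ep := n0 / 8; have ep0 : 0 < ep by rewrite /ep; slra.
(* The last clause excludes trivial solutions such as s = s' = t and yields the contradiction in the
   limit. *)
pose A n s s' := [/\ nr n (P s) (P s'), ht n (ch n P u s') (ch n P u s ++ [:: P s']) &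
  ep / 2 <= d (P s) (P t)].
have key n : 0 < n -> exists s s', [/\ u <= s, s <= t, t <= s', s' <= v & A n s s'].
  move=> n1; pose e1 := Num.min ep n / 8.
  have e10 : 0 < e1 by rewrite /e1 divr_gt0 // lt_min ep0.
  have e1e : e1 <= ep / 8 by rewrite /e1 ler_pM2r ?invr_gt0 // ge_min lexx.
  have e1n : e1 <= n / 8 by rewrite /e1 ler_pM2r ?invr_gt0 // ge_min lexx orbT.
  have [dl dl0 AAF] := gf _ e10.
  pose e := Num.min dl e1 / 2.
  have e0 : 0 < e by rewrite /e divr_gt0 // lt_min dl0.
  have [edl ee1] : e <= dl /\ e <= e1 / 2.
    have h : Num.min dl e1 <= dl by rewrite ge_min lexx.
    have h' : Num.min dl e1 <= e1 by rewrite ge_min lexx orbT.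
    by move: e0; rewrite /e; split; slra.
  have [L hL nL] := bad e e0.
  have [l L0 Ech] := chP uP e0 uv.
  have srt := ch_near uP e0 uv.
  have [m [q [q0 qm qv qh [qc [N' qN]]]]] := ht_rows (P u) e0 srt hL.
  pose tau := nth v (u :: l).
  have tf k : osc_lt e P (tau k) (tau k.+1) by exact: part_osc_lt L0 k.
  have q0t j : q 0%N j = P (tau j) by rewrite q0 Ech (fnx_map _ _ _ (part_last L0)).
  have sL : (0 < size L)%N.
    by have := ht_size0 hL; rewrite Ech /=; case: (L).
  have tauv k : tau (size l + k.+1)%N = v by rewrite /tau nth_default //= addnS leq_addr.
  have [j0 j0l /andP[tj0 tj1]] : exists2 j, (j <= size l)%N & tau j <= t <= tau j.+1.
    by apply: locate => //; rewrite -addn1 tauv.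
  pose N := (maxn N' (size l).+1)%N.
  have j0N : (j0 <= N)%N by rewrite /N leq_max (leqW j0l) orbT.
  have qvd i j : (i < m)%N -> nr dl (q i j) (q i.+1 j) by move=> im; exact: nr_le edl (qv _ _ im).
  have qhd i j : (i <= m)%N -> nr dl (q i j) (q i j.+1) by move=> im; exact: nr_le edl (qh _ _ im).
  have [F uF hF] := AAF m N q qvd qhd.
  have h00 : d (F 0 j0%:R) (q 0%N j0) < e1 by apply: hF => //; rewrite lexx ?ler01 ?ler_nat //=.
  have tjt : d (P (tau j0)) (P t) < e by apply: (tf j0).2; rewrite ?lexx ?tj0 //= (le_trans tj0).
  have hz : d (F 0 j0%:R) (P t) <= ep.
    by have := metric_triangle (F 0 j0%:R) (q 0%N j0) (P t); rewrite q0t in h00 *; slra.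
  have [k k0 /= res] := component_exit m nq uF ep0 e10 j0N hz.
  pose f (v : V) := F (pos k v.1) (pos k v.2).
  pose qr (v : V) := q (rnd k v).1 (rnd k v).2.
  have rin w : inr (m * k) (N * k) w -> ((rnd k w).1 <= m)%N /\ ((rnd k w).2 <= N)%N.
    move=> [w1 w2]; split=> /=.
      by rewrite -[X in (_ <= X)%N](mulnK m k0) leq_div2r.
    by rewrite -[X in (_ <= X)%N](mulnK N k0) leq_div2r.
  have fq w : inr (m * k) (N * k) w -> d (f w) (qr w) < e1.
    move=> iw; have [w1 w2] := rin _ iw; apply: hF => //; exact: pos_rnd.
  have qcc i : (i <= m)%N -> q i 0%N = q 0%N 0%N by move=> im; rewrite !qc.
  have prech j : ht e (pre q 0 j) (ch e P u (tau j)).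
    apply: ht_sym; have -> : pre q 0 j = map P (u :: [seq tau k | k <- iota 1 j]).
      by rewrite /pre /mkseq /= q0t -map_comp; congr cons; apply: eq_map => i /=; rewrite q0t.
    by apply: ch_ht; exact: (part_tau 0 j tf).
  have een : e + e <= n /\ e + e <= n0 by split; move: ep0; rewrite /ep in e1e *; slra.
  case: een => een een0.
  have utau j : u <= tau j by exact: (tau_mono (i := 0%N) tf).
  have tauv' j : tau j <= v.
    have -> : v = tau (size l + j.+1)%N by rewrite tauv.
    by apply: (tau_mono tf); move: (size l) => sl; clear; lia.
  have lq := lat_path e0 qv qh qcc.
  case: res => [[w cw hw]|[a [b [ab hfa cw]]]].
    (* First case: a path from the point over [t] stays in a small ball and ends on the row of [L],
       possibly after sliding along a constant column. Then [L] meets the lifted point. *)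
    exfalso; apply: nL.
    have [c [pc lc cin]] := rnd_conn k0 cw.
    have E0 : rnd k (0, j0 * k)%N = (0, j0)%N by rewrite /rnd /= div0n mulnK.
    rewrite E0 in pc lc cin.
    have inw := (conn_end cw).1; have [rw1 rw2] := rin _ inw.
    have call : all (fun b => b.1 <= m)%N c.
      apply/allP => x xc; have [|v' [iv' _] ->] := cin x; first by rewrite inE xc orbT.
      by have [] := rin _ iv'.
    have H1 := lq (0, j0)%N c (leq0n m) call pc; rewrite lc /= in H1.
    have [jw H2] : exists jw, ht (e + e) (pre q (rnd k w).1 (rnd k w).2) (pre q m jw).
      case: hw => hw.
      - exists (rnd k w).2; rewrite /rnd hw mulnK //; exact: ht_refl.
      - exists 0%N; rewrite /rnd hw /= div0n /pre /mkseq /= !qc //; exact: ht_refl.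
      - exists N; rewrite {2}/rnd hw /= mulnK //.
        move: rw1; set i := (w.1 %/ k)%N => im.
        have -> : m = (i + (m - i))%N by rewrite subnKC.
        have : (i + (m - i) <= m)%N by rewrite subnKC.
        elim: (m - i)%N => [|h IH] ih; first by rewrite addn0; exact: ht_refl.
        rewrite addnS in ih *; apply: (ht_trans (IH (ltnW ih))).
        apply: ht_trans (lat_up e0 qv qh qcc N ih).
        have -> : q (i + h).+1 N = q (i + h)%N N by rewrite !qN // ?leq_maxl // ltnW.
        have [s ->] := pre_rcons q (i + h)%N N; rewrite -cats1 -!cats1 -catA; apply: ht_catl.
        exact/ht_sym/ht_dup0.
    have [jL [jLs _ H3]] := @pre_take q m L (P u) jw (e + e) qm sL.
    set x := nth (P u) L jL in H3.
    have EL : L = take jL L ++ x :: drop jL.+1 L by rewrite -drop_nth // cat_take_drop.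
    have H : ht (e + e) (pre q 0 j0 ++ [seq q b.1 b.2 | b <- c]) (take jL L ++ [:: x]).
      exact: ht_trans H1 (ht_trans H2 H3).
    have ball y : y \in q 0%N j0 :: [seq q b.1 b.2 | b <- c] -> d y (P t) < n0 / 2.
      rewrite -[_ :: _]/(map (fun b : V => q b.1 b.2) ((0, j0)%N :: c)) => /mapP[b /cin [v' [iv' hv'] ->] ->].
      have := fq _ iv'; rewrite -/(f v') in hv'; rewrite -/(qr v') metric_sym => h.
      have := metric_triangle (qr v') (f v') (P t); rewrite /ep in hv' e1e ep0; slra.
    have ex : nr n0 x (P t).
      have [s Es] := pre_rcons q 0 j0.
      have := ht_last (P u) H; rewrite Es !last_cat last_rcons /= => <-.
      have := ball (last (q 0%N j0) [seq q b.1 b.2 | b <- c]) (mem_last _ _).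
      by rewrite /nr; move: n00; slra.
    exists (take jL L), x, (drop jL.+1 L); split=> //.
    rewrite -[take jL L ++ _]/(take jL L ++ [:: x] ++ [:: P t]) catA.
    apply: ht_trans (ht_catr _ (ht_le een0 H)).
    have [s Es] := pre_rcons q 0 j0; rewrite Es -!catA -cats1 -catA /=.
    apply: (@ht_trans _ _ _ (s ++ [:: q 0%N j0; P t])); last first.
      apply: ht_catl; apply: ht_sym; rewrite cats1; apply: (ball_collapse (z := P t)) => y.
      rewrite -rcons_cons mem_rcons inE => /orP[/eqP->|/ball//]; rewrite mdistxx; move: n00; slra.
    have -> : s ++ [:: q 0%N j0; P t] = pre q 0 j0 ++ [:: P t] by rewrite Es -cats1 -catA.
    have en0 : e <= n0 by move: e0 een0; slra.
    apply: ht_sym; apply: (ht_trans (ht_catr _ (ht_le en0 (prech j0)))).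
    have f1 : osc_lt e P (tau j0) t by apply: osc_lt_sub (tf j0) _ _ _.
    apply: (@ht_trans _ _ _ (ch e P u t)); last exact: ch_le.
    apply: ht_le en0 _; apply: ht_trans (ch_cat uP e0 (utau j0) tj0).
    apply: ht_sym; apply: (ht_trans (ht_catl _ (ch_small f1))).
    have [s' ->] := ch_rcons uP e0 (utau j0); exact: ht_glue.
  (* Second case: the whole wall is mapped near f (0, a), so the part of [P] between its two ends
     collapses at scale [n]. The right end is taken at [jb.+1], since t <= tau jb might fail when jb
     = j0. *)
  have [c [pc lc cin]] := rnd_conn k0 cw.
  have Ea : rnd k (0, a)%N = (0, a %/ k)%N by rewrite /rnd /= div0n.
  have Eb : rnd k (0, b)%N = (0, b %/ k)%N by rewrite /rnd /= div0n.
  rewrite Ea Eb in pc lc cin.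
  set ja := (a %/ k)%N in pc lc cin; set jb := (b %/ k)%N in lc.
  case/andP: ab => aj jb'.
  have jaj : (ja < j0)%N by rewrite /ja ltn_divLR.
  have jbj : (j0 <= jb)%N by rewrite /jb leq_divRL // ltnW.
  exists (tau ja), (tau jb.+1).
  have t1 : tau ja <= t by apply: le_trans tj0; apply: (tau_mono tf); exact: ltnW.
  have t2 : t <= tau jb.+1 by apply: le_trans tj1 _; apply: (tau_mono tf).
  split=> //.
  have Ra : inr (m * k) (N * k) (0, a)%N := (conn_start cw).1.
  have fa := fq _ Ra; rewrite /qr Ea /= in fa.
  have ball y : y \in (0, ja)%N :: c -> d (q y.1 y.2) (f (0, a)%N) < e1 + e1.
    move=> /cin [v' [iv' hv'] ->]; have := fq _ iv'; rewrite -/(f v') in hv'; rewrite -/(qr v') metric_sym => h.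
    have := metric_triangle (qr v') (f v') (f (0, a)%N); rewrite (metric_sym (f v') (f (0, a)%N)).
    move: hv'; rewrite -/(f (0, a)%N); slra.
  have call : all (fun b => b.1 <= m)%N (rcons c (0, jb.+1)%N).
    rewrite all_rcons /=; apply/allP => x xc; have [|v' [iv' _] ->] := cin x; first by rewrite inE xc orbT.
    by have [] := rin _ iv'.
  have pc' : path king (0, ja)%N (rcons c (0, jb.+1)%N).
    by rewrite rcons_path pc lc /king /=; move: (jb); clear; lia.
  have H1 : ht (e + e) (pre q 0 ja ++ rcons [seq q b.1 b.2 | b <- c] (q 0%N jb.+1)) (pre q 0 jb.+1).
    by have := lq (0, ja)%N _ (leq0n m) call pc'; rewrite last_rcons map_rcons.
  have bb : d (q 0%N jb.+1) (f (0, a)%N) < e1 + e1 + e.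
    have h1 : d (q 0%N jb) (f (0, a)%N) < e1 + e1.
      by have := ball (last (0, ja)%N c) (mem_last _ _); rewrite lc.
    have := qh 0%N jb (leq0n m); rewrite /nr metric_sym => h2.
    by have := metric_triangle (q 0%N jb.+1) (q 0%N jb) (f (0, a)%N); slra.
  have n8 : e1 + e1 + e < n / 2 by move: n1; slra.
  have all2 y : y \in q 0%N ja :: rcons [seq q b.1 b.2 | b <- c] (q 0%N jb.+1) -> d y (f (0, a)%N) < n / 2.
    rewrite -rcons_cons mem_rcons inE => /orP[/eqP->|]; first by slra.
    rewrite -[_ :: _]/(map (fun b : V => q b.1 b.2) ((0, ja)%N :: c)) => /mapP[y' /ball h ->]; move: e0; slra.
  split.
  - rewrite -!q0t /nr; have := metric_triangle (q 0%N ja) (f (0, a)%N) (q 0%N jb.+1).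
    have := all2 (q 0%N ja) (mem_head _ _); rewrite (metric_sym (f _)); slra.
  - have en : e <= n by move: e0 een; slra.
    apply: (@ht_trans _ _ _ (ch e P u (tau jb.+1))); first by apply: ht_sym; exact: ch_le.
    apply: (ht_trans (ht_le en (ht_sym (prech jb.+1)))).
    apply: (ht_trans (ht_le een (ht_sym H1))).
    apply: (@ht_trans _ _ _ (pre q 0 ja ++ [:: P (tau jb.+1)])); last first.
      apply: ht_catr; apply: (ht_trans (ht_le en (prech ja))); exact: ch_le.
    rewrite -q0t; have [s ->] := pre_rcons q 0 ja; rewrite -cats1 -!catA /=; apply: ht_catl.
    exact: (ball_collapse (z := f (0, a)%N)).
  - rewrite -q0t; rewrite -/(f (0, a)%N) in hfa.
    have := metric_triangle (f (0, a)%N) (q 0%N ja) (P t); move: fa hfa e1e ep0; slra.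
have mA n n' s s' : u <= s -> u <= s' -> 0 < n' -> n' <= n -> A n' s s' -> A n s s'.
  move=> us us' n1 nn [h1 h2 h3]; split=> //; first exact: nr_le nn h1.
  apply: (@ht_trans _ _ _ (ch n' P u s')); first by apply: ht_sym; exact: ch_le.
  apply: (ht_trans (ht_le nn h2)); apply: ht_catr; exact: ch_le.
(* The two parameters converge one after the other: first [s], then [s'] with partners already close
   to the limit of the first. *)
have [||s us] := @cluster_itv R (fun n s => exists s', [/\ u <= s, s <= t, t <= s', s' <= v & A n s s']) u t.
- move=> n n' s n1 nn [s' [h1 h2 h3 h4 h5]]; exists s'; split=> //.
  by apply: mA h5 => //; apply: le_trans h3.
- move=> n n1; have [s [s' [h1 h2 h3 h4 h5]]] := key n n1; exists s; first by rewrite h1.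
  by exists s'.
move=> cs.
have [||s' us'] := @cluster_itv R (fun n s' => exists s1, [/\ u <= s1, s1 <= t, t <= s' , `|s1 - s| < n & A n s1 s']) t v.
- move=> n n' s' n1 nn [s1 [h1 h2 h3 h4 h5]]; exists s1; split=> //; first exact: lt_le_trans nn.
  by apply: mA h5 => //; apply: le_trans h3.
- move=> n n1; have [s1 [_ h0 [s' [h1 h2 h3 h4 h5]]]] := cs n n1; exists s'; first by rewrite h3.
  by exists s1.
move=> cs'; case/andP: us => us st; case/andP: us' => ts' s'v.
have us' : u <= s' by apply: le_trans ts'.
have wl : W (fun e => [::] ++ ch e P u s) (fun e => [::] ++ ch e P u s').
  apply: W_limit => //; try exact: coh_nil.
  move=> n n1; have [s2 [/andP[h1 h2] h3 [s1 [k1 k2 k3 k4 [k5 k6 k7]]]]] := cs' n n1.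
  by exists s1, s2; split=> //; apply: le_trans h1.
have Est : P t = P s by apply: (rP s s') => //; [apply: le_trans ts'|rewrite st].
have e4 : 0 < ep / 2 by slra.
have [rr r0 hr] := uP _ e4.
have m0 : 0 < Num.min rr 1 by rewrite lt_min r0 ltr01.
have [s1 [_ h0 [s2 [h1 h2 h3 h4 [_ _ h5]]]]] := cs _ m0.
move: h0; rewrite lt_min => /andP[/hr h0 _].
by move: h5; rewrite Est; slra.
Qed.

End Unavoid.

Lemma cat_split (T : Type) (a b L1 L2 : seq T) y : a ++ b = L1 ++ y :: L2 ->
  (exists L3, a = L1 ++ y :: L3) \/ (exists2 L3, L1 = a ++ L3 & b = L3 ++ y :: L2).
Proof.
elim: a L1 => [|x a IH] L1 /=; first by right; exists L1.
case: L1 => [|x1 L1] /= [<-]; first by left; exists a.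
by move=> /IH [[L3 ->]|[L3 -> ->]]; [left; exists L3|right; exists L3].
Qed.

(** * Prefixes of reduced paths inside weakly homotopic paths *)

Section Arcs.
Context {R : realType} {X : metricType R}.
Local Notation d := (@mdist R X).
Implicit Types (P Q : R -> X) (A : R -> seq X) (u v w t : R).

Lemma W_coh A P Q u t w s : coh A -> uc P -> uc Q -> u <= t -> w <= s ->
  forall n n', 0 < n' -> n' <= n ->
  nr n' (Q s) (P t) /\ ht n' (ch n' P u t) (A n' ++ ch n' Q w s ++ [:: P t]) ->
  nr n (Q s) (P t) /\ ht n (ch n P u t) (A n ++ ch n Q w s ++ [:: P t]).
Proof.
move=> cA uP uQ ut ws n n' n0 nn [h1 h2]; split; first exact: nr_le nn h1.
apply: (@ht_trans _ _ _ (ch n' P u t)); first by apply: ht_sym; exact: ch_le.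
apply: (ht_trans (ht_le nn h2)); apply: ht_cat; first exact: cA.
by apply: ht_catr; exact: ch_le.
Qed.

Lemma W_from_approx A P Q u t w w' : coh A -> uc P -> uc Q -> u <= t ->
  (forall n, 0 < n -> exists2 s, w <= s <= w' &
    nr n (Q s) (P t) /\ ht n (ch n P u t) (A n ++ ch n Q w s ++ [:: P t])) ->
  exists2 s, w <= s <= w' & W (samples P u t) (fun e => A e ++ ch e Q w s).
Proof.
move=> cA uP uQ ut H.
pose B n s := w <= s /\ (nr n (Q s) (P t) /\ ht n (ch n P u t) (A n ++ ch n Q w s ++ [:: P t])).
have [||s0 /andP[ws0 sw0] cs] := @cluster_itv R B w w'.
- by move=> n n' s n0 nn [ws h]; split=> //; apply: W_coh h.
- by move=> n n0; have [s /andP[h1 h2] h3] := H n n0; exists s; rewrite ?h1.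
exists s0; first by rewrite ws0.
apply: W_sym; apply: (W_limit (B := fun _ => [::])) => //; first exact: coh_nil.
move=> n n0; have [s [/andP[h1 h2] h3 [h4 [h5 h6]]]] := cs n n0.
by exists s, t; split=> //; rewrite ?subrr ?normr0.
Qed.

Lemma split_ch e Q w w' L1 x L2 : uc Q -> 0 < e -> w <= w' -> ch e Q w w' = L1 ++ x :: L2 ->
  exists s, [/\ w <= s, s <= w', x = Q s & ht e (ch e Q w s) (L1 ++ [:: x])].
Proof.
move=> uQ e0 ww; have [l Ll ->] := chP uQ e0 ww => E.
have tf := part_osc_lt e0 Ll; set tau := nth w' (w :: l) in tf.
have sz : size (w :: l) = (size L1 + (size L2).+1)%N by rewrite -(size_map Q) E size_cat.
have jl : (size L1 < size (w :: l))%N by rewrite sz; move: (size L1) (size L2); clear; lia.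
have Ex : x = Q (tau (size L1)).
  have := congr1 (fun s => nth x s (size L1)) E; rewrite nth_cat ltnn subnn (nth_map w') //=.
exists (tau (size L1)); split=> //.
- exact: (tau_mono (i := 0%N) tf).
- have -> : w' = tau (size L1 + size l).+1 by rewrite /tau nth_default //= ltnS leq_addl.
  by apply: (tau_mono tf); move: (size L1) (size l); clear; lia.
apply: (ht_trans (ch_ht (part_tau 0 (size L1) tf))).
suff -> : map Q (w :: [seq tau k | k <- iota 1 (size L1)]) = L1 ++ [:: x] by exact: ht_refl.
have -> : L1 ++ [:: x] = take (size L1).+1 (map Q (w :: l)).
  by rewrite E take_cat ltnNge leqnSn /= subSn // subnn /= take0.
rewrite -map_take; congr map.
apply: (@eq_from_nth _ w'); first by rewrite /= size_map size_iota size_takel.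
move=> [|i] //=; rewrite size_map size_iota ltnS => iL.
by rewrite (nth_map 0%N) ?size_iota // nth_iota // nth_take.
Qed.

Hypothesis nq : @noquad R X.
Hypothesis gf : @grid_filling R X.

(** By [unavoid], the chains sampled from the concatenation meet the lifted point, in one of the two
    halves. The meeting point depends on the scale; compactness of the parameter interval replaces
    it by one parameter for all scales. *)
Lemma arc_cover2 P Q Q' u v w w' x x' t : uc P -> uc Q -> uc Q' -> reduced P u v ->
  u <= t -> t <= v -> w <= w' -> x <= x' ->
  W (samples P u v) (fun e => ch e Q w w' ++ ch e Q' x x') ->
  (exists2 s, w <= s <= w' & W (samples P u t) (samples Q w s)) \/
  (exists2 s, x <= s <= x' & W (samples P u t) (fun e => ch e Q w w' ++ ch e Q' x s)).
Proof.
move=> uP uQ uQ' rP ut tv ww xx HW.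
pose B1 n := exists2 s, w <= s <= w' & nr n (Q s) (P t) /\ ht n (ch n P u t) ([::] ++ ch n Q w s ++ [:: P t]).
pose B2 n := exists2 s, x <= s <= x' &
  nr n (Q' s) (P t) /\ ht n (ch n P u t) (ch n Q w w' ++ ch n Q' x s ++ [:: P t]).
have m1 n n' : 0 < n' -> n' <= n -> B1 n' -> B1 n.
  move=> n0 nn [s /andP[h1 h2] h3]; exists s; first by rewrite h1.
  exact: (W_coh coh_nil uP uQ ut h1 n0 nn).
have m2 n n' : 0 < n' -> n' <= n -> B2 n' -> B2 n.
  move=> n0 nn [s /andP[h1 h2] h3]; exists s; first by rewrite h1.
  exact: (W_coh (coh_ch uQ ww) uP uQ' ut h1 n0 nn).
have key n : 0 < n -> B1 n \/ B2 n.
  move=> n0; have [e1 e10 H] := unavoid nq gf uP rP ut tv n0.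
  pose e := Num.min e1 n; have e0 : 0 < e by rewrite lt_min e10.
  have ee : e <= e1 by rewrite ge_min lexx.
  have en : e <= n by rewrite ge_min lexx orbT.
  have [|L1 [y [L2 [E h1 h2]]]] := H (ch e Q w w' ++ ch e Q' x x').
    have uv : u <= v by apply: le_trans tv.
    apply: (@ht_trans _ _ _ (ch e P u v)); first by apply: ht_sym; exact: ch_le.
    exact: ht_le ee (HW _ e0).
  have [[L3 E3]|[L3 E3 E4]] := cat_split E.
    have [s [ws sw Ey h]] := split_ch uQ e0 ww E3; left; exists s; first by rewrite ws.
    rewrite -Ey; split=> //; apply: (ht_trans h2).
    rewrite -[L1 ++ _]/(L1 ++ [:: y] ++ [:: P t]) catA; apply: ht_catr.
    by apply: (ht_trans (ht_le en (ht_sym h))); exact: ch_le.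
  have [s [ws sw Ey h]] := split_ch uQ' e0 xx E4; right; exists s; first by rewrite ws.
  rewrite -Ey; split=> //; apply: (ht_trans h2); rewrite E3 -catA; apply: ht_cat.
    exact: ch_le.
  rewrite -[L3 ++ _]/(L3 ++ [:: y] ++ [:: P t]) catA; apply: ht_catr.
  by apply: (ht_trans (ht_le en (ht_sym h))); exact: ch_le.
(* Both alternatives get stronger as the scale decreases, so if the first fails at one scale, the
   second holds at every scale. *)
have [H1|H1] := pselect (forall n, 0 < n -> B1 n).
  by left; exact: (W_from_approx coh_nil uP uQ ut H1).
right; apply: (W_from_approx (coh_ch uQ ww) uP uQ' ut) => n n0.
have [n1 [n10 nB]] : exists n1, 0 < n1 /\ ~ B1 n1.
  by apply: contrapT => h; apply: H1 => n1 n10; apply: contrapT => h1; apply: h; exists n1.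
have m0 : 0 < Num.min n n1 by rewrite lt_min n0.
have [h|h] := key _ m0.
  by case: nB; apply: m1 h => //; rewrite ge_min lexx orbT.
by apply: m2 h => //; rewrite ge_min lexx.
Qed.

Lemma arc_cover1 P Q u v w w' t : uc P -> uc Q -> reduced P u v ->
  u <= t -> t <= v -> w <= w' -> W (samples P u v) (samples Q w w') ->
  exists2 s, w <= s <= w' & W (samples P u t) (samples Q w s).
Proof.
move=> uP uQ rP ut tv ww HW.
have HC : W (samples P u v) (fun e => ch e Q w w' ++ ch e Q w' w').
  by move=> e e0; apply: (ht_trans (HW e e0)); apply: ht_sym; exact: ch_cat.
have [//|[s /andP[s1 s2] H]] := arc_cover2 uP uQ uQ rP ut tv ww (lexx w') HC.
exists w'; first by rewrite ww lexx.
have E : s = w' by apply/eqP; rewrite eq_le s1 s2.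
move=> e e0; apply: (ht_trans (H e e0)); rewrite E; exact: ch_cat.
Qed.

End Arcs.

(** * Removable sets of parameters and their unions *)

Section Reduction.
Context {R : realType} {X : metricType R}.
Local Notation d := (@mdist R X).
Variables (P : R -> X) (u v : R).
Hypothesis uP : uc P.
Hypothesis uv : u <= v.
Implicit Types (G : set R) (s t x y : R).

(* [G] is a union of open intervals on which [P] is to be collapsed to a constant. *)
Definition kept G x := u <= x <= v /\ ~ G x.

Definition clo G := forall x, (forall e, 0 < e -> exists2 y, kept G y & `|y - x| < e) -> kept G x.

(** The last clause makes every gap of the kept set a weakly null loop. Unions of chains are
    delicate because a gap of the union need not be a gap of any member. *)
Definition removable G := [/\ ~ G u, ~ G v, clo G &
  forall s t, kept G s -> kept G t -> s < t -> (forall x, s < x -> x < t -> G x) ->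
    W (samples P u s) (samples P u t)].

Lemma kept_max G a b : clo G -> (exists2 y, kept G y & a <= y <= b) ->
  exists m, [/\ kept G m, a <= m, m <= b & forall y, kept G y -> a <= y -> y <= b -> y <= m].
Proof.
move=> cG [y0 ky0 /andP[ay0 yb0]].
pose E := [set y | [/\ kept G y, a <= y & y <= b]].
have hs : has_sup E by split; [exists y0|exists b => y []].
have aS : a <= sup E by apply: (le_trans ay0); apply: sup_upper_bound.
have Sb : sup E <= b by apply: ge_sup; [exists y0|move=> y []].
exists (sup E); split=> //; last by move=> y *; apply: sup_upper_bound.
apply: cG => e e0; have [y [ky ay yb] h] := sup_adherent e0 hs; exists y => //.
have : y <= sup E by apply: sup_upper_bound.
by move=> h'; rewrite ltr_norml; apply/andP; split; lra.
Qed.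

Lemma kept_min G a b : clo G -> (exists2 y, kept G y & a <= y <= b) ->
  exists m, [/\ kept G m, a <= m, m <= b & forall y, kept G y -> a <= y -> y <= b -> m <= y].
Proof.
move=> cG [y0 ky0 /andP[ay0 yb0]].
pose E := [set y | [/\ kept G y, a <= y & y <= b]].
have lb : has_lbound E by exists a => z [].
have hi : has_inf E by split; [exists y0|].
have aS : a <= inf E by apply: lb_le_inf; [exists y0|move=> y []].
have infE y : E y -> inf E <= y by exact: (ge_inf lb).
have Sb : inf E <= b by exact: le_trans (infE y0 (And3 ky0 ay0 yb0)) yb0.
exists (inf E); split=> //; last by move=> y ky ay yb; exact: infE.
apply: cG => e e0; have [y [ky ay yb] h] := inf_adherent e0 hi; exists y => //.
have : inf E <= y by exact: infE.
by move=> h'; rewrite ltr_norml; apply/andP; split; lra.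
Qed.

(** A compact part of a gap of the union lies in a single member, whose gap around it has ends close
    to those of the large gap; [W_limit] concludes. *)
Lemma removable_bigcup (F : set (set R)) : F `<=` removable -> total_on F subset ->
  removable (\bigcup_(G in F) G).
Proof.
move=> Frem tot; set U := \bigcup_(G in F) G.
have UG G x : F G -> G x -> U x by move=> FG Gx; exists G.
have kG G x : F G -> kept U x -> kept G x by move=> FG [h1 h2]; split=> // Gx; exact/h2/UG/Gx.
have kU x : u <= x <= v -> (forall G, F G -> kept G x) -> kept U x.
  by move=> xuv H; split=> // -[G FG Gx]; have [_] := H G FG.
split.
- by move=> [G FG Gu]; have [] := Frem G FG.
- by move=> [G FG Gu]; have [] := Frem G FG.
- move=> x Hx; apply: kU.
    apply/andP; split; rewrite leNgt; apply/negP => h.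
      have h0 : 0 < u - x by slra.
      have [y [/andP[h1 h2] _]] := Hx _ h0; rewrite ltr_norml => /andP[]; slra.
    have h0 : 0 < x - v by slra.
    have [y [/andP[h1 h2] _]] := Hx _ h0; rewrite ltr_norml => /andP[]; slra.
  move=> G FG; have [_ _ cG _] := Frem G FG; apply: cG => e e0.
  by have [y ky h] := Hx e e0; exists y => //; exact: kG ky.
move=> s t ks kt st gap.
have us : u <= s by case: ks => /andP[].
have ut : u <= t by case: kt => /andP[].
(* Otherwise every member keeps a point of [a, b]. The first such points increase along the chain,
   and their supremum is kept by all members, hence by the union, although it lies in a gap. *)
have cover a b : s < a -> a <= b -> b < t -> exists2 G, F G & forall x, a <= x -> x <= b -> G x.
  move=> sa ab bt; apply: contrapT => no.
  have ex G : F G -> exists2 y, kept G y & a <= y <= b.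
    move=> FG; apply: contrapT => no'; apply: no; exists G => // x ax xb.
    apply: contrapT => nG; apply: no'; exists x; last by rewrite ax.
    by split=> //; case: ks kt => /andP[? ?] _ [/andP[? ?] _]; apply/andP; split; slra.
  have ex' G : exists m, F G -> [/\ kept G m, a <= m, m <= b & forall y, kept G y -> a <= y -> y <= b -> m <= y].
    have [FG|nF] := pselect (F G); last by exists 0.
    by have [_ _ cG _] := Frem G FG; have [m h] := kept_min cG (ex G FG); exists m.
  have [f hf] := choice ex'.
  have [G0 FG0] : exists G, F G.
    have : U a by apply: gap => //; slra.
    by move=> [G FG _]; exists G.
  pose E := [set f G | G in F].
  have hs : has_sup E.
    by split; [exists (f G0), G0|exists b => _ [G FG <-]; have [] := hf G FG].
  have aS : a <= sup E.
    by have [_ h _ _] := hf _ FG0; apply: (le_trans h); apply: sup_upper_bound => //; exists G0.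
  have Sb : sup E <= b.
    by apply: ge_sup; [exists (f G0), G0|move=> _ [G FG <-]; have [] := hf G FG].
  suff [_] : kept U (sup E) by apply; apply: gap; slra.
  apply: kU; first by case: ks kt => /andP[? ?] _ [/andP[? ?] _]; apply/andP; split; slra.
  move=> G FG; have [_ _ cG _] := Frem G FG; apply: cG => e e0.
  have [_ [G1 FG1 <-] h1] := sup_adherent e0 hs.
  have le1 G2 : F G2 -> f G2 <= sup E by move=> h; apply: sup_upper_bound => //; exists G2.
  have [kf1 af1 fb1 min1] := hf _ FG1; have [kf af fb minf] := hf _ FG.
  have [GG|GG] := tot _ _ FG FG1.
    exists (f G1); first by split; [case: kf1|move=> /GG; case: kf1].
    by have := le1 _ FG1; rewrite ltr_norml => ?; apply/andP; split; slra.
  exists (f G) => //.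
  have : f G1 <= f G by apply: min1 => //; split; [case: kf|move=> /GG; case: kf].
  by have := le1 _ FG; rewrite ltr_norml => ? ?; apply/andP; split; slra.
have := @W_limit R X (fun _ => [::]) (fun _ => [::]) P P u u s t coh_nil coh_nil uP uP us ut; apply.
move=> n n0; pose r := Num.min n (t - s) / 3.
have m0 : 0 < Num.min n (t - s) by rewrite lt_min n0; slra.
have mn : Num.min n (t - s) <= n by rewrite ge_min lexx.
have mt : Num.min n (t - s) <= t - s by rewrite ge_min lexx orbT.
have [|||G FG HG] := cover (s + r) (t - r); [rewrite /r; slra|rewrite /r; slra|rewrite /r; slra|].
have [_ _ cG wG] := Frem G FG.
have [s1 [ks1 h1 h2 M1]] : exists m, [/\ kept G m, s <= m, m <= s + r & forall y, kept G y -> s <= y -> y <= s + r -> y <= m].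
  by apply: kept_max cG _; exists s; [exact: kG ks|rewrite lexx /r; slra].
have [s2 [ks2 k1 k2 M2]] : exists m, [/\ kept G m, t - r <= m, m <= t & forall y, kept G y -> t - r <= y -> y <= t -> m <= y].
  by apply: kept_min cG _; exists t; [exact: kG kt|rewrite lexx /r andbT; slra].
have us1 : u <= s1 by slra.
have us2 : u <= s2 by rewrite /r in k1 *; slra.
have s12 : s1 < s2 by rewrite /r in h2 k1; slra.
have w12 : W (samples P u s1) (samples P u s2).
  apply: wG => // x x1 x2; apply: contrapT => nG.
  have kx : kept G x by split=> //; case: ks1 ks2 => /andP[? ?] _ [/andP[? ?] _]; apply/andP; split; slra.
  have [xs|xs] := leP x (s + r); first by have := M1 x kx; slra.
  have [xt|xt] := leP (t - r) x; first by have := M2 x kx; slra.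
  by apply: nG; apply: HG; slra.
exists s1, s2; split=> //; [rewrite /r in h2; rewrite ltr_norml; apply/andP; split; slra|rewrite /r in k1; rewrite ltr_norml; apply/andP; split; slra|].
have E12 : P s1 = P s2 by exact: (@W_last R X (fun _ => [::]) (fun _ => [::]) P P u s1 u s2).
split; first by rewrite E12; exact: nrxx.
apply: (ht_trans (ht_sym (w12 n n0))); rewrite -E12.
have [q Eq] := ch_rcons uP n0 us1; rewrite Eq -cats1 -catA; apply: ht_catl.
exact/ht_sym/ht_dup0.
Qed.

End Reduction.

(** * Existence of reduced paths *)

Section Reduction2.
Context {R : realType} {X : metricType R}.
Local Notation d := (@mdist R X).
Local Notation nilp := (fun _ : R => [::] : seq X).

Lemma W_endpoints (P Q : R -> X) u s w t : uc P -> uc Q -> u <= s -> w <= t ->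
  W (samples P u s) (samples Q w t) -> P s = Q t.
Proof. by move=> uP uQ us wt H; apply: (@W_last R X nilp nilp P Q u s w t). Qed.

Lemma ch_const e (P : R -> X) u v : 0 < e -> u <= v -> (forall x, u <= x <= v -> P x = P u) ->
  ht e (ch e P u v) [:: P u].
Proof.
move=> e0 uv H; have f : osc_lt e P u v.
  by split=> // x y hx hy; rewrite !H // mdistxx.
apply: (ht_trans (ch_small f)); rewrite (H v) ?lexx ?uv //; exact: ht_dup0.
Qed.

(** For a maximal removable [G], the path [Q] waits at the last kept point [sg t]. Both ends of a
    gap have the same value under [P], so [Q] is continuous, and a weakly null loop left in [Q]
    would give a larger removable set. *)
Lemma reduction (P : R -> X) u v : uc P -> u <= v -> exists Q,
  [/\ uc Q, reduced Q u v, (forall x, exists2 y, u <= y <= v & Q x = P y),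
      Q u = P u /\ Q v = P v & W (samples P u v) (samples Q u v)].
Proof.
move=> uP uv.
have [G [Grem Gmax]] := Zorn_bigcup (@removable_bigcup R X P u v uP).
have [Gu Gv cG gap] := Grem.
have ku : kept u v G u by split; rewrite ?lexx.
have kv : kept u v G v by split; rewrite ?lexx ?uv.
have [sg hsg] : exists sg : R -> R, forall t, u <= t -> t <= v -> [/\ kept u v G (sg t), u <= sg t, sg t <= t &
    forall y, kept u v G y -> y <= t -> y <= sg t].
  have ex t : exists m, u <= t -> t <= v -> [/\ kept u v G m, u <= m, m <= t & forall y, kept u v G y -> y <= t -> y <= m].
    have [tt|nt] := pselect (u <= t <= v); last by exists 0 => h1 h2; case: nt; rewrite h1.
    case/andP: (tt) => t1 t2.
    have [|m [h1 h2 h3 h4]] := kept_max (a := u) (b := t) cG.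
      by exists u => //; rewrite lexx t1.
    exists m => _ _; split=> // y ky yt; apply: h4 => //; by case: ky => /andP[].
  by have [f hf] := choice ex; exists f.
have sgk t : kept u v G t -> sg t = t.
  move=> kt; have [/andP[t1 t2] _] := kt; have [_ _ h h'] := hsg t t1 t2.
  by apply/eqP; rewrite eq_le h h'.
(* [sg t] and the first kept point after [t] are the ends of a gap *)
have next t y : u <= t -> kept u v G y -> t <= y -> exists m, [/\ kept u v G m, t <= m, m <= y,
    W (samples P u (sg t)) (samples P u m) & forall x, sg t <= x -> x < m -> u <= x -> x <= v -> sg x = sg t].
  move=> ut ky ty; have tv : t <= v by case: (ky) => /andP[_ h] _; exact: le_trans h.
  have [ks us st Ms] := hsg t ut tv.
  have [|m [km tm my Mm]] := kept_min (a := t) (b := y) cG; first by exists y => //; rewrite lexx ty.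
  have mid x : kept u v G x -> sg t < x -> m <= x.
    move=> kx sx; have [xt|xt] := leP x t; first by have := Ms x kx xt; slra.
    have [xy|xy] := leP x y; first by apply: Mm => //; exact: ltW.
    slra.
  exists m; split=> //.
    have [E|ne] := eqVneq (sg t) m; first by rewrite E => e e0; exact: ht_refl.
    apply: gap => //; first by rewrite lt_neqAle ne (le_trans st).
    move=> x sx xm; apply: contrapT => nG.
    have kx : kept u v G x by split=> //; case: km => /andP[? ?] _; apply/andP; split; slra.
    by have := mid x kx sx; slra.
  move=> x sx xm ux xv; have [kx ux' xx Mx] := hsg x ux xv.
  apply/eqP; rewrite eq_le Mx // andbT leNgt; apply/negP => h.
  by have := mid _ kx h; slra.
pose cl t := Num.max u (Num.min v t).
have cl1 t : u <= cl t by rewrite /cl le_max lexx.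
have cl2 t : cl t <= v by rewrite /cl ge_max uv ge_min lexx.
have clid t : u <= t -> t <= v -> cl t = t by move=> h1 h2; rewrite /cl min_r // max_r.
pose Q t := P (sg (cl t)).
have Qk t : kept u v G t -> Q t = P t.
  by move=> kt; have [/andP[t1 t2] _] := kt; rewrite /Q clid // sgk.
have Qsg t : u <= t -> t <= v -> Q t = P (sg t) by move=> *; rewrite /Q clid.
have cllip s t : `|cl s - cl t| <= `|s - t|.
  wlog st : s t / s <= t.
    move=> H; have [/H//|/ltW /H] := leP s t; by rewrite distrC (distrC t).
  have -> : `|s - t| = t - s by rewrite ler0_norm; slra.
  rewrite /cl ler_norml.
  case: (leP v s) => vs; case: (leP v t) => vt; rewrite ?(max_r uv);
    try (case: (leP u s) => us); try (case: (leP u t) => ut'); apply/andP; split; slra.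
have uQ : uc Q.
  move=> e e0; have [dl d0 H] := uP e e0; exists dl => // s t st.
  have {st} : `|cl s - cl t| < dl by apply: le_lt_trans st.
  rewrite /Q; move: (cl s) (cl t) (cl1 s) (cl2 s) (cl1 t) (cl2 t) => {}s {}t us sv ut tv st.
  wlog le : s t us sv ut tv st / s <= t.
    move=> WL; have [/WL|/ltW /WL] := leP s t; first by apply.
    by rewrite distrC metric_sym; apply.
  have [ks us' ss Ms] := hsg s us sv; have [kt ut' tt Mt] := hsg t ut tv.
  have [le'|lt'] := leP (sg t) s.
    have -> : sg s = sg t by apply/eqP; rewrite eq_le Ms // andbT Mt // (le_trans ss).
    by rewrite mdistxx.
  have [m [km sm mt Wm _]] := next s (sg t) us kt (ltW lt').
  have -> : P (sg s) = P m by apply: W_endpoints Wm => //; apply: le_trans sm.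
  by apply: H; move: st; rewrite !ltr_norml => /andP[? ?]; apply/andP; split; slra.
(* Induction along steps of length [dl]: the current point is first moved across the gap that may
   contain it, which changes neither class, and the rest of the step is short for both paths. *)
have Wk t : kept u v G t -> W (samples Q u t) (samples P u t).
  move=> kt e e0; have [d1 d10 f1] := uc_osc_lt uP e0; have [d2 d20 f2] := uc_osc_lt uQ e0.
  pose dl := Num.min d1 d2 / 2.
  have dl0 : 0 < dl by rewrite /dl divr_gt0 // lt_min d10.
  have dl1 : dl < d1.
    have : Num.min d1 d2 <= d1 by rewrite ge_min lexx.
    by rewrite /dl; slra.
  have dl2 : dl < d2.
    have : Num.min d1 d2 <= d2 by rewrite ge_min lexx orbT.
    by rewrite /dl; slra.
  have [n tn] : exists n : nat, t <= u + n%:R * dl.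
    exists (Num.truncn ((t - u) / dl)).+1; rewrite -lerBlDl -ler_pdivrMr //; apply: ltW.
    exact: truncnS_gt.
  elim: n t kt tn => [|n IH] t kt tn.
    have -> : t = u by case: kt => /andP[? ?] _; rewrite mul0r in tn; slra.
    by apply: (ht_trans (ch_xx _ _ e0)); rewrite Qk //; apply: ht_sym; exact: ch_xx.
  have [tb|bt] := leP t (u + n%:R * dl); first exact: IH.
  set b := u + n%:R * dl in IH bt *.
  have tb : t <= b + dl by rewrite /b -addrA -[X in _ + X](_ : n.+1%:R * dl = _) // -natr1 mulrDl mul1r.
  have ub : u <= b by rewrite /b lerDl mulr_ge0 // ltW.
  have bv : b <= v by case: (kt) => /andP[_ h] _; slra.
  have [m [km bm mt Wm sgm]] := next b t ub kt (ltW bt).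
  have [ks us sb Ms] := hsg b ub bv.
  have um : u <= m by slra.
  have sm : sg b <= m by slra.
  have vm : m <= v by case: (km) => /andP[].
  have Gs := IH _ ks sb.
  have Pm : P (sg b) = P m by apply: W_endpoints Wm.
  have Gm : ht e (ch e Q u m) (ch e P u m).
    apply: ht_trans (Wm e e0); apply: ht_trans Gs.
    apply: (ht_trans (ht_sym (ch_cat uQ e0 us sm))).
    have cst : ht e (ch e Q (sg b) m) [:: Q (sg b)].
      apply: ch_const => // x /andP[x1 x2]; rewrite (Qk _ ks).
      have [xm|mx] := ltP x m.
        have ux : u <= x by slra.
        have xv : x <= v by slra.
        by rewrite Qsg // sgm.
      have -> : x = m by slra.
      by rewrite Qk.
    apply: (ht_trans (ht_catl _ cst)).
    have [q ->] := ch_rcons uQ e0 us; rewrite -cats1 -catA; apply: ht_catl; exact: ht_dup0.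
  apply: (ht_trans (ht_sym (ch_cat uQ e0 um mt))).
  apply: ht_trans (ch_cat uP e0 um mt); apply: ht_cat => //.
  have F1 : osc_lt e P m t by apply: f1 => //; slra.
  have F2 : osc_lt e Q m t by apply: f2 => //; slra.
  apply: (ht_trans (ch_small F2)); rewrite !Qk //; exact/ht_sym/ch_small.
have Wsg t : u <= t -> t <= v -> W (samples Q u t) (samples P u (sg t)).
  move=> ut tv e e0; have [ks us st Ms] := hsg t ut tv.
  apply: ht_trans (Wk _ ks e e0); apply: (ht_trans (ht_sym (ch_cat uQ e0 us st))).
  have cst : ht e (ch e Q (sg t) t) [:: Q (sg t)].
    apply: ch_const => // x /andP[x1 x2].
    have ux : u <= x by slra.
    have xv : x <= v by slra.
    rewrite !Qsg //; last by slra.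
    rewrite (sgk _ ks); congr P; have [kx ux' xx Mx] := hsg x ux xv.
    by apply/eqP; rewrite eq_le Mx // andbT Ms //; slra.
  apply: (ht_trans (ht_catl _ cst)).
  have [q ->] := ch_rcons uQ e0 us; rewrite -cats1 -catA; apply: ht_catl; exact: ht_dup0.
exists Q; split=> //.
- move=> s t us st tv WQ x /andP[sx xt].
  have ut : u <= t by slra.
  have sv : s <= v by slra.
  have ux : u <= x by slra.
  have xv : x <= v by slra.
  have [ks us' ss Ms] := hsg s us sv; have [kt ut' tt Mt] := hsg t ut tv.
  have [kx ux' xx Mx] := hsg x ux xv.
  have WP : W (samples P u (sg s)) (samples P u (sg t)).
    exact: W_trans (W_sym (Wsg s us sv)) (W_trans WQ (Wsg t ut tv)).
  have Pst : P (sg s) = P (sg t) by apply: W_endpoints WP.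
  have sxx : sg s <= sg x by apply: Mx => //; slra.
  have xtt : sg x <= sg t by apply: Mt => //; slra.
  rewrite !Qsg //.
  have [E|nE] := eqVneq (sg x) (sg s); first by rewrite E.
  have [E|nE'] := eqVneq (sg x) (sg t); first by rewrite E.
  exfalso.
  have l1 : sg s < sg x by rewrite lt_neqAle sxx eq_sym nE.
  have l2 : sg x < sg t by rewrite lt_neqAle xtt nE'.
  (* The interval from [sg s] to [sg t] carries a weakly null loop and contains the kept point
     [sg x], so adding it to [G] contradicts maximality. *)
  pose G' := G `|` [set y | sg s < y /\ y < sg t].
  apply: (Gmax G').
    split; first by move=> y Gy; left.
    by move=> H; case: kx => _; apply; apply: H; right.
  have k' y : kept u v G' y <-> kept u v G y /\ ~ (sg s < y /\ y < sg t).
    split; first by move=> [h1 h2]; split; [split=> // Gy; apply: h2; left|move=> h; apply: h2; right].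
    by move=> [[h1 h2] h3]; split=> // -[].
  split.
  + by move=> [//|[h _]]; slra.
  + by move=> [//|[_ h]]; case: kt => /andP[? ?] _; slra.
  + move=> y Hy; apply/k'; split.
      by apply: cG => e e0; have [z /k'[kz _] hz] := Hy e e0; exists z.
    move=> [h1 h2]; pose e := Num.min (y - sg s) (sg t - y).
    have e0 : 0 < e by rewrite lt_min; apply/andP; split; slra.
    have [z /k'[kz nz]] := Hy e e0; rewrite /e lt_min !ltr_norml => /andP[/andP[? ?] /andP[? ?]].
    by apply: nz; split; slra.
  (* A gap of [G'] that meets the added interval is that interval itself, because [sg s] and [sg t]
     are still kept. *)
  + move=> a b /k'[ka na] /k'[kb nb] ab gab.
    have [dis|ovl] := pselect (forall y, a < y -> y < b -> ~ (sg s < y /\ y < sg t)).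
      apply: gap => // y ay yb; have [//|h] := gab y ay yb; by case: (dis y ay yb).
    have [y [ay yb [sy yt]]] : exists y, [/\ a < y, y < b & sg s < y /\ y < sg t].
      apply: contrapT => H; apply: ovl => y ay yb h; apply: H; by exists y.
    have Es : a = sg s.
      apply: contrapT => ne.
      have : a < sg s.
        rewrite ltNge le_eqVlt; apply/negP => /orP[/eqP h|h]; [exact: ne|apply: na; slra].
      move=> h; have sb : sg s < b by slra.
      by have [Gs|[h1 h2]] := gab (sg s) h sb; [case: ks|slra].
    have Et : b = sg t.
      apply: contrapT => ne.
      have : sg t < b.
        rewrite ltNge le_eqVlt; apply/negP => /orP[/eqP h|h]; [exact: ne|apply: nb; slra].
      move=> h; have sa : a < sg t by slra.
      by have [Gs|[h1 h2]] := gab (sg t) sa h; [case: kt|slra].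
    by rewrite Es Et.
- move=> x; exists (sg (cl x)) => //.
  by have [[/andP[h1 h2] _] _ _ _] := hsg _ (cl1 x) (cl2 x); rewrite h1 h2.
- by rewrite !Qk.
- exact: W_sym (Wk _ kv).
Qed.

End Reduction2.

(** * Cancellation, order of lifted points and centres of triangles *)

Section Median.
Context {R : realType} {X : metricType R}.
Local Notation d := (@mdist R X).
Implicit Types (P Q : R -> X) (A : R -> seq X) (u v w t : R).

Lemma sorted_nr_rev e (s : seq X) : sorted (nr e) (rev s) = sorted (nr e) s.
Proof. by rewrite rev_sorted; apply: eq_sorted => x y; rewrite nr_sym. Qed.

Lemma ht_cancel e (q Y Z : seq X) x : 0 < e -> sorted (nr e) (rcons q x) ->
  ht e (rcons q x ++ x :: Y) (rcons q x ++ x :: Z) -> ht e (x :: Y) (x :: Z).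
Proof.
move=> e0 sq H.
have B : ht e (rev (rcons q x) ++ rcons q x) [:: x].
  have := @ht_back R X e x (rev q) e0; rewrite -rev_rcons revK; apply.
  by have := sorted_nr_rev e (rcons q x); rewrite sq rev_rcons.
have K T : ht e (rev (rcons q x) ++ rcons q x ++ x :: T) (x :: T).
  rewrite catA; apply: (ht_trans (ht_catr _ B)); exact: ht_dup0.
exact: ht_trans (ht_sym (K Y)) (ht_trans (ht_catl _ H) (K Z)).
Qed.

Lemma W_cancel P Q Q' u v w w' x x' : uc P -> uc Q -> uc Q' -> u <= v ->
  Q w = P v -> Q' x = P v ->
  W (fun e => ch e P u v ++ ch e Q w w') (fun e => ch e P u v ++ ch e Q' x x') ->
  W (samples Q w w') (samples Q' x x').
Proof.
move=> uP uQ uQ' uv Ew Ex H e e0; have := H e e0.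
have := ch_near uP e0 uv; have [q ->] := ch_rcons uP e0 uv.
by rewrite /ch /= Ew Ex; exact: ht_cancel.
Qed.

Lemma W_cat A A' (B : R -> seq X) : W A A' -> W (fun e => B e ++ A e) (fun e => B e ++ A' e).
Proof. by move=> H e e0; apply: ht_catl; exact: H. Qed.

Lemma W_ch_cat P u w v : uc P -> u <= w -> w <= v ->
  W (fun e => ch e P u w ++ ch e P w v) (samples P u v).
Proof. by move=> uP uw wv e e0; exact: ch_cat. Qed.

Lemma W_opath P u v : uc P -> u <= v ->
  W (fun e => rev (ch e P u v)) (samples (opath P) (- v) (- u)).
Proof. by move=> uP uv e e0; exact: ch_opath. Qed.

Lemma W_rev A A' : W A A' -> W (fun e => rev (A e)) (fun e => rev (A' e)).
Proof. by move=> H e e0; apply: ht_rev; exact: H. Qed.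

Lemma W_rev_opath P Q u v w x : uc P -> uc Q -> u <= v -> w <= x ->
  W (samples P u v) (samples Q w x) ->
  W (samples (opath P) (- v) (- u)) (samples (opath Q) (- x) (- w)).
Proof.
move=> uP uQ uv wx H; apply: W_trans (W_sym (W_opath uP uv)) _.
apply: W_trans (W_opath uQ wx); exact: W_rev.
Qed.

Lemma opathK P : opath (opath P) = P.
Proof. by apply/funext => t; rewrite /opath opprK. Qed.

Lemma reduced_prefix P u v w : reduced P u v -> w <= v -> reduced P u w.
Proof. by move=> rP wv s t us st tw; apply: rP => //; exact: le_trans wv. Qed.

Lemma reduced_suffix P u v w : uc P -> reduced P u v -> u <= w -> reduced P w v.
Proof.
move=> uP rP uw s t ws st tv H; apply: rP => //; first exact: le_trans ws.
have wt : w <= t by apply: le_trans st.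
apply: W_trans (W_sym (W_ch_cat uP uw ws)) _; apply: W_trans (W_ch_cat uP uw wt).
exact: W_cat.
Qed.

Lemma W_back P u w v : uc P -> u <= w -> w <= v ->
  W (fun e => ch e P u v ++ rev (ch e P w v)) (samples P u w).
Proof.
move=> uP uw wv e e0.
apply: (ht_trans (ht_catr _ (ht_sym (ch_cat uP e0 uw wv)))); rewrite -catA.
apply: (ht_trans (ht_catl _ (ch_back uP e0 wv))).
have [q ->] := ch_rcons uP e0 uw; rewrite -cats1 -catA; apply: ht_catl; exact: ht_dup0.
Qed.

(** A prefix of the reversed path is a reversed suffix of [P]; composing [P] with it gives, by
    [W_back], a prefix of [P], to which reducedness applies. *)
Lemma reduced_opath P u v : uc P -> u <= v -> reduced P u v -> reduced (opath P) (- v) (- u).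
Proof.
move=> uP uv rP s t vs st tu H x /andP[sx xt].
have uoP := uc_opath uP.
have WA y : - v <= y -> y <= - u -> W (samples (opath P) (- v) y) (fun e => rev (ch e P (- y) v)).
  move=> y1 y2; have yv : - y <= v by lra.
  by have := W_sym (W_opath uP yv); rewrite opprK.
have h1 : W (fun e => rev (ch e P (- s) v)) (fun e => rev (ch e P (- t) v)).
  apply: W_trans (W_sym (WA s vs _)) _; first lra.
  by apply: W_trans H (WA t _ tu); lra.
have su : u <= - s by lra.
have sv : - s <= v by lra.
have tu' : u <= - t by lra.
have tv' : - t <= v by lra.
have h2 : W (samples P u (- t)) (samples P u (- s)).
  apply: W_trans (W_sym (W_back uP tu' tv')) _; apply: W_trans (W_back uP su sv).
  by apply: W_cat; exact: W_sym.
rewrite /opath; have ts : - t <= - s by lra.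
have e1 : P (- x) = P (- t) by apply: (rP _ _ tu' ts sv h2); apply/andP; split; lra.
have e2 : P (- s) = P (- t) by apply: (rP _ _ tu' ts sv h2); apply/andP; split; lra.
by rewrite e1 e2.
Qed.

Lemma closed_lift A P Q u w w' t0 : coh A -> uc P -> uc Q -> u <= t0 ->
  (forall n, 0 < n -> exists t s, [/\ u <= t, `|t - t0| < n, w <= s, s <= w' &
     W (samples Q u t) (fun e => A e ++ ch e P w s)]) ->
  exists s, [/\ w <= s, s <= w' & W (samples Q u t0) (fun e => A e ++ ch e P w s)].
Proof.
move=> cA uP uQ ut0 H.
pose B n s := exists t, [/\ u <= t, `|t - t0| < n, w <= s, s <= w' &
     W (samples Q u t) (fun e => A e ++ ch e P w s)].
have [||s0 /andP[ws0 sw0] cs] := @cluster_itv R B w w'.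
- by move=> n n' s n0 nn [t [h1 h2 h3 h4 h5]]; exists t; split=> //; exact: lt_le_trans nn.
- move=> n n0; have [t [s [h1 h2 h3 h4 h5]]] := H n n0; exists s; first by rewrite h3.
  by exists t.
exists s0; split=> //; apply: W_sym; apply: (W_limit (B := fun _ => [::])) => //; first exact: coh_nil.
move=> n n0; have [s [_ h1 [t [h2 h3 h4 h5 h6]]]] := cs n n0.
have E : Q t = P s by exact: (@W_last R X (fun _ => [::]) A Q P u t w s).
exists s, t; split=> //; split; first by rewrite E; exact: nrxx.
apply: (ht_trans (h6 n n0)); rewrite E; apply: ht_catl.
have [q ->] := ch_rcons uP n0 h4; rewrite -cats1 -catA; apply: ht_catl; exact/ht_sym/ht_dup0.
Qed.

Hypothesis nq : @noquad R X.
Hypothesis gf : @grid_filling R X.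

(** If y' <= x', the class of [P'] up to y' is, by [arc_cover1], the class of [P] up to some s <= x.
    It is also the class of [P] up to y, so [P] is constant on [s, y], which contains x. *)
Lemma lift_mono P P' u v u' v' x y x' y' : uc P -> uc P' -> reduced P u v -> reduced P' u' v' ->
  u <= x -> x <= y -> y <= v -> u' <= x' -> x' <= v' -> u' <= y' ->
  P x <> P y -> W (samples P u x) (samples P' u' x') ->
  W (samples P u y) (samples P' u' y') -> x' < y'.
Proof.
move=> uP uP' rP rP' ux xy yv ux' xv' uy' ne Wx Wy; rewrite ltNge; apply/negP => yx'.
have rP'x := reduced_prefix rP' xv'.
have [s /andP[us sx] Ws] := arc_cover1 nq gf uP' uP rP'x uy' yx' ux (W_sym Wx).
have sy : s <= y by apply: le_trans xy.
have Wsy : W (samples P u s) (samples P u y) by exact: W_trans (W_sym Ws) (W_sym Wy).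
apply: ne; rewrite (rP s y us sy yv Wsy x) ?sx //.
by rewrite (rP s y us sy yv Wsy y) // sy lexx.
Qed.

(* The lifted points of [P3] are covered by those of [P1] and those of [P2], two closed sets;
   the unit interval being connected, some point lies on both. *)
Lemma median P1 P2 P3 : uc P1 -> uc P2 -> uc P3 -> reduced P3 0 1 -> P2 0 = P1 1 ->
  W (samples P3 0 1) (fun e => ch e P1 0 1 ++ ch e P2 0 1) ->
  exists t s1 s2, [/\ 0 <= t <= 1, 0 <= s1 <= 1, 0 <= s2 <= 1,
    [/\ W (samples P3 0 t) (samples P1 0 s1),
        W (samples P2 0 s2) (samples (opath P1) (- 1) (- s1)) &
        W (samples P3 t 1) (samples P2 s2 1)] &
    P3 t = P1 s1 /\ P3 t = P2 s2].
Proof.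
move=> u1 u2 u3 r3 E12 H.
have l01 : (0 : R) <= 1 by exact: ler01.
pose A1 t := exists s, [/\ 0 <= s, s <= 1 & W (samples P3 0 t) (fun e => [::] ++ ch e P1 0 s)].
pose A2 t := exists s, [/\ 0 <= s, s <= 1 & W (samples P3 0 t) (fun e => ch e P1 0 1 ++ ch e P2 0 s)].
have cov t : 0 <= t -> t <= 1 -> A1 t \/ A2 t.
  move=> t0 t1; have [[s /andP[h1 h2] h]|[s /andP[h1 h2] h]] := arc_cover2 nq gf u3 u1 u2 r3 t0 t1 l01 l01 H.
    by left; exists s.
  by right; exists s.
have c1 t0 : 0 <= t0 -> (forall n, 0 < n -> exists t, [/\ 0 <= t, `|t - t0| < n & A1 t]) -> A1 t0.
  move=> t00 Hn; apply: (closed_lift coh_nil) => // n n0.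
  by have [t [h1 h2 [s [h3 h4 h5]]]] := Hn n n0; exists t, s.
have c2 t0 : 0 <= t0 -> (forall n, 0 < n -> exists t, [/\ 0 <= t, `|t - t0| < n & A2 t]) -> A2 t0.
  move=> t00 Hn; apply: (closed_lift (coh_ch u1 l01)) => // n n0.
  by have [t [h1 h2 [s [h3 h4 h5]]]] := Hn n n0; exists t, s.
have E0 : P3 0 = P1 0.
  by have := ht_head (P3 0) (H 1 ltr01).
have A10 : A1 0.
  exists 0; rewrite lexx l01; split=> // e e0; apply: (ht_trans (ch_xx _ _ e0)).
  by rewrite E0; apply: ht_sym; exact: ch_xx.
have A21 : A2 1 by exists 1; rewrite lexx l01.
pose S := [set t | [/\ 0 <= t, t <= 1 & A1 t]].
have hs : has_sup S by split; [exists 0|exists 1 => t []].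
have S0 : 0 <= sup S by apply: sup_upper_bound.
have S1 : sup S <= 1 by apply: ge_sup; [exists 0|move=> t []].
have AS1 : A1 (sup S).
  apply: c1 => // n n0; have [t [h1 h2 h3] h4] := sup_adherent n0 hs; exists t; split=> //.
  have : t <= sup S by apply: sup_upper_bound.
  by move=> h; rewrite ltr_norml; apply/andP; split; slra.
have AS2 : A2 (sup S).
  have [E|ne] := eqVneq (sup S) 1; first by rewrite E.
  have lt1 : sup S < 1 by rewrite lt_neqAle ne.
  apply: c2 => // n n0; pose r := Num.min n (1 - sup S) / 2.
  have m0 : 0 < Num.min n (1 - sup S) by rewrite lt_min n0; slra.
  have mn : Num.min n (1 - sup S) <= n by rewrite ge_min lexx.
  have mt : Num.min n (1 - sup S) <= 1 - sup S by rewrite ge_min lexx orbT.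
  have r1 : 0 <= sup S + r by rewrite /r; slra.
  have r2 : sup S + r <= 1 by rewrite /r; slra.
  exists (sup S + r); split=> //.
    by rewrite addrC addKr ger0_norm /r; slra.
  have [h|//] := cov _ r1 r2.
  have : sup S + r <= sup S by apply: sup_upper_bound.
  by rewrite /r; slra.
have [s1 [s10 s11 W1]] := AS1; have [s2 [s20 s21 W2]] := AS2; set t := sup S in S0 S1 W1 W2.
have e1 : P3 t = P1 s1 by apply: W_endpoints W1.
have e2 : P3 t = P2 s2 by exact: (@W_last R X (fun _ => [::]) (samples P1 0 1) P3 P2 0 t 0 s2).
exists t, s1, s2; rewrite S0 S1 s10 s11 s20 s21; split=> //; split=> //.
(* [h] cancels [P1] up to s1 from the two lifts of the same point: the rest of [P1] followed by [P2]
   up to s2 is null. Moving the rest of [P1] to the other side gives its reversal. *)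
- have m1 : - 1 <= - s1 by slra.
  have h : W (fun e => ch e P1 s1 1 ++ ch e P2 0 s2) (fun e => [:: P1 s1]).
    move=> e e0.
    have K : ht e (ch e P1 0 s1 ++ ch e P1 s1 1 ++ ch e P2 0 s2) (ch e P1 0 s1 ++ [:: P1 s1]).
      rewrite catA; apply: (ht_trans (ht_catr _ (ch_cat u1 e0 s10 s11))).
      apply: (ht_trans (ht_sym (W2 e e0))); apply: (ht_trans (W1 e e0)); rewrite cat0s.
      have [q ->] := ch_rcons u1 e0 s10; rewrite -cats1 -catA; apply: ht_catl; exact/ht_sym/ht_dup0.
    move: K; have := ch_near u1 e0 s10; have [q ->] := ch_rcons u1 e0 s10.
    by rewrite {2 4}/ch /=; exact: ht_cancel.
  move=> e e0; apply: ht_sym; apply: (ht_trans (ht_sym (ch_opath u1 e0 s11))); apply: ht_sym.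
  have K : ht e (rev (ch e P1 s1 1) ++ ch e P1 s1 1 ++ ch e P2 0 s2) (rev (ch e P1 s1 1) ++ [:: P1 s1]).
    by apply: ht_catl; exact: h.
  have Er : exists q, rev (ch e P1 s1 1) = rcons q (P1 s1).
    by rewrite /ch /= rev_cons; eexists.
  have B : ht e (rev (ch e P1 s1 1) ++ ch e P1 s1 1) [:: P1 1].
    have := sorted_nr_rev e (ch e P1 s1 1); rewrite (ch_near u1 e0 s11).
    have [q Eq] := ch_rcons u1 e0 s11; rewrite Eq rev_rcons => sq.
    by have := ht_back e0 sq; rewrite -rev_rcons revK rev_rcons.
  apply: (@ht_trans _ _ _ ([:: P1 1] ++ ch e P2 0 s2)).
    by rewrite /ch /= E12; exact/ht_sym/ht_dup0.
  apply: (ht_trans (ht_catr _ (ht_sym B))); rewrite -catA; apply: (ht_trans K).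
  have [q ->] := Er; rewrite -cats1 -catA; apply: ht_catl; exact: ht_dup0.
- apply: (@W_cancel P3 P3 P2 0 t) => //.
  apply: W_trans (W_ch_cat u3 S0 S1) _; apply: (W_trans H) => e e0.
  apply: (ht_trans (ht_catl _ (ht_sym (ch_cat u2 e0 s20 s21)))); rewrite catA; apply: ht_catr.
  by apply: ht_sym; exact: W2.
Qed.

End Median.

(** * Counting the solutions of a predicate *)

Section Enum.
Context {T : choiceType}.
Implicit Types (A B : T -> Prop) (s : seq T).

Definition enumerates A s := uniq s /\ forall x, x \in s <-> A x.
Definition listable A := exists s, enumerates A s.
(** By [card_listE] the choice of the list is irrelevant; if there is none, the default gives 0. *)
Definition card_list A : nat := size (xget [::] [set s | enumerates A s]).

Lemma card_listE A s : enumerates A s -> card_list A = size s.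
Proof.
move=> As; have [us hs] := As; rewrite /card_list.
have [ut ht] : enumerates A (xget [::] [set s | enumerates A s]).
  exact: (@xgetPex _ [::] [set s | enumerates A s] (ex_intro _ s As)).
apply/eqP; rewrite eq_sym -(uniq_size_uniq ut) // => x.
by apply/idP/idP; [move/ht/hs|move/hs/ht].
Qed.

Lemma listable_sub A s : (forall x, A x -> x \in s) -> listable A.
Proof.
move=> H; exists (undup [seq x <- s | `[< A x >]]); split; first exact: undup_uniq.
by move=> x; rewrite mem_undup mem_filter; split=> [/andP[/asboolP]//|Ax]; rewrite (H x Ax) asboolT.
Qed.

Lemma card_list_eq0 A : (forall x, ~ A x) -> card_list A = 0%N.
Proof. by move=> H; rewrite (@card_listE A [::]) //; split=> // x; split=> // /H. Qed.

Lemma card_list_eq1 A y : (forall x, A x <-> x = y) -> card_list A = 1%N.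
Proof. by move=> H; rewrite (@card_listE A [:: y]) //; split=> // x; rewrite inE H; split=> [/eqP|->]. Qed.

Lemma card_list_ext A B : (forall x, A x <-> B x) -> card_list A = card_list B.
Proof.
move=> H; rewrite /card_list; congr size; congr xget; apply/funext => s; apply/propext.
by split=> -[h1 h2]; split=> // x; rewrite h2 H.
Qed.

Lemma card_listU A B : listable A -> listable B -> (forall x, A x -> ~ B x) ->
  card_list (fun x => A x \/ B x) = (card_list A + card_list B)%N.
Proof.
move=> [s As] [t Bt] dis; rewrite (card_listE As) (card_listE Bt) -size_cat; apply: card_listE.
case: As Bt => us hs [ut ht]; split.
  rewrite cat_uniq us ut andbT; apply/hasPn => x /ht Bx; apply/negP => /hs Ax; exact: dis Bx.
move=> x; rewrite mem_cat; split=> [/orP[/hs|/ht]|[/hs ->|/ht ->]]; rewrite ?orbT //; by [left|right].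
Qed.

Lemma card_list_inj A B (f : T -> T) : listable A -> listable B ->
  (forall x, A x -> B (f x)) -> (forall x y, A x -> A y -> f x = f y -> x = y) -> (card_list A <= card_list B)%N.
Proof.
move=> [s As] [t Bt] fAB finj; rewrite (card_listE As) (card_listE Bt); case: As Bt => us hs [ut ht].
rewrite -(size_map f); apply: uniq_leq_size.
  by rewrite map_inj_in_uniq // => x y /hs Ax /hs Ay; exact: finj.
by move=> _ /mapP[x /hs/fAB/ht fx ->].
Qed.

End Enum.

(** * Signed passages of a path from high to low values *)

Section Count.
Context {R : realType} {X : metricType R}.
Local Notation d := (@mdist R X).
Implicit Types (P Q : R -> X) (u v w t x y : R).

Definition ucf (lam : X -> R) := forall e, 0 < e ->
  exists2 dl, 0 < dl & forall a b, d a b < dl -> `|lam a - lam b| < e.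

Lemma uc_ucf lam P : ucf lam -> uc P -> forall e, 0 < e ->
  exists2 dl, 0 < dl & forall s t, `|s - t| < dl -> `|lam (P s) - lam (P t)| < e.
Proof.
move=> ul uP e e0; have [d1 d10 h1] := ul e e0; have [d2 d20 h2] := uP _ d10.
by exists d2 => // s t st; apply: h1; exact: h2.
Qed.

Variables (lam : X -> R) (chi : X -> Prop) (rho rho' : R).
Hypothesis ul : ucf lam.
Hypothesis rr : rho < rho'.

(** The two thresholds act as a hysteresis: oscillations inside the band between them are not
    counted, which keeps the number of passages finite. *)
Definition low (a : X) := lam a <= rho.
Definition high (a : X) := rho' <= lam a.

Definition noC P x y := forall z, x <= z -> z < y -> ~ low (P z).

(* [y] is the end of a passage from high to low values that enters at a labelled point. *)
Definition entry P u v y := [/\ u <= y <= v, low (P y), chi (P y) &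
  exists x, [/\ u <= x, x < y, high (P x) & noC P x y]].

Lemma low_not_high a : low a -> ~ high a.
Proof. rewrite /low /high => h1 h2; move: rr; lra. Qed.

Lemma first_C P x y : uc P -> x <= y -> low (P y) ->
  exists z, [/\ x <= z, z <= y, low (P z) & noC P x z].
Proof.
move=> uP xy Cy; pose A := [set z | [/\ x <= z, z <= y & low (P z)]].
have lb : has_lbound A by exists x => z [].
have hi : has_inf A by split; [exists y|].
have infA z : A z -> inf A <= z by exact: (ge_inf lb).
have xi : x <= inf A by apply: lb_le_inf; [exists y|move=> z []].
exists (inf A); split=> //; first by apply: infA.
- rewrite /low leNgt; apply/negP => h.
  have e0 : 0 < lam (P (inf A)) - rho by lra.
  have [dl d0 H] := uc_ucf ul uP e0.
  have [z [xz zy Cz] hz] := inf_adherent d0 hi.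
  have iz : inf A <= z by apply: infA.
  have := H z (inf A); rewrite /low in Cz; rewrite !ltr_norml.
  by move=> /(_ _)/andP[|]; [apply/andP; split; lra|lra].
- move=> z xz zi Cz; have zy := le_trans (ltW zi) (infA y (And3 xy (lexx y) Cy)).
  by have := infA z (And3 xz zy Cz); lra.
Qed.

Lemma entry_gap P u v y1 y2 : entry P u v y1 -> entry P u v y2 -> y1 < y2 ->
  exists x, [/\ y1 < x, x < y2, high (P x) & noC P x y2].
Proof.
move=> [_ C1 _ _] [_ _ _ [x [ux xy Ex nC]]] y12; exists x; split=> //.
rewrite ltNge; apply/negP => h; exact: nC h y12 C1.
Qed.

(** Between two entries the path climbs from [rho] to [rho'], which by uniform continuity takes a
    time at least [dl]; so the integer part of (y - u) / dl is injective on entries. *)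
Lemma entry_listable P u v : uc P -> listable (entry P u v).
Proof.
move=> uP; have e0 : 0 < rho' - rho by move: rr; slra.
have [dl d0 H] := uc_ucf ul uP e0.
pose f y := Num.truncn ((y - u) / dl).
have sep y1 y2 : entry P u v y1 -> entry P u v y2 -> y1 < y2 -> (f y1 < f y2)%N.
  move=> E1 E2 y12; have [x [h1 h2 h3 h4]] := entry_gap E1 E2 y12.
  have [/andP[u1 v1] C1 _ _] := E1.
  have le : dl <= x - y1.
    rewrite leNgt; apply/negP => h; have := H x y1; rewrite /low in C1; rewrite /high in h3; rewrite !ltr_norml.
    by move=> /(_ _)/andP[|]; [apply/andP; split; slra|move: rr; slra].
  have h : (y1 - u) / dl + 1 <= (y2 - u) / dl.
    have -> : (y1 - u) / dl + 1 = (y1 - u + dl) / dl by rewrite [RHS]mulrDl divff // lt0r_neq0.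
    by rewrite ler_pM2r ?invr_gt0 //; slra.
  have p1 : 0 <= (y1 - u) / dl by rewrite divr_ge0 ?(ltW d0) // subr_ge0.
  have p2 : 0 <= (y2 - u) / dl by slra.
  rewrite /f -ltnS -(ltr_nat R); have := truncn_itv p1; have := truncn_itv p2.
  move=> /andP[a1 a2] /andP[b1 b2]; rewrite -!natr1 in a2 *; slra.
have inj y1 y2 : entry P u v y1 -> entry P u v y2 -> f y1 = f y2 -> y1 = y2.
  move=> E1 E2 E; apply/eqP; rewrite eq_le !leNgt; apply/andP; split; apply/negP => h.
    by have := sep _ _ E2 E1 h; rewrite E ltnn.
  by have := sep _ _ E1 E2 h; rewrite E ltnn.
have ex k : exists y, (exists2 y', entry P u v y' & f y' = k) -> entry P u v y /\ f y = k.
  have [[y h1 h2]|no] := pselect (exists2 y', entry P u v y' & f y' = k); last by exists 0 => /no.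
  by exists y.
have [g hg] := choice ex.
apply: (@listable_sub _ _ [seq g k | k <- iota 0 (f v).+1]) => y Ey.
have [h1 h2] := hg (f y) (ex_intro2 _ _ y Ey erefl).
have -> : y = g (f y) by apply: inj.
apply: map_f; rewrite mem_iota /= add0n ltnS.
by apply: le_truncn; rewrite ler_pM2r ?invr_gt0 // lerB //; have [/andP[]] := Ey.
Qed.

Definition cnt P u v := card_list (entry P u v).

Definition Echi (a : X) : nat := `[< high a /\ chi a >].

(* The last two terms make [Nc] additive at end points with high values. *)
Definition Nc P u v : int := (cnt P u v)%:Z - (cnt (opath P) (- v) (- u))%:Z
  - (Echi (P u))%:Z + (Echi (P v))%:Z.

(** No passage straddles a low [w], and one that straddles a high [w] may be regarded as starting
    from [w]. A cut inside the band could lose a passage. *)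
Lemma cnt_add P u w v : uc P -> u <= w -> w <= v -> low (P w) \/ high (P w) ->
  cnt P u v = (cnt P u w + cnt P w v)%N.
Proof.
move=> uP uw wv Hw; rewrite /cnt -card_listU; [|exact: entry_listable|exact: entry_listable|]; last first.
  move=> y [/andP[_ yw] _ _ _] [/andP[wy _] _ _ [x [wx xy _ _]]]; lra.
apply: card_list_ext => y; split.
  move=> [/andP[uy yv] Cy chiy [x [ux xy Ex nC]]].
  have [yw|wy] := leP y w; first by left; split=> //; [rewrite uy|exists x].
  right; split=> //; first by rewrite (ltW wy).
  have [wx|xw] := leP w x; first by exists x.
  case: Hw => Hw; first by have := nC w (ltW xw) wy.
  by exists w; split=> // z wz zy; apply: nC => //; apply: le_trans wz; exact: ltW.
case=> -[/andP[uy yv] Cy chiy [x [ux xy Ex nC]]]; split=> //.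
- by rewrite uy (le_trans yv).
- by exists x.
- by rewrite yv (le_trans uw).
- by exists x; split=> //; exact: le_trans ux.
Qed.

Lemma Nc_add P u w v : uc P -> u <= w -> w <= v -> low (P w) \/ high (P w) ->
  Nc P u v = Nc P u w + Nc P w v.
Proof.
move=> uP uw wv Hw; rewrite /Nc (cnt_add uP uw wv Hw).
rewrite (@cnt_add (opath P) (- v) (- w) (- u)) ?lerN2 //; first by rewrite !PoszD; ring.
  exact: uc_opath.
by rewrite /opath opprK.
Qed.

Lemma Nc_opath P u v : Nc (opath P) (- v) (- u) = - Nc P u v.
Proof. by rewrite /Nc opathK !opprK /opath !opprK; ring. Qed.

(** By continuity the first low point after values above [rho] is not below [rho]. Hence the label
    is read only where lam is at least [rho], the region in which it will be controlled. *)
Lemma first_C_level P x y : uc P -> x < y -> noC P x y -> rho <= lam (P y).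
Proof.
move=> uP xy nC; rewrite leNgt; apply/negP => h.
have e0 : 0 < rho - lam (P y) by lra.
have [dl d0 H] := uc_ucf ul uP e0.
pose r := Num.min dl (y - x) / 2.
have m0 : 0 < Num.min dl (y - x) by rewrite lt_min d0; lra.
have mn : Num.min dl (y - x) <= dl by rewrite ge_min lexx.
have mt : Num.min dl (y - x) <= y - x by rewrite ge_min lexx orbT.
apply: (nC (y - r)); [rewrite /r; lra|rewrite /r; lra|rewrite /low].
have := H (y - r) y; rewrite !ltr_norml.
by move=> /(_ _)/andP[|]; [rewrite /r; apply/andP; split; lra|lra].
Qed.

Lemma entry_level P u v y : uc P -> entry P u v y -> rho <= lam (P y).
Proof. by move=> uP [_ _ _ [x [_ xy _ nC]]]; exact: first_C_level xy nC. Qed.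

Lemma Nc_noC P u v : u <= v -> (forall t, u <= t -> t <= v -> ~ low (P t)) ->
  Nc P u v = (Echi (P v))%:Z - (Echi (P u))%:Z.
Proof.
move=> uv H; rewrite /Nc /cnt !card_list_eq0; first by ring.
  by move=> y [/andP[h1 h2]]; rewrite /opath => h _ _; apply: (H (- y)) => //; lra.
by move=> y [/andP[h1 h2]] h _ _; exact: (H y).
Qed.

Lemma Nc_nochi P u v : uc P -> u <= v ->
  (forall t, u <= t -> t <= v -> rho <= lam (P t) -> ~ chi (P t)) -> Nc P u v = 0.
Proof.
move=> uP uv H; have uoP := uc_opath uP.
have z t : u <= t -> t <= v -> Echi (P t) = 0%N.
  move=> t1 t2; rewrite /Echi asboolF // => -[h1]; apply: H => //; move: h1 rr; rewrite /high; lra.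
rewrite /Nc !z ?lexx // /cnt !card_list_eq0 //.
  move=> y Ey; have := entry_level uoP Ey; case: Ey => /andP[h1 h2] _; rewrite /opath => h _ E.
  by apply: (H (- y)) h; rewrite //; lra.
by move=> y Ey; have := entry_level uP Ey; case: Ey => /andP[h1 h2] _ h _ E; exact: (H y) h.
Qed.

(** When all relevant points are labelled, entries of the path and of its reversal alternate, and
    the [Echi] terms correct for the ends. The induction cuts out the passage [x, y] of an entry,
    which contributes 1 - Echi (P x) = 0. Without any entries, the ends are both low or both
    high. *)
Lemma Nc_chi P u v : uc P -> u <= v -> low (P u) \/ high (P u) -> low (P v) \/ high (P v) ->
  (forall t, u <= t -> t <= v -> rho <= lam (P t) -> chi (P t)) -> Nc P u v = 0.
Proof.
have [n] := ubnP (cnt P u v + cnt (opath P) (- v) (- u))%N.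
elim: n P u v => // n IH P u v.
have case1 P1 u1 v1 y : (cnt P1 u1 v1 + cnt (opath P1) (- v1) (- u1) < n.+1)%N ->
  uc P1 -> u1 <= v1 -> low (P1 u1) \/ high (P1 u1) -> low (P1 v1) \/ high (P1 v1) ->
  (forall t, u1 <= t -> t <= v1 -> rho <= lam (P1 t) -> chi (P1 t)) -> entry P1 u1 v1 y -> Nc P1 u1 v1 = 0.
  move=> hn uP1 uv1 Hu Hv Hc Ey; have [/andP[uy yv] Cy chiy [x [ux xy Ex nC]]] := Ey.
  have uoP1 := uc_opath uP1; have xy' := ltW xy; have xv := le_trans xy' yv.
  have Hx : low (P1 x) \/ high (P1 x) by right.
  have Hy : low (P1 y) \/ high (P1 y) by left.
  have ey z : entry P1 x y z <-> z = y.
    split=> [[/andP[xz zy] Cz _ _]|->]; last by split=> //; [rewrite lexx xy'|exists x].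
    by apply/eqP; rewrite eq_le zy leNgt; apply/negP => h; exact: nC xz h Cz.
  have er z : ~ entry (opath P1) (- y) (- x) z.
    move=> [/andP[h1 h2] Cz _ [x1 [h3 h4 _ _]]]; apply: (nC (- z)) Cz; slra.
  have c1 : cnt P1 x y = 1%N by exact: card_list_eq1 ey.
  have c2 : cnt (opath P1) (- y) (- x) = 0%N by exact: card_list_eq0 er.
  have Nxy : Nc P1 x y = 0.
    rewrite /Nc c1 c2 /Echi asboolT ?asboolF //; first by move=> [h _]; exact: low_not_high Cy h.
    split=> //; apply: Hc => //; move: Ex rr; rewrite /high; slra.
  rewrite (Nc_add uP1 ux xv Hx) (Nc_add uP1 xy' yv Hy) Nxy add0r.
  have Ho z : low (P1 z) \/ high (P1 z) -> low (opath P1 (- z)) \/ high (opath P1 (- z)).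
    by rewrite /opath opprK.
  have a1 := cnt_add uP1 ux xv Hx; have a2 := cnt_add uP1 xy' yv Hy.
  have n1 : - x <= - u1 by slra.
  have n2 : - v1 <= - x by slra.
  have n3 : - y <= - x by slra.
  have n4 : - v1 <= - y by slra.
  have b1 := cnt_add uoP1 n2 n1 (Ho _ Hx); have b2 := cnt_add uoP1 n4 n3 (Ho _ Hy).
  rewrite !IH //.
  - by move: hn a1 a2 b1 b2 c1 c2; clear; lia.
  - by move=> t t1 t2; apply: Hc => //; slra.
  - by move: hn a1 a2 b1 b2 c1 c2; clear; lia.
  - by move=> t t1 t2; apply: Hc => //; slra.
move=> hn uP uv Hu Hv Hc; have uoP := uc_opath uP.
have [[y Ey]|no] := pselect (exists y, entry P u v y); first exact: case1 Ey.
have Hco t : - v <= t -> t <= - u -> rho <= lam (opath P t) -> chi (opath P t).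
  by move=> t1 t2; apply: Hc; slra.
have [[y Ey]|no'] := pselect (exists y, entry (opath P) (- v) (- u) y).
  apply/eqP; rewrite -oppr_eq0 -Nc_opath; apply/eqP; apply: case1 Ey => //.
  - by rewrite !opprK opathK addnC.
  - slra.
  - by rewrite /opath opprK.
  - by rewrite /opath opprK.
have z1 : cnt P u v = 0%N by apply: card_list_eq0 => y Ey; apply: no; exists y.
have z2 : cnt (opath P) (- v) (- u) = 0%N by apply: card_list_eq0 => y Ey; apply: no'; exists y.
have enter Q a b : uc Q -> a <= b -> high (Q a) -> low (Q b) ->
   (forall t, a <= t -> t <= b -> rho <= lam (Q t) -> chi (Q t)) -> exists y, entry Q a b y.
  move=> uQ ab Ea Cb Hq; have [z [az zb Cz nC]] := first_C uQ ab Cb.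
  have az' : a < z by rewrite lt_neqAle az andbT; apply/eqP => E; move: Cz; rewrite -E => /low_not_high.
  exists z; split=> //; [by rewrite az| |by exists a; rewrite lexx].
  by apply: Hq => //; exact: first_C_level az' nC.
have EuEv : Echi (P u) = Echi (P v).
  have EC w : low (P w) -> Echi (P w) = 0%N by move=> Cw; rewrite /Echi asboolF // => -[/(low_not_high Cw)].
  have EE w : u <= w -> w <= v -> high (P w) -> Echi (P w) = 1%N.
    move=> w1 w2 Ew; rewrite /Echi asboolT //; split=> //; apply: Hc => //.
    by move: Ew rr; rewrite /high; slra.
  case: Hu => Hu; case: Hv => Hv.
  - by rewrite !EC.
  - case: no'; apply: enter => //; [slra|by rewrite /opath opprK|by rewrite /opath opprK].
  - by case: no; apply: enter.
  - by rewrite !EE.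
by rewrite /Nc z1 z2 EuEv; ring.
Qed.

Hypothesis nq : @noquad R X.
Hypothesis gf : @grid_filling R X.

(** An entry y with start x lifts to x' < y' in [P'], and the first low point z after x' is an entry
    of [P']. It has the label of P y: z lifts back to some t, and if P' z were not P y, then P t
    would be low with x < t < y. Order preservation makes the assignment injective. *)
Lemma cnt_le P P' u v u' v' : uc P -> uc P' -> u <= v -> u' <= v' -> reduced P u v -> reduced P' u' v' ->
  W (samples P u v) (samples P' u' v') -> (cnt P u v <= cnt P' u' v')%N.
Proof.
move=> uP uP' uv uv' rP rP' HW.
pose rel y y2 := exists x x' y', [/\ [/\ u <= x, x < y, high (P x) & noC P x y],
  u' <= x' /\ x' <= y2, y2 <= y' /\ y' <= v', W (samples P u x) (samples P' u' x') &
  W (samples P u y) (samples P' u' y')].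
have ex y : exists y2, entry P u v y -> entry P' u' v' y2 /\ rel y y2.
  have [Ey|nE] := pselect (entry P u v y); last by exists 0.
  have [/andP[uy yv] Cy chiy [x [ux xy Ex nC]]] := Ey.
  have xv : x <= v by slra.
  have [x' /andP[ux' xv'] Wx] := arc_cover1 nq gf uP uP' rP ux xv uv' HW.
  have [y' /andP[uy' yv'] Wy] := arc_cover1 nq gf uP uP' rP uy yv uv' HW.
  have Ex' : P x = P' x' by apply: W_endpoints Wx.
  have Ey' : P y = P' y' by apply: W_endpoints Wy.
  have nxy : P x <> P y by move=> E; move: Ex; rewrite E; exact: low_not_high.
  have xy' : x' < y' by exact: (lift_mono nq gf uP uP' rP rP' ux (ltW xy) yv ux' xv' uy' nxy Wx Wy).
  have Cy' : low (P' y') by rewrite -Ey'.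
  have [z [xz zy Cz nCz]] := first_C uP' (ltW xy') Cy'.
  have xz' : x' < z.
    by rewrite lt_neqAle xz andbT; apply/eqP => E; move: Cz; rewrite -E -Ex' => /low_not_high; apply.
  exists z => _; split; last by exists x, x', y'.
  have uz : u' <= z by slra.
  have zv : z <= v' by slra.
  split=> //; [by rewrite uz| |by exists x'; rewrite -Ex'].
  have [t /andP[ut tv] Wt] := arc_cover1 nq gf uP' uP rP' uz zv uv (W_sym HW).
  have Et : P' z = P t by apply: W_endpoints Wt.
  suff -> : P' z = P y by [].
  apply: contrapT => ne; rewrite Ey' in ne.
  have ty : t < y by exact: (lift_mono nq gf uP' uP rP' rP uz zy yv' ut tv uy ne Wt (W_sym Wy)).
  have nxz : P' x' <> P' z by move=> E; move: Cz; rewrite -E -Ex' => /low_not_high; apply.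
  have xt : x < t by exact: (lift_mono nq gf uP' uP rP' rP ux' xz zv ux xv ut nxz (W_sym Wx) Wt).
  by apply: (nC t (ltW xt) ty); rewrite -Et.
have [f hf] := choice ex.
have lt12 y1 y2 : entry P u v y1 -> entry P u v y2 -> y1 < y2 -> f y1 < f y2.
  move=> E1 E2 y12; have [_ [_ [_ [y1' [_ _ [h1 h1'] _ W1]]]]] := hf _ E1.
  have [_ [x2 [x2' [y2' [[ux2 xy2 Ex2 nC2] [ux2' h2] [k1 k2] W2 _]]]]] := hf _ E2.
  have [/andP[uy1 yv1] C1 _ _] := E1.
  have y1x : y1 < x2 by rewrite ltNge; apply/negP => h; exact: nC2 h y12 C1.
  have ne : P y1 <> P x2 by move=> E; move: Ex2; rewrite -E; exact: low_not_high.
  have xv2 : x2 <= v by have [/andP[? ?] _ _ _] := E2; slra.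
  have uy1' : u' <= y1'.
    have [[/andP[? ?] _ _ _] _] := hf _ E1; slra.
  have := lift_mono nq gf uP uP' rP rP' uy1 (ltW y1x) xv2 uy1' h1' ux2' ne W1 W2.
  slra.
apply: (@card_list_inj _ _ _ f); [exact: entry_listable|exact: entry_listable| |].
  by move=> y /hf[].
move=> y1 y2 E1 E2 E; apply/eqP; rewrite eq_le !leNgt; apply/andP; split; apply/negP => h.
  by have := lt12 _ _ E2 E1 h; rewrite E ltxx.
by have := lt12 _ _ E1 E2 h; rewrite E ltxx.
Qed.

Lemma Nc_W P P' u v u' v' : uc P -> uc P' -> u <= v -> u' <= v' -> reduced P u v -> reduced P' u' v' ->
  W (samples P u v) (samples P' u' v') -> Nc P u v = Nc P' u' v'.
Proof.
move=> uP uP' uv uv' rP rP' HW.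
have E0 : P u = P' u' by have := ht_head (P u) (HW 1 ltr01).
have E1 : P v = P' v' by apply: W_endpoints HW.
have c1 : cnt P u v = cnt P' u' v'.
  by apply/eqP; rewrite eqn_leq !cnt_le //; exact: W_sym.
have nv : - v <= - u by lra.
have nv' : - v' <= - u' by lra.
have HWo := W_rev_opath uP uP' uv uv' HW.
have ro := reduced_opath uP uv rP; have ro' := reduced_opath uP' uv' rP'.
have uo := uc_opath uP; have uo' := uc_opath uP'.
have c2 : cnt (opath P) (- v) (- u) = cnt (opath P') (- v') (- u').
  apply/eqP; rewrite eqn_leq (cnt_le uo uo') // (cnt_le uo' uo) //; exact: W_sym.
by rewrite /Nc c1 c2 E0 E1.
Qed.

(** The three sides are cut at the centre of the tripod, and their halves agree in pairs, one pair
    with opposite directions. Additivity at the cut is why the centre has to be low or high. *)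
Lemma Nc_triangle P1 P2 P3 : uc P1 -> uc P2 -> uc P3 ->
  reduced P1 0 1 -> reduced P2 0 1 -> reduced P3 0 1 ->
  forall t s1 s2, 0 <= t <= 1 -> 0 <= s1 <= 1 -> 0 <= s2 <= 1 ->
    W (samples P3 0 t) (samples P1 0 s1) ->
    W (samples P2 0 s2) (samples (opath P1) (- 1) (- s1)) ->
    W (samples P3 t 1) (samples P2 s2 1) ->
    P3 t = P1 s1 /\ P3 t = P2 s2 -> low (P3 t) \/ high (P3 t) ->
  Nc P1 0 1 + Nc P2 0 1 = Nc P3 0 1.
Proof.
move=> u1 u2 u3 r1 r2 r3 t s1 s2 /andP[t0 t1] /andP[s10 s11] /andP[s20 s21] W1 W2 W3 [E1 E2] Hm.
rewrite (Nc_add u3 t0 t1 Hm).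
rewrite E1 in Hm; rewrite (Nc_add u1 s10 s11 Hm).
rewrite -E1 E2 in Hm; rewrite (Nc_add u2 s20 s21 Hm).
have p r : r <= 1 -> reduced P1 0 r by move=> h; exact: reduced_prefix r1 h.
rewrite (Nc_W u3 u1 t0 s10 (reduced_prefix r3 t1) (reduced_prefix r1 s11) W1).
rewrite (Nc_W u3 u2 t1 s21 (reduced_suffix u3 r3 t0) (reduced_suffix u2 r2 s20) W3).
have m1 : - 1 <= - s1 by lra.
have ro := reduced_opath u1 s11 (reduced_suffix u1 r1 s10).
rewrite (Nc_W u2 (uc_opath u1) s20 m1 (reduced_prefix r2 s21) ro W2) Nc_opath; ring.
Qed.

End Count.

(** * Lebesgue numbers and Urysohn functions in compact metric spaces *)

Section CompactMetric.
Context {R : realType} {X : metricType R}.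
Local Notation d := (@mdist R X).
Hypothesis cX : compact [set: X].

(** Otherwise the complements of finite unions of balls generate a proper filter, whose cluster
    point would be avoided by its own ball. *)
Lemma fin_cover (r : X -> R) : (forall x, 0 < r x) ->
  exists s : seq X, forall y, exists2 x, x \in s & d x y < r x.
Proof.
move=> r0; apply: contrapT => no.
pose F : set_system X := [set B | exists s : seq X, forall y, (forall x, x \in s -> r x <= d x y) -> B y].
have FF : ProperFilter F.
  apply: Build_ProperFilter_ex.
    move=> B [s sB]; apply: contrapT => nB; apply: no; exists s => y.
    apply: contrapT => h; apply: nB; exists y; apply: sB => x xs.
    by rewrite leNgt; apply/negP => h'; apply: h; exists x.
  split; first by exists [::].
    move=> A B [s sA] [t tB]; exists (s ++ t) => y H; split.
      by apply: sA => x xs; apply: H; rewrite mem_cat xs.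
    by apply: tB => x xs; apply: H; rewrite mem_cat xs orbT.
  by move=> A B AB [s sA]; exists s => y /sA/AB.
have [p [_ cp]] := cX FF filterT.
have Fp : F [set y | r p <= d p y] by exists [:: p] => y; apply; rewrite mem_head.
have [y []] := cp _ _ Fp (nbhsx_ballx p (r p) (r0 p)).
by rewrite ballEmdist /= leNgt => /negP.
Qed.

Lemma min_pos (T : eqType) (s : seq T) (r : T -> R) : (forall x, 0 < r x) ->
  exists2 g, 0 < g & forall x, x \in s -> g <= r x.
Proof.
move=> r0; elim: s => [|x s [g g0 H]]; first by exists 1.
exists (Num.min g (r x)); first by rewrite lt_min g0 r0.
move=> y; rewrite in_cons => /orP[/eqP ->|/H h]; first by rewrite ge_min lexx orbT.
by rewrite ge_min h.
Qed.

Lemma open_dist (U : set X) x : open U -> U x -> exists2 r, 0 < r & forall y, d x y < r -> U y.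
Proof.
move=> oU Ux; have : nbhs x U by exact: open_nbhs_nbhs.
rewrite -nbhs_ballE => -[r /= r0 H]; exists r => // y h; apply: H.
by rewrite ballEmdist.
Qed.

Lemma dist_open (U : set X) : (forall x, U x -> exists2 r, 0 < r & forall y, d x y < r -> U y) -> open U.
Proof.
move=> H; rewrite openE => x /H[r r0 h]; rewrite /interior -nbhs_ballE; exists r => //= y.
by rewrite ballEmdist; exact: h.
Qed.

(** This is a Lebesgue number of the cover by [U] and [V]. *)
Lemma sep_closed (U V : set X) : open U -> open V -> (forall x, U x \/ V x) ->
  exists2 g, 0 < g & forall x y, ~ U x -> ~ V y -> g <= d x y.
Proof.
move=> oU oV UV.
have ex x : exists r : R, 0 < r /\ ((forall y, d x y < 2 * r -> U y) \/ (forall y, d x y < 2 * r -> V y)).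
  by case: (UV x) => [/(open_dist oU)|/(open_dist oV)] [r r0 H]; exists (r / 2); split; try lra;
    [left|right] => y h; apply: H; lra.
have [r hr] := choice ex.
have [s hs] := fin_cover (fun x => (hr x).1).
have [g g0 hg] := min_pos s (fun x => (hr x).1).
exists g => // x y nU nV; rewrite leNgt; apply/negP => h.
have [z zs hz] := hs x; have := hg z zs.
have := metric_triangle z x y; case: (hr z) => r0 [] H T gz.
  by apply: nU; apply: H; lra.
by apply: nV; apply: H; lra.
Qed.

(** The function is the distance to [F0] divided by [g] and truncated at 1. Written as 1 - sup with
    0 among the competitors, it also makes sense for empty [F0]. *)
Lemma urysohn (F0 F1 : set X) (g : R) : 0 < g -> (forall x y, F0 x -> F1 y -> g <= d x y) ->
  exists lam : X -> R, [/\ ucf lam, (forall x, 0 <= lam x), (forall x, F0 x -> lam x = 0) & (forall x, F1 x -> lam x = 1)].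
Proof.
move=> g0 sepF.
pose E x := [set z | z = 0 \/ exists2 y, F0 y & z = 1 - d x y / g].
have dg a b : 0 <= d a b / g by rewrite divr_ge0 ?mdist_ge0 ?(ltW g0).
have ub x z : E x z -> z <= 1 by move=> [->//|[y _ ->]]; have := dg x y; lra.
have hs x : has_sup (E x) by split; [exists 0; left|exists 1 => z; exact: ub].
have s0 x : 0 <= sup (E x) by apply: sup_upper_bound => //; left.
have s1 x : sup (E x) <= 1 by apply: ge_sup; [exists 0; left|move=> z; exact: ub].
have lip x y : sup (E x) <= sup (E y) + d x y / g.
  apply: ge_sup; first by exists 0; left.
  move=> z [->|[w Fw ->]]; first by have := s0 y; have := dg x y; lra.
  have h : 1 - d y w / g <= sup (E y) by apply: sup_upper_bound => //; right; exists w.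
  have : d y w / g <= d x w / g + d x y / g.
    rewrite -mulrDl ler_pM2r ?invr_gt0 //; have := metric_triangle y x w; rewrite (metric_sym y x); lra.
  lra.
exists (fun x => 1 - sup (E x)); split.
- move=> e e0; exists (e * g); first by rewrite mulr_gt0.
  move=> a b; rewrite -ltr_pdivrMr // => h; have := lip a b; have := lip b a.
  rewrite (metric_sym b a) => h1 h2; rewrite ltr_norml; apply/andP; split; lra.
- by move=> x; have := s1 x; lra.
- move=> x Fx; have : 1 <= sup (E x); last by have := s1 x; lra.
  by apply: sup_upper_bound => //; right; exists x => //; rewrite mdistxx mul0r subr0.
- move=> x Fx; have : sup (E x) <= 0; last by have := s0 x; lra.
  apply: ge_sup; first by exists 0; left.
  move=> z [->//|[y Fy ->]]; have := sepF y x Fy Fx; rewrite metric_sym => h.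
  have : 1 <= d x y / g by rewrite ler_pdivlMr // mul1r.
  lra.
Qed.

End CompactMetric.

(** This will turn every vertex of a finite net and every centre of its triangles into a low or a
    high point. *)
Lemma avoid_band (R : realType) (l : seq R) (a b : R) : a < b ->
  exists r r', [/\ a <= r, r < r', r' <= b & forall z, z \in l -> z <= r \/ r' <= z].
Proof.
move=> ab; elim: l => [|z l [r [r' [ar rr rb H]]]]; first by exists a, b.
have [zr|rz] := leP z r.
  by exists r, r'; split=> // y; rewrite in_cons => /orP[/eqP->|/H//]; left.
have [rz'|zr'] := leP r' z.
  by exists r, r'; split=> // y; rewrite in_cons => /orP[/eqP->|/H//]; right.
exists z, r'; split=> //; first lra.
move=> y; rewrite in_cons => /orP[/eqP->|/H[h|h]]; [left| left|right] => //; lra.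
Qed.

(** * Reduced edges and triangle centres at a small scale *)

Section ThreeSets.
Context {R : realType} {X : metricType R}.
Local Notation d := (@mdist R X).

(** The edges join the moved points [v a], because the almost retraction does not fix the points of
    X. *)
Definition edge_system := forall eps : R, 0 < eps -> exists2 dl : R, 0 < dl &
  exists (v : X -> X) (E : X -> X -> R -> X),
    (forall a b, d a b < dl -> [/\ uc (E a b), E a b 0 = v a, E a b 1 = v b & forall t, d (E a b t) a < eps]) /\
    (forall a b c, d a b < dl -> d b c < dl -> d a c < dl ->
      W (samples (E a c) 0 1) (fun e => ch e (E a b) 0 1 ++ ch e (E b c) 0 1)).

Definition three_split := forall U1 U2 U3 : set X, open U1 -> open U2 -> open U3 ->
  (forall x, [\/ U1 x, U2 x | U3 x]) -> exists V1 V2 V3 : set X,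
  [/\ open V1, open V2, open V3, (forall x, [\/ V1 x, V2 x | V3 x]) &
     [/\ V1 `<=` U1, V2 `<=` U2, V3 `<=` U3 & forall x, ~ [/\ V1 x, V2 x & V3 x]]].

Hypothesis cX : compact [set: X].
Hypothesis nq : @noquad R X.
Hypothesis gf : @grid_filling R X.
Hypothesis es : edge_system.

(** The centres [m] are chosen before lam, chi and the band, because the band will have to avoid the
    values of lam at the centres. *)
Lemma reduced_system eps : 0 < eps -> exists2 dl : R, 0 < dl &
  exists (v : X -> X) (E : X -> X -> R -> X),
    (forall a b, d a b < dl -> [/\ uc (E a b), E a b 0 = v a, E a b 1 = v b & forall t, d (E a b t) a < eps]
       /\ reduced (E a b) 0 1) /\
    exists m : X -> X -> X -> X, forall a b c, d a b < dl -> d b c < dl -> d a c < dl ->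
      forall lam chi rho rho', ucf lam -> rho < rho' -> low lam rho (m a b c) \/ high lam rho' (m a b c) ->
      Nc lam chi rho rho' (E a b) 0 1 + Nc lam chi rho rho' (E b c) 0 1 = Nc lam chi rho rho' (E a c) 0 1.
Proof.
move=> e0; have [dl d0 [v [E [hE hW]]]] := es e0; exists dl => //; exists v.
have l01 : (0 : R) <= 1 by exact: ler01.
have ex (ab : X * X) : exists Q, d ab.1 ab.2 < dl ->
  [/\ uc Q, reduced Q 0 1, (forall x, exists2 y, 0 <= y <= 1 & Q x = E ab.1 ab.2 y),
      Q 0 = E ab.1 ab.2 0 /\ Q 1 = E ab.1 ab.2 1 & W (samples (E ab.1 ab.2) 0 1) (samples Q 0 1)].
  have [h|h] := pselect (d ab.1 ab.2 < dl); last by exists (E ab.1 ab.2) => /h.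
  have [uE _ _ _] := hE _ _ h; by have [Q HQ] := reduction uE l01; exists Q.
have [f hf] := choice ex; pose Q a b := f (a, b).
have hQ a b : d a b < dl -> [/\ uc (Q a b), Q a b 0 = v a, Q a b 1 = v b & forall t, d (Q a b t) a < eps]
    /\ reduced (Q a b) 0 1.
  move=> ab; have [/= h1 h2 h3 [h4 h5] h6] := hf (a, b) ab; have [k1 k2 k3 k4] := hE _ _ ab.
  split=> //; split; rewrite /Q ?h4 ?h5 //.
  by move=> t; have [y _ ->] := h3 t; exact: k4.
exists Q; split=> //.
have exm (t : X * X * X) : exists m, d t.1.1 t.1.2 < dl -> d t.1.2 t.2 < dl -> d t.1.1 t.2 < dl ->
   forall lam chi rho rho', ucf lam -> rho < rho' -> low lam rho m \/ high lam rho' m ->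
      Nc lam chi rho rho' (Q t.1.1 t.1.2) 0 1 + Nc lam chi rho rho' (Q t.1.2 t.2) 0 1 =
      Nc lam chi rho rho' (Q t.1.1 t.2) 0 1.
  case: t => -[a b] c /=.
  have [ab|] := pselect (d a b < dl); last by exists a.
  have [bc|] := pselect (d b c < dl); last by exists a.
  have [ac|] := pselect (d a c < dl); last by exists a.
  have [[u1 s1 e1 _] r1] := hQ _ _ ab; have [[u2 s2 e2 _] r2] := hQ _ _ bc; have [[u3 s3 e3 _] r3] := hQ _ _ ac.
  have W3 : W (samples (Q a c) 0 1) (fun e => ch e (Q a b) 0 1 ++ ch e (Q b c) 0 1).
    have [_ _ _ _ w1] := hf (a, b) ab; have [_ _ _ _ w2] := hf (b, c) bc; have [_ _ _ _ w3] := hf (a, c) ac.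
    apply: W_trans (W_sym w3) _; apply: W_trans (hW a b c ab bc ac) _ => e e1'.
    by apply: ht_cat; [exact: w1|exact: w2].
  have E12 : Q b c 0 = Q a b 1 by rewrite s2 e1.
  have [t [x1 [x2 [h1 h2 h3 [w1 w2 w3] h4]]]] := median nq gf u1 u2 u3 r3 E12 W3.
  exists (Q a c t) => _ _ _ lam chi rho rho' ul rr Hm.
  exact: (Nc_triangle chi ul rr nq gf u1 u2 u3 r1 r2 r3 h1 h2 h3 w1 w2 w3 h4 Hm).
have [g hg] := choice exm; exists (fun a b c => g (a, b, c)) => a b c.
exact: hg (a, b, c).
Qed.

End ThreeSets.

(** * Weighted sums over a finite net *)

Section WeightedSums.
Context {R : realType} {X : metricType R}.
Local Notation d := (@mdist R X).
Variables (S : seq X) (eta : R).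

Definition wt (a x : X) : R := Num.max 0 (eta - d x a).

Lemma wt_ge0 a x : 0 <= wt a x.
Proof. by rewrite /wt le_max lexx. Qed.

Lemma wt_pos a x : d x a < eta -> 0 < wt a x.
Proof. by move=> h; rewrite /wt lt_max; apply/orP; right; lra. Qed.

Lemma wt_neq0 a x : wt a x != 0 -> d x a < eta.
Proof. by apply: contraNT; rewrite -leNgt => h; rewrite /wt max_l //; lra. Qed.

Lemma wt_lip a x y : `|wt a x - wt a y| <= d x y.
Proof.
have := metric_triangle x y a; have := metric_triangle y x a; rewrite (metric_sym y x).
have := mdist_ge0 x y; rewrite /wt ler_norml.
by case: (leP 0 (eta - d x a)) => ?; case: (leP 0 (eta - d y a)) => ?; move=> *; apply/andP; split; lra.
Qed.

(** Not divided by the total weight, the sums are Lipschitz on all of X; inequalities between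
    averages are multiplied by the total weight instead. *)
Definition wsum (c : X -> R) x := \sum_(a <- S) wt a x * c a.

Lemma wsum_lip c : exists2 L, 0 < L & forall x y, `|wsum c x - wsum c y| <= L * d x y.
Proof.
exists (\sum_(a <- S) `|c a| + 1); first by rewrite ltr_wpDl // sumr_ge0.
move=> x y; rewrite /wsum -sumrB; apply: (le_trans (ler_norm_sum _ _ _)).
apply: (@le_trans _ _ ((\sum_(a <- S) `|c a|) * d x y)).
  rewrite mulr_suml; apply: ler_sum => a _; rewrite -mulrBl normrM mulrC.
  by rewrite ler_wpM2l // wt_lip.
by rewrite ler_wpM2r ?mdist_ge0 // lerDl.
Qed.

Lemma wsum_ge c x : (forall a, a \in S -> d x a < eta -> 1 <= c a) -> wsum (fun=> 1) x <= wsum c x.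
Proof.
move=> H; rewrite /wsum big_seq [X in _ <= X]big_seq; apply: ler_sum => a aS.
have [->|/wt_neq0 h] := eqVneq (wt a x) 0; first by rewrite !mul0r.
by rewrite ler_wpM2l ?wt_ge0 // H.
Qed.

Lemma wsumN c x : wsum (fun a => - c a) x = - wsum c x.
Proof. by rewrite /wsum -sumrN; apply: eq_bigr => a _; rewrite mulrN. Qed.

Lemma wsum_shift c c' k x : (forall a, a \in S -> d x a < eta -> c' a = c a + k) ->
  wsum c' x = wsum c x + k * wsum (fun=> 1) x.
Proof.
move=> H; rewrite /wsum mulr_sumr -big_split /= big_seq [RHS]big_seq; apply: eq_bigr => a aS.
have [->|/wt_neq0 h] := eqVneq (wt a x) 0; first by rewrite !mul0r mulr0 addr0.
by rewrite H //; ring.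
Qed.

Lemma wsum_gt0 x a : a \in S -> d x a < eta -> 0 < wsum (fun=> 1) x.
Proof.
move=> aS xa; rewrite /wsum (big_rem a) //= mulr1 ltr_pwDl ?wt_pos // sumr_ge0 // => b _.
by rewrite mulr1 wt_ge0.
Qed.

End WeightedSums.

(** * Residues modulo 3 and the map to the circle *)

Lemma int_le0_ge1 (R : realType) (z : int) : z%:~R <= 0 :> R \/ 1 <= z%:~R :> R.
Proof. by rewrite lerz0 ler1z -gtz0_ge1 ltNge; case: (z <= 0); [left|right]. Qed.

(** Integers at distance less than 1 from [t] differ pairwise by at most 1, so three of them cannot
    have three distinct residues. *)
Lemma no_three_residues (R : realType) (t : R) (p q r : int) : `|t - (0 + 3 * p%:~R)| < 1 ->
  `|t - (1 + 3 * q%:~R)| < 1 -> `|t - (-1 + 3 * r%:~R)| < 1 -> False.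
Proof.
rewrite !ltr_norml => /andP[a1 a2] /andP[b1 b2] /andP[e1 e2].
have i1 : (3 * q - 3 * p)%:~R < 1%:~R :> R by rewrite intrB !intrM; lra.
have i2 : (-3)%:~R < (3 * q - 3 * p)%:~R :> R by rewrite intrB !intrM; lra.
have i3 : (3 * r - 3 * p)%:~R < 3%:~R :> R by rewrite intrB !intrM; lra.
have i4 : (-1)%:~R < (3 * r - 3 * p)%:~R :> R by rewrite intrB !intrM; lra.
rewrite !ltr_int in i1 i2 i3 i4.
have Eq : q = p by move: i1 i2; clear; lia.
have Er : r = p by move: i3 i4; clear; lia.
by rewrite Eq in b1 b2; rewrite Er in e1 e2; lra.
Qed.

Lemma some_residue (R : realType) (t : R) : exists i (z : int),
  [\/ i = 0, i = 1 | i = -1] /\ `|t - (i + 3 * z%:~R)| < 1.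
Proof.
pose j := Num.floor t; have /andP[j1 j2] := floor_itv t.
have hj i (z : int) : j%:~R = i + 3 * z%:~R -> `|t - (i + 3 * z%:~R)| < 1.
  by move=> <-; move: j2; rewrite intrD ltr_norml => j2; apply/andP; split; lra.
have := divz_eq j 3; have m0 : (0 <= (j %% 3)%Z)%R by exact: modz_ge0.
have m3 : ((j %% 3)%Z < 3)%R by exact: ltz_pmod.
move: m0 m3; set q := (j %/ 3)%Z; case: ((j %% 3)%Z) => // -[|[|[|//]]] _ _ Ej.
- by exists 0, q; split; [constructor 1|apply: hj; rewrite Ej addr0 intrM mulrC add0r].
- by exists 1, q; split; [constructor 2|apply: hj; rewrite Ej intrD intrM mulrC addrC].
- exists (-1), (q + 1); split; [by constructor 3|apply: hj; rewrite Ej !intrD intrM].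
  by have -> : (2%:Z)%:~R = 2 :> R by []; ring.
Qed.

(* The heights [h] and the cocycle [n] define a map to the circle R/3Z: near a point a
   of the net its lift is the weighted average of the h b + 3 n(a,b), and arcs i is the
   preimage of the open unit arc around i. *)
Section CircleMap.
Context {R : realType} {X : metricType R}.
Local Notation d := (@mdist R X).
Variables (S : seq X) (eta : R) (h : X -> R) (n : X -> X -> int).
Hypothesis net : forall x, exists2 a, a \in S & d x a < eta.
Hypothesis coc : forall x a b c, a \in S -> b \in S -> c \in S ->
  d x a < eta -> d x b < eta -> d x c < eta -> n a b + n b c = n a c.

Definition gap_to i (z : int) a b : R := h b + 3 * (n a b)%:~R - i - 3 * z%:~R.

Definition arcs i : set X := [set x | exists a, [/\ a \in S, d x a < eta & exists z : int,
   `|wsum S eta (gap_to i z a) x| < wsum S eta (fun=> 1) x]].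

Lemma arcs_open i : open (arcs i).
Proof.
apply: dist_open => x [a [aS xa [z H]]].
have [L1 L10 h1] := wsum_lip S eta (gap_to i z a); have [L2 L20 h2] := wsum_lip S eta (fun=> 1).
move: h1 h2 H; set f := wsum S eta (gap_to i z a); set g := wsum S eta (fun=> 1) => h1 h2 H.
have D0 : 0 < g x - `|f x| by lra.
have LL : 0 < L1 + L2 by lra.
exists (Num.min (eta - d x a) ((g x - `|f x|) / (L1 + L2))).
  by rewrite lt_min divr_gt0 // andbT; lra.
move=> y; rewrite lt_min => /andP[y1]; rewrite ltr_pdivlMr // => y2.
exists a; split=> //; first by have := metric_triangle y x a; rewrite (metric_sym y x); lra.
exists z; rewrite -/f -/g; rewrite mulrDr ![d x y * _]mulrC in y2.
have := h2 x y; rewrite ler_norml => /andP[_ b]; have := h1 x y.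
by have := ler_normB (f x) (f x - f y); rewrite subKr; lra.
Qed.

Let height a x : R := wsum S eta (gap_to 0 0 a) x / wsum S eta (fun=> 1) x.

Lemma arcs_lift i z a x : a \in S -> d x a < eta ->
  (`|wsum S eta (gap_to i z a) x| < wsum S eta (fun=> 1) x) = (`|height a x - (i + 3 * z%:~R)| < 1).
Proof.
move=> aS xa; have den0 := wsum_gt0 aS xa.
rewrite (@wsum_shift _ _ _ _ (gap_to 0 0 a) _ (- (i + 3 * z%:~R))); last first.
  by move=> y _ _; rewrite /gap_to; ring.
rewrite /height; move: den0; set den := wsum S eta (fun=> 1) x; set num := wsum S eta _ x => den0.
have -> : num + - (i + 3 * z%:~R) * den = (num / den - (i + 3 * z%:~R)) * den.
  by rewrite mulrBl mulNr divfK // lt0r_neq0.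
by rewrite normrM (gtr0_norm den0) -ltr_pdivlMr // divff // lt0r_neq0.
Qed.

(** This is where the cocycle identity enters: changing the base point of the lift shifts all
    heights by the same multiple of 3. *)
Lemma arcs_move x a b z i : a \in S -> b \in S -> d x a < eta -> d x b < eta ->
  wsum S eta (gap_to i z b) x = wsum S eta (gap_to i (z + n a b) a) x.
Proof.
move=> aS bS xa xb; rewrite (@wsum_shift _ _ _ _ (gap_to i (z + n a b) a) _ 0) ?mul0r ?addr0 // => p pS xp.
by rewrite /gap_to -(@coc x a b p) // ?intrD; ring.
Qed.

Lemma arcs_cover x : [\/ arcs 0 x, arcs 1 x | arcs (-1) x].
Proof.
have [a aS xa] := net x; have [i [z [hi hz]]] := some_residue (height a x).
have ai : arcs i x by exists a; split=> //; exists z; rewrite arcs_lift.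
by case: hi => E; rewrite E in ai; [constructor 1|constructor 2|constructor 3].
Qed.

Lemma arcs_triple x : ~ [/\ arcs 0 x, arcs 1 x & arcs (-1) x].
Proof.
move=> [[a [aS xa [ka Ha]]] [b [bS xb [kb Hb]]] [e [eS xe [ke He]]]].
rewrite (arcs_move _ _ aS bS) // in Hb; rewrite (arcs_move _ _ aS eS) // in He.
rewrite !arcs_lift // in Ha Hb He; exact: no_three_residues Ha Hb He.
Qed.

(** A weighted average of numbers that are all at least 1, or all at most -1, does not lie in (-1,
    1). *)
Lemma arcs_avoid i x : (forall a z, a \in S -> d x a < eta ->
  (forall b, b \in S -> d x b < eta -> 1 <= gap_to i z a b) \/
  (forall b, b \in S -> d x b < eta -> gap_to i z a b <= -1)) -> ~ arcs i x.
Proof.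
move=> H [a [aS xa [z]]]; case: (H a z aS xa) => {}H.
  by have := wsum_ge H; have := ler_norm (wsum S eta (gap_to i z a) x); lra.
have : wsum S eta (fun=> 1) x <= wsum S eta (fun b => - gap_to i z a b) x.
  by apply: wsum_ge => b bS xb; have := H b bS xb; lra.
by rewrite wsumN; have := ler_norm (- wsum S eta (gap_to i z a) x); rewrite normrN; lra.
Qed.

End CircleMap.

(** * Refinement of a cover by three open sets *)

Section ThreeSplit.
Context {R : realType} {X : metricType R}.
Local Notation d := (@mdist R X).
Hypothesis cX : compact [set: X].
Hypothesis nq : @noquad R X.
Hypothesis gf : @grid_filling R X.
Hypothesis es : @edge_system R X.

Lemma three_split_of_edges : @three_split R X.
Proof.
move=> U1 U2 U3 o1 o2 o3 cov.
have [g g0 hg] : exists2 g : R, 0 < g & forall x y, ~ (U2 `|` U3) x -> ~ U1 y -> g <= d x y.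
  apply: (sep_closed cX) => //; first exact: openU.
  by move=> x; case: (cov x) => h; [right|left; left|left; right].
have [lam [ul lam0 lamA lamB]] := @urysohn R X (~` (U2 `|` U3)) (~` U1) g g0 hg.
have oZ : open [set x | lam x < 1 / 4].
  apply: dist_open => x /= h; have e0 : 0 < 1 / 4 - lam x by slra.
  have [dl d0 H] := ul _ e0; exists dl => // y /H; rewrite ltr_norml => /andP[]; slra.
(* Labels do not matter where lam is small, so the set lam < 1 / 4 is added to both [U2] and [U3].
   It contains the points outside both of them, where lam vanishes, so the enlarged sets cover X. *)
have [g' g0' hg'] : exists2 g : R, 0 < g & forall x y,
    ~ ([set x | lam x < 1 / 4] `|` U3) x -> ~ ([set x | lam x < 1 / 4] `|` U2) y -> g <= d x y.
  apply: (sep_closed cX); [exact: openU|exact: openU|] => x.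
  case: (cov x) => h; [|by right; right|by left; right].
  have [h2|n2] := pselect (U2 x); first by right; right.
  have [h3|n3] := pselect (U3 x); first by left; right.
  by left; left; rewrite /= lamA; [slra|case].
have [mu [um mu0 muA muB]] := @urysohn R X (~` ([set x | lam x < 1 / 4] `|` U3))
   (~` ([set x | lam x < 1 / 4] `|` U2)) g' g0' hg'.
pose chi x := 1 / 2 < mu x.
(* As 1 / 12 = 1 / 3 - 1 / 4 and rho >= 1 / 3, a value of lam at least [rho] near x forces lam x > 1
   / 4, the region where [mu] separates. A variation of [mu] below 1 / 2 lets the value 0 or 1 at x
   decide the labels nearby. *)
have t0 : 0 < 1 / 12 :> R by slra.
have t1 : 0 < 1 / 2 :> R by slra.
have [k1 k10 hk1] := ul _ t0; have [k2 k20 hk2] := um _ t1.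
pose k := Num.min k1 k2.
have k0 : 0 < k by rewrite lt_min k10.
have k4 : 0 < k / 4 by slra.
have [dl d0 [v [E [hE [m hm]]]]] := reduced_system nq gf es k4.
pose eta := Num.min dl k / 4.
have eta0 : 0 < eta by rewrite /eta divr_gt0 // lt_min d0.
have etad : eta + eta < dl.
  have : Num.min dl k <= dl by rewrite ge_min lexx.
  by move: eta0; rewrite /eta; slra.
have etak : eta <= k / 4 by rewrite /eta ler_pM2r ?invr_gt0 // ge_min lexx orbT.
have [S hS] := fin_cover cX (fun _ => eta0).
have tb : (1 / 3 : R) < 1 / 2 by slra.
have [rho [rho' [r1 rr r2 band]]] := avoid_band
  ([seq lam (v a) | a <- S] ++ [seq lam (m t.1.1 t.1.2 t.2) | t <- [seq (ab, c) | ab <- [seq (a, b) | a <- S, b <- S], c <- S]]) tb.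
have vS a : a \in S -> low lam rho (v a) \/ high lam rho' (v a).
  by move=> aS; apply: band; rewrite mem_cat (map_f (fun a => lam (v a))).
have mS a b c : a \in S -> b \in S -> c \in S -> low lam rho (m a b c) \/ high lam rho' (m a b c).
  move=> aS bS cS; apply: band; rewrite mem_cat; apply/orP; right.
  apply/mapP; exists (a, b, c) => //; apply/allpairsP; exists ((a, b), c); split=> //=.
  by apply/allpairsP; exists (a, b).
pose n a b : int := Nc lam chi rho rho' (E a b) 0 1.
(* The three kinds of vertices sit at the residues 0, -1 and 1, and 3 n lifts the circle: leaving
   the low points through unlabelled ones and returning through labelled ones is one full turn. *)
pose h a : R := if `[< low lam rho (v a) >] then 0 else if `[< chi (v a) >] then -1 else 1.
have near2 x a b : d x a < eta -> d x b < eta -> d a b < dl.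
  by move=> xa xb; have := metric_triangle a x b; rewrite (metric_sym a x); slra.
have pt x a b t : a \in S -> d x a < eta -> d x b < eta -> d (E a b t) x < k / 2.
  move=> aS xa xb; have [[_ _ _ /(_ t) h1] _] := hE _ _ (near2 _ _ _ xa xb).
  by have := metric_triangle (E a b t) a x; rewrite (metric_sym a x); slra.
have lamk x y : d y x < k / 2 -> `|lam y - lam x| < 1 / 12.
  move=> yx; apply: hk1; have kk1 : k <= k1 by rewrite ge_min lexx.
  by slra.
have muk x y : d y x < k / 2 -> `|mu y - mu x| < 1 / 2.
  move=> yx; apply: hk2; have kk2 : k <= k2 by rewrite ge_min lexx orbT.
  by slra.
have vx x a : a \in S -> d x a < eta -> d (v a) x < k / 2.
  move=> aS xa; have aa : d a a < dl by rewrite mdistxx.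
  by have [[_ <- _ _] _] := hE _ _ aa; exact: pt.
have l01 : (0 : R) <= 1 by exact: ler01.
have hrange x a : a \in S -> d x a < eta -> [\/ low lam rho (v a) /\ h a = 0,
    high lam rho' (v a) /\ chi (v a) /\ h a = -1 | high lam rho' (v a) /\ ~ chi (v a) /\ h a = 1].
  move=> aS xa; rewrite /h; case: (vS a aS) => H; first by constructor 1; rewrite asboolT.
  have nl : ~ low lam rho (v a) by move=> /(low_not_high rr).
  rewrite (asboolF nl); have [ch|nch] := pselect (chi (v a)).
    by constructor 2; rewrite asboolT.
  by constructor 3; rewrite asboolF.
have net x : exists2 a, a \in S & d x a < eta by have [a aS] := hS x; rewrite metric_sym; exists a.
have coc x a b c : a \in S -> b \in S -> c \in S -> d x a < eta -> d x b < eta -> d x c < eta ->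
  n a b + n b c = n a c.
  move=> aS bS cS xa xb xc; apply: hm; [exact: near2 xa xb|exact: near2 xb xc|exact: near2 xa xc|by []|by []|].
  exact: mS.
exists (arcs S eta h n 0), (arcs S eta h n 1), (arcs S eta h n (-1)).
split; [exact: arcs_open|exact: arcs_open|exact: arcs_open|exact: arcs_cover|split; last exact: (arcs_triple coc)].
(* Off [U1] all points near x are high, so no passage occurs and only the [Echi] terms remain. The
   lifts h b + 3 Echi are 1 or 2, at distance at least 1 from the multiples of 3. *)
- move=> x Vx; apply: contrapT => nU; move: Vx; apply: arcs_avoid => a kk aS xa.
  have lx : lam x = 1 by exact: lamB.
  have hi y : d y x < k / 2 -> high lam rho' y.
    by move=> /lamk; rewrite lx ltr_norml /high => /andP[]; slra.
  have nE b : b \in S -> d x b < eta -> n a b = (Echi lam chi rho' (v b))%:Z - (Echi lam chi rho' (v a))%:Z.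
    move=> bS xb; rewrite /n; have [[_ e1 e2 _] _] := hE _ _ (near2 _ _ _ xa xb).
    rewrite Nc_noC ?e1 ?e2 // => t _ _ lo; apply: (low_not_high rr lo); apply: hi; exact: pt.
  have hb b : b \in S -> d x b < eta -> 1 <= h b + 3 * (Echi lam chi rho' (v b))%:R <= 2.
    move=> bS xb; have hv : high lam rho' (v b) by apply: hi; exact: vx.
    case: (hrange x b bS xb) => [[/(low_not_high rr)//]|[_ [ch ->]]|[_ [ch ->]]]; rewrite /Echi.
      by rewrite asboolT //=; apply/andP; split; slra.
    by rewrite asboolF /=; [apply/andP; split; slra|case].
  pose z := (Echi lam chi rho' (v a))%:Z + kk.
  have cE b : b \in S -> d x b < eta ->
      gap_to h n 0 kk a b = h b + 3 * (Echi lam chi rho' (v b))%:R - 3 * z%:~R.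
    by move=> bS xb; rewrite /gap_to nE // /z intrB intrD; ring.
  by case: (int_le0_ge1 R z) => hz; [left|right] => b bS xb; rewrite cE //;
    have /andP[] := hb b bS xb; move: hz; clear; lra.
(* Off [U2] the nearby points with lam at least [rho] are labelled, so [n] vanishes and the heights
   are -1 or 0, away from the residue 1. *)
- move=> x Vx; apply: contrapT => nU; move: Vx; apply: arcs_avoid => a kk aS xa.
  have chiy y : d y x < k / 2 -> rho <= lam y -> chi y.
    move=> yx ry; have := lamk _ _ yx; rewrite ltr_norml => /andP[l1 l2].
    have mx : mu x = 1 by apply: muB => -[/=|//]; slra.
    by have := muk _ _ yx; rewrite mx ltr_norml /chi => /andP[]; slra.
  have nE b : b \in S -> d x b < eta -> n a b = 0.
    move=> bS xb; rewrite /n; have [[u e1 e2 _] _] := hE _ _ (near2 _ _ _ xa xb).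
    apply: Nc_chi => //; [by rewrite e1; exact: vS|by rewrite e2; exact: vS|].
    by move=> t _ _; apply: chiy; exact: pt.
  have hb b : b \in S -> d x b < eta -> -1 <= h b <= 0.
    move=> bS xb; case: (hrange x b bS xb) => [[_ ->]|[_ [_ ->]]|[hv [nch _]]]; try (apply/andP; split; slra).
    by case: nch; apply: chiy; [exact: vx|move: hv; rewrite /high; slra].
  have cE b : b \in S -> d x b < eta -> gap_to h n 1 kk a b = h b - 1 - 3 * kk%:~R.
    by move=> bS xb; rewrite /gap_to nE // mulr0z; ring.
  by case: (int_le0_ge1 R (kk + 1)); rewrite intrD => hz; [left|right] => b bS xb; rewrite cE //;
    have /andP[] := hb b bS xb; move: hz; clear; lra.
(* Off [U3] those points are unlabelled, [n] vanishes and the heights are 0 or 1, away from the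
   residue -1. *)
- move=> x Vx; apply: contrapT => nU; move: Vx; apply: arcs_avoid => a kk aS xa.
  have chiy y : d y x < k / 2 -> rho <= lam y -> ~ chi y.
    move=> yx ry; have := lamk _ _ yx; rewrite ltr_norml => /andP[l1 l2].
    have mx : mu x = 0 by apply: muA => -[/=|//]; slra.
    by have := muk _ _ yx; rewrite mx ltr_norml /chi => /andP[]; slra.
  have nE b : b \in S -> d x b < eta -> n a b = 0.
    move=> bS xb; rewrite /n; have [[u e1 e2 _] _] := hE _ _ (near2 _ _ _ xa xb).
    apply: Nc_nochi => //.
    by move=> t _ _; apply: chiy; exact: pt.
  have hb b : b \in S -> d x b < eta -> 0 <= h b <= 1.
    move=> bS xb; case: (hrange x b bS xb) => [[_ ->]|[hv [ch _]]|[hv [nch ->]]]; try (apply/andP; split; slra).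
    by case: (chiy (v b)) => //; [exact: vx|move: hv; rewrite /high; slra].
  have cE b : b \in S -> d x b < eta -> gap_to h n (-1) kk a b = h b + 1 - 3 * kk%:~R.
    by move=> bS xb; rewrite /gap_to nE // mulr0z; ring.
  by case: (int_le0_ge1 R kk) => hz; [left|right] => b bS xb; rewrite cE //;
    have /andP[] := hb b bS xb; move: hz; clear; lra.
Qed.


End ThreeSplit.

(** * From covers by three sets to covering dimension *)

(** Triples of indices are treated one at a time, the third set being the union of all members other
    than the first two. Members only shrink, so triples already made disjoint stay so. *)
Lemma covdim_of_three_split (R : realType) (X : metricType R) : @three_split R X -> covdim_le X 1.
Proof.
move=> TS k U oU cU.
have key (L : seq ('I_k * 'I_k * 'I_k)) :
  (forall t, t \in L -> [/\ t.1.1 != t.1.2, t.1.2 != t.2 & t.1.1 != t.2]) ->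
  exists V : 'I_k -> set X, [/\ forall i, open (V i), forall x, exists i, V i x,
    forall i, V i `<=` U i & forall t x, t \in L -> ~ [/\ V t.1.1 x, V t.1.2 x & V t.2 x]].
  elim: L => [|[[i j] l] L IH] HL; first by exists U; split=> // i x.
  have [|V [oV cV sV dV]] := IH; first by move=> t tL; apply: HL; rewrite in_cons tL orbT.
  have [/= ij jl il] := HL (i, j, l) (mem_head _ _).
  pose rest := \bigcup_(p in [set p | p != i /\ p != j]) V p.
  have [||||V1 [V2 [V3 [p1 p2 p3 c123 [s1 s2 s3 no]]]]] := TS (V i) (V j) rest.
  - exact: oV.
  - exact: oV.
  - by apply: bigcup_open => p _; exact: oV.
  - move=> x; have [p Vp] := cV x; have [E|pi] := eqVneq p i; first by constructor 1; rewrite -E.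
    have [E|pj] := eqVneq p j; first by constructor 2; rewrite -E.
    by constructor 3; exists p.
  pose V' p := if p == i then V1 else if p == j then V2 else V p `&` V3.
  have sub p : V' p `<=` V p.
    rewrite /V' => x; case: eqP => [->|_]; first exact: s1.
    by case: eqP => [->|_]; [exact: s2|case].
  exists V'; split.
  - move=> p; rewrite /V'; case: ifP => // _; case: ifP => // _; exact: openI.
  - move=> x; case: (c123 x) => h.
    + by exists i; rewrite /V' eqxx.
    + by exists j; rewrite /V' eq_sym (negbTE ij) eqxx.
    + by have [p [pi pj] Vp] := s3 _ h; exists p; rewrite /V' (negbTE pi) (negbTE pj).
  - by move=> p x /sub; exact: sV.
  - move=> t x; rewrite in_cons => /orP[/eqP -> /= [h1 h2 h3]|tL [/sub h1 /sub h2 /sub h3]]; last exact: (dV t x).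
    apply: (no x); split.
    + by move: h1; rewrite /V' eqxx.
    + by move: h2; rewrite /V' eq_sym (negbTE ij) eqxx.
    + by move: h3; rewrite /V' (eq_sym l) (negbTE il) (eq_sym l) (negbTE jl) => -[].
pose L := [seq t <- enum {: 'I_k * 'I_k * 'I_k} | [&& t.1.1 != t.1.2, t.1.2 != t.2 & t.1.1 != t.2]].
have [|V [oV cV sV dV]] := key L.
  by move=> t; rewrite mem_filter => /andP[/and3P[]].
exists k, V; split=> //; first by move=> j; exists j; exact: sV.
move=> x S hS; rewrite leqNgt; apply/negP => /card_gt2P[a [b [c [[aS bS cS] [ab bc ca]]]]].
apply: (dV (a, b, c) x) => /=; last by split; apply: hS.
by rewrite mem_filter mem_enum /= ab bc eq_sym ca.
Qed.

(** * The compact convex space of 1-Lipschitz functions *)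

Definition klip (R : realType) (X : metricType R) (D : R) (f : X -> R) : Prop :=
  (forall x y, `|f x - f y| <= @mdist R X x y) /\ (forall x, 0 <= f x <= D).

Record kspace (R : realType) (X : metricType R) (D : R) := Kspace { kfun : X -> R; kfunP : klip D kfun }.

HB.instance Definition _ (R : realType) (X : metricType R) (D : R) := gen_eqMixin (kspace X D).
HB.instance Definition _ (R : realType) (X : metricType R) (D : R) := gen_choiceMixin (kspace X D).

Section KSpaceDist.
Context {R : realType} {X : metricType R} {D : R}.
Implicit Types f g h : kspace X D.

(** The value 0 is included so that the supremum is taken over a nonempty set even for empty X. *)
Definition kdist f g : R := sup [set r | r = 0 \/ exists x, r = `|kfun f x - kfun g x|].

Lemma kdist_has_sup f g : has_sup [set r | r = 0 \/ exists x, r = `|kfun f x - kfun g x|].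
Proof.
split; first by exists 0; left.
exists `|D| => r [->//|[x ->]]; have := (kfunP f).2 x; have := (kfunP g).2 x.
move=> /andP[g0 gD] /andP[f0 fD]; apply: le_trans (ler_norm D).
by rewrite ler_norml; apply/andP; split; lra.
Qed.

Lemma kdist_ge f g x : `|kfun f x - kfun g x| <= kdist f g.
Proof. by apply: sup_upper_bound; [exact: kdist_has_sup|right; exists x]. Qed.

Lemma kdist_ge0 f g : 0 <= kdist f g.
Proof. by apply: sup_upper_bound; [exact: kdist_has_sup|left]. Qed.

Lemma kdist_le f g c : 0 <= c -> (forall x, `|kfun f x - kfun g x| <= c) -> kdist f g <= c.
Proof.
move=> c0 H; apply: ge_sup; first by case: (kdist_has_sup f g).
by move=> r [->//|[x ->]].
Qed.

Lemma kdistxx f : kdist f f = 0.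
Proof.
apply/eqP; rewrite eq_le kdist_ge0 andbT; apply: kdist_le => // x.
by rewrite subrr normr0.
Qed.

Lemma kspace_eq f g : kfun f =1 kfun g -> f = g.
Proof.
case: f g => [f fP] [g gP] /= /funext E; move: gP; rewrite -E => gP.
by congr Kspace; exact: Prop_irrelevance.
Qed.

Lemma kdist_positivity f g : kdist f g = 0 -> f = g.
Proof.
move=> E; apply: kspace_eq => x; apply/eqP; rewrite -subr_eq0 -normr_le0 -E.
exact: kdist_ge.
Qed.

Lemma kdist_sym f g : kdist f g = kdist g f.
Proof.
have le a b : kdist a b <= kdist b a.
  by apply: kdist_le => [|x]; [exact: kdist_ge0|rewrite distrC; exact: kdist_ge].
by apply/eqP; rewrite eq_le !le.
Qed.

Lemma kdist_triangle g f h : kdist f h <= kdist f g + kdist g h.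
Proof.
apply: kdist_le => [|x]; first by rewrite addr_ge0 // kdist_ge0.
have := kdist_ge f g x; have := kdist_ge g h x.
have := ler_normD (kfun f x - kfun g x) (kfun g x - kfun h x).
have -> : kfun f x - kfun g x + (kfun g x - kfun h x) = kfun f x - kfun h x by ring.
lra.
Qed.

End KSpaceDist.

HB.instance Definition _ (R : realType) (X : metricType R) (D : R) :=
  isMetric.Build R (kspace X D) (@kdistxx R X D) (@kdist_positivity R X D)
    (@kdist_sym R X D) (@kdist_triangle R X D).

Section KSpace.
Context {R : realType} {X : metricType R} (D : R).
Local Notation d := (@mdist R X).
Hypothesis cX : compact [set: X].
Hypothesis dD : forall x y, d x y <= D.
Local Notation Y := (kspace X D : metricType R).

Lemma kdistE (f g : Y) : @mdist R Y f g = kdist f g.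
Proof. by []. Qed.

Lemma klip_dist x : klip D (d x).
Proof.
split=> [y z|y]; last by rewrite mdist_ge0 dD.
have := metric_triangle x y z; have := metric_triangle x z y; rewrite (metric_sym z y).
by rewrite ler_norml => *; apply/andP; split; lra.
Qed.

(** The Kuratowski embedding. *)
Definition kur x : Y := Kspace (klip_dist x).

Lemma kur_isom x y : @mdist R Y (kur x) (kur y) = d x y.
Proof.
rewrite kdistE; apply/eqP; rewrite eq_le; apply/andP; split; last first.
  apply: le_trans (kdist_ge (kur x) (kur y) y); rewrite /= mdistxx subr0; exact: ler_norm.
apply: kdist_le => [|z]; first exact: mdist_ge0.
have := metric_triangle x y z; have := metric_triangle y x z; rewrite (metric_sym y x) /=.
by rewrite ler_norml => *; apply/andP; split; lra.
Qed.

(** Arzela-Ascoli by an ultrafilter: the pointwise limits form a function [L] of the same space, and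
    the common Lipschitz constant turns convergence on a finite net into uniform convergence. *)
Lemma kspace_compact : compact [set: Y].
Proof.
move=> F FF _; have [G [GU FG]] := ultraFilterLemma FF.
have GP : ProperFilter G by exact: ultra_proper.
pose A x := [set c | G [set f : Y | c <= kfun f x]].
have A0 x : A x 0.
  by apply: filterS filterT => f _ /=; have [_ /(_ x)/andP[]] := kfunP f.
have AD x c : A x c -> c <= D.
  move=> Ac; have [f h] := filter_ex Ac; apply: (le_trans h).
  by have [_ /(_ x)/andP[]] := kfunP f.
have hs x : has_sup (A x) by split; [exists 0|exists D => c; exact: AD].
pose L x := sup (A x).
have GL x e : 0 < e -> G [set f : Y | `|kfun f x - L x| < e].
  move=> e0; have e2 : 0 < e / 2 by slra.
  have [c Ac hc] := sup_adherent e2 (hs x).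
  have nA : ~ G [set f : Y | L x + e / 2 <= kfun f x].
    move=> h; have h' : L x + e / 2 <= L x by apply: sup_upper_bound.
    by slra.
  have [//|h] := in_ultra_setVsetC [set f : Y | L x + e / 2 <= kfun f x] GU.
  apply: filterS (filterI Ac h) => f [/= h1 h2]; rewrite /L in h2 *.
  have h3 : kfun f x < sup (A x) + e / 2 by rewrite ltNge; apply/negP.
  by rewrite ltr_norml; apply/andP; split; slra.
have LP : klip D L.
  split=> [x y|x]; last first.
    by apply/andP; split; [apply: sup_upper_bound|apply: ge_sup; [exists 0|move=> c; exact: AD]].
  rewrite leNgt; apply/negP => h; pose e := (`|L x - L y| - d x y) / 2.
  have e0 : 0 < e by rewrite /e; slra.
  have [f [/= h1 h2]] := filter_ex (filterI (GL x e e0) (GL y e e0)).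
  have [/(_ x y) h3 _] := kfunP f.
  have := ler_normD (L x - kfun f x) (kfun f x - L y).
  have -> : L x - kfun f x + (kfun f x - L y) = L x - L y by ring.
  have := ler_normD (kfun f x - kfun f y) (kfun f y - L y).
  have -> : kfun f x - kfun f y + (kfun f y - L y) = kfun f x - L y by ring.
  rewrite (distrC (L x) (kfun f x)); move: h1 h2; rewrite /e; slra.
exists (Kspace LP : Y); split=> // B C FB nC.
move: nC; rewrite -nbhs_ballE => -[e /= e0 eC].
have e4 : 0 < e / 4 by slra.
have [s hs'] := fin_cover cX (fun _ => e4).
have Gs : G [set f : Y | forall x, x \in s -> `|kfun f x - L x| < e / 4].
  elim: s {hs'} => [|x s IH]; first by apply: filterS filterT => f _ x.
  apply: filterS (filterI (GL x _ e4) IH) => f [h1 h2] y; rewrite in_cons => /orP[/eqP->//|]; exact: h2.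
have [f [Bf fs]] := filter_ex (filterI (FG _ FB) Gs).
exists f; split=> //; apply: eC; rewrite ballEmdist /= kdistE.
apply: le_lt_trans (_ : 3 * (e / 4) < e); last by slra.
apply: kdist_le => [|y /=]; first slra.
have [x xs xy] := hs' y; have h1 := fs x xs.
have [/(_ x y) h2 _] := kfunP f; have [/(_ x y) h3 _] := LP.
have := ler_normD (L y - L x) (L x - kfun f y).
have -> : L y - L x + (L x - kfun f y) = L y - kfun f y by ring.
have := ler_normD (L x - kfun f x) (kfun f x - kfun f y).
have -> : L x - kfun f x + (kfun f x - kfun f y) = L x - kfun f y by ring.
rewrite (distrC (L x) (kfun f x)) (distrC (L y) (L x)); slra.
Qed.

Lemma kur_embedding : embedding kur.
Proof.
split.
- move=> x B; rewrite /= -nbhs_ballE => -[e /= e0 eB].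
  rewrite /fmap /= -nbhs_ballE; exists e => //= y; rewrite ballEmdist /= => h; apply: eB.
  by rewrite ballEmdist /= kur_isom.
- move=> x y E; apply: (@mdist_positivity R X); rewrite -kur_isom E; exact: mdistxx.
- move=> A oA; exists [set y : Y | exists a r, [/\ 0 < r, forall x, d a x < r -> A x & @mdist R Y (kur a) y < r]].
  split.
    apply: dist_open => y [a [r [r0 H h]]]; exists (r - @mdist R Y (kur a) y); first by rewrite subr_gt0.
    move=> z hz; exists a, r; split=> //; have := @metric_triangle _ Y (kur a) y z; lra.
  apply/seteqP; split=> y.
    move=> [x Ax <-]; split; first by exists x.
    by have [r r0 H] := open_dist oA Ax; exists x, r; split=> //; rewrite mdistxx.
  by move=> [[x _ <-] [a [r [r0 H h]]]]; exists x => //; apply: H; rewrite -kur_isom.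
Qed.

Definition knear (dl : R) (f : X -> R) := klip D f /\ exists x, forall w, `|f w - d x w| <= dl.

(** The almost retraction is restated for bare functions, so that convex combinations can be written
    directly; [lft] packs them and is arbitrary outside the space. The uniform modulus comes from
    compactness. *)
Lemma retraction (eps : R) : X -> AANR X -> 0 < eps -> exists (r : (X -> R) -> X) (dl : R), [/\ 0 < dl,
  forall x, d x (r (d x)) < eps &
  forall eta, 0 < eta -> exists2 th, 0 < th & forall f g, knear dl f -> knear dl g ->
    (forall w, `|f w - g w| <= th) -> d (r f) (r g) < eta].
Proof.
move=> x0 aX e0; have [U [clU [V [oV iV VU]] [r [cr hr]]]] := aX Y kur kspace_compact kur_embedding eps e0.
have exV x : exists rr : R, 0 < rr /\ forall y : Y, @mdist R Y (kur x) y < 2 * rr -> V y.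
  have [|rr r0 H] := open_dist (x := kur x) oV; first by apply: iV; exists x.
  by exists (rr / 2); split; [slra|move=> y h; apply: H; slra].
have [rr hrr] := choice exV.
have [s hs] := fin_cover cX (fun x => (hrr x).1).
have [dl d0 hdl] := min_pos s (fun x => (hrr x).1).
have nU (y : Y) x : @mdist R Y (kur x) y < dl -> U y.
  move=> h; apply: VU; have [z zs hz] := hs x; apply: (hrr z).2.
  have := @metric_triangle _ Y (kur z) (kur x) y; rewrite kur_isom.
  have := hdl z zs; slra.
have ucU eta : 0 < eta -> exists2 th, 0 < th & forall y y' : Y, U y -> U y' -> @mdist R Y y y' < th -> d (r y) (r y') < eta.
  move=> eta0; have ex (y : Y) : exists q : R, 0 < q /\ forall y' : Y, @mdist R Y y y' < 2 * q -> U y' ->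
      U y /\ d (r y) (r y') < eta / 2.
    have [Uy|nUy] := pselect (U y).
      have eta2 : 0 < eta / 2 by slra.
      have /subspace_continuousP cr' := cr.
      have := cr' y Uy _ (nbhsx_ballx (r y) (eta / 2) eta2).
      rewrite /fmap /= /within /= -nbhs_ballE => -[q /= q0 H].
      exists (q / 2); split; first slra.
      move=> y' h Uy'; split=> //; have := H y'; rewrite !ballEmdist /=; apply=> //; slra.
    (* Closedness of [U] is used here: around a point outside [U] a ball misses [U] and the
       condition is void. *)
    have oU : open (~` U) by exact: closed_openC.
    have [q q0 H] := open_dist oU nUy; exists (q / 2); split; first slra.
    by move=> y' h Uy'; case: (H y') => //; slra.
  have [q hq] := choice ex.
  have [t ht] := fin_cover kspace_compact (fun y => (hq y).1).
  have [th th0 hth] := min_pos t (fun y => (hq y).1).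
  exists th => // y y' Uy Uy' yy'; have [z zt zy] := ht y; have := hth z zt => tz.
  have q0 := (hq z).1.
  have [|_ k1] := (hq z).2 y _ Uy; first slra.
  have [|_ k2] := (hq z).2 y' _ Uy'; first by have := @metric_triangle _ Y z y y'; slra.
  have := metric_triangle (r y) (r z) (r y'); rewrite (metric_sym (r y) (r z)); slra.
have exf (f : X -> R) : exists y : Y, klip D f -> kfun y = f.
  have [kf|nk] := pselect (klip D f); last by exists (kur x0) => /nk.
  by exists (Kspace kf).
have [lft hlft] := choice exf.
have lk x : lft (d x) = kur x by apply: kspace_eq => w; rewrite hlft //; exact: klip_dist.
exists (fun f => r (lft f)), (dl / 2); split; first slra.
  by move=> x; rewrite lk.
move=> eta eta0; have [th th0 H] := ucU eta eta0; exists (th / 2); first slra.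
have kU f : knear (dl / 2) f -> U (lft f).
  move=> [kf [x hx]]; apply: (nU _ x); rewrite metric_sym kdistE.
  apply: le_lt_trans (_ : dl / 2 < dl); last slra.
  by apply: kdist_le => [|w]; [slra|rewrite hlft].
move=> f g nf ng fg; apply: H; [exact: kU|exact: kU|].
rewrite kdistE; apply: le_lt_trans (_ : th / 2 < th); last slra.
apply: kdist_le => [|w]; first slra.
by rewrite !hlft; [|exact: ng.1|exact: nf.1].
Qed.

End KSpace.

(** * Grids, edges and triangles filled by convex combinations *)

Section Fillings.
Context {R : realType} {X : metricType R} (D : R).
Local Notation d := (@mdist R X).
Hypothesis dD : forall x y, d x y <= D.
Hypothesis retr : forall eps : R, 0 < eps -> exists (r : (X -> R) -> X) (dl : R), [/\ 0 < dl,
  forall x, d x (r (d x)) < eps &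
  forall eta, 0 < eta -> exists2 th, 0 < th & forall f g, @knear R X D dl f -> @knear R X D dl g ->
    (forall w, `|f w - g w| <= th) -> d (r f) (r g) < eta].

Lemma cvx_close (t p q s M : R) : 0 <= t -> t <= 1 -> `|p - s| <= M -> `|q - s| <= M ->
  `|(1 - t) * p + t * q - s| <= M.
Proof.
rewrite !ler_norml => t0 t1 /andP[p1 p2] /andP[q1 q2]; apply/andP; split; nra.
Qed.

Lemma cvx_diff (t p q p' q' M : R) : 0 <= t -> t <= 1 -> `|p - p'| <= M -> `|q - q'| <= M ->
  `|((1 - t) * p + t * q) - ((1 - t) * p' + t * q')| <= M.
Proof.
rewrite !ler_norml => t0 t1 /andP[p1 p2] /andP[q1 q2]; apply/andP; split; nra.
Qed.

Lemma klip_cvx (f g : X -> R) t : klip D f -> klip D g -> 0 <= t -> t <= 1 ->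
  klip D (fun w => (1 - t) * f w + t * g w).
Proof.
move=> [f1 f2] [g1 g2] t0 t1; split=> [x y|x]; first exact: cvx_diff.
have /andP[a1 a2] := f2 x; have /andP[b1 b2] := g2 x; apply/andP; split; nra.
Qed.

Lemma dist_close (a b w : X) : `|d a w - d b w| <= d a b.
Proof.
have := metric_triangle a b w; have := metric_triangle b a w; rewrite (metric_sym b a).
by rewrite ler_norml => *; apply/andP; split; lra.
Qed.

(** Closed unit intervals overlap, so a point of [k, k + 1] may be assigned to a neighbouring cell;
    the slack of 2 in the indices absorbs this. *)
Lemma pl_cvx m (x : R) : exists i i' t, [/\ (i <= m)%N, (i' <= m)%N, (0 <= t) && (t <= 1),
  (i <= i')%N && (i' <= i.+1)%N /\ (forall k : nat, (k <= m)%N -> k%:R <= x -> x <= k.+1%:R ->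
     [&& (i <= k.+2)%N, (k <= i.+2)%N, (i' <= k.+2)%N & (k <= i'.+2)%N]) &
  forall a, pl m a x = (1 - t) * a i + t * a i'].
Proof.
have [m0|m0] := posnP m.
  exists 0%N, 0%N, 0; rewrite lexx ler01; split=> //.
    by split=> // k; rewrite m0 => km _ _; move: km; clear; lia.
  by move=> a; rewrite m0 /pl big_ord0; ring.
have [i [t [im t0 t1 [h1 h2] H]]] := pl_cell x m0.
exists i, i.+1, t; rewrite t0 t1; split=> //; first exact: ltnW.
split=> [|k km kx xk]; first by rewrite leqnn leqnSn.
have c1 : (i <= k.+1)%N.
  case: h1 => [h1|->//]; rewrite -(ler_nat R); exact: le_trans h1 xk.
have c2 : (k <= i.+1)%N.
  case: h2 => [h2|->//]; rewrite -(ler_nat R); exact: le_trans kx h2.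
by move: c1 c2; clear; lia.
Qed.

Lemma lattice_step (q : nat -> X) e : (forall i, d (q i) (q i.+1) < e) -> 0 <= e ->
  forall i k, (i <= k.+2)%N -> (k <= i.+2)%N -> d (q i) (q k) <= 2 * e.
Proof.
move=> H e0; have up i n : (n <= 2)%N -> d (q i) (q (i + n)%N) <= 2 * e.
  case: n => [|[|[|//]]] _; rewrite ?addn0 ?addn1 ?addn2 ?mdistxx; first lra.
    by have := H i; lra.
  by have := metric_triangle (q i) (q i.+1) (q i.+2); have := H i; have := H i.+1; lra.
move=> i k ik ki; have [le|le] := leqP i k.
  by rewrite -(subnKC le); apply: up; move: ki; clear; lia.
by rewrite metric_sym -(subnKC (ltnW le)); apply: up; move: ik; clear; lia.
Qed.

(** The distance functions of the grid points are interpolated bilinearly, then sent to X by the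
    almost retraction. *)
Lemma grid_fillingP : @grid_filling R X.
Proof.
move=> eps e0; have e2 : 0 < eps / 2 by slra.
have [r [dl [d0 hr ucr]]] := retr e2; have [th th0 hth] := ucr _ e2.
(* The grid points that enter at one place are at most two steps apart in each direction, hence
   within 4 e. *)
pose e := Num.min dl th / 8.
have m0 : 0 < Num.min dl th by rewrite lt_min d0.
have ee0 : 0 < e by rewrite /e; slra.
have edl : 8 * e <= dl.
  have : Num.min dl th <= dl by rewrite ge_min lexx.
  by rewrite /e; slra.
have eth : 8 * e <= th.
  have : Num.min dl th <= th by rewrite ge_min lexx orbT.
  by rewrite /e; slra.
exists e => // m N q qv qh.
(* Rows beyond [m] are replaced by row [m], because the hypotheses control only the rows up to
   [m]. *)
pose qq i j := q (minn i m) j.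
have qqv j i : d (qq i j) (qq i.+1 j) < e.
  rewrite /qq; case: (boolP (i < m)%N) => [im|]; last rewrite -leqNgt => mi.
    by rewrite (minn_idPl (ltnW im)) (minn_idPl im); exact: qv.
  by rewrite (minn_idPr mi) (minn_idPr (leqW mi)) mdistxx.
have qqh i j : d (qq i j) (qq i j.+1) < e by apply: qh; exact: geq_minr.
have near2 i j k l : (i <= k.+2)%N -> (k <= i.+2)%N -> (j <= l.+2)%N -> (l <= j.+2)%N ->
    d (qq i j) (qq k l) <= 4 * e.
  move=> ik ki jl lj; have := metric_triangle (qq i j) (qq k j) (qq k l).
  have := lattice_step (qqv j) (ltW ee0) ik ki; have := lattice_step (qqh k) (ltW ee0) jl lj; slra.
pose f x y w := pl N.+1 (fun j => pl m (fun i => d (q i j) w) x) y.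
have fE x y : exists i i' j j' t t', [/\ (i <= m)%N /\ (i' <= m)%N, (0 <= t) && (t <= 1) /\ (0 <= t') && (t' <= 1),
   (i <= i')%N && (i' <= i.+1)%N /\ (j <= j')%N && (j' <= j.+1)%N,
   (forall k l, (k <= m)%N -> (l <= N)%N -> k%:R <= x <= k.+1%:R -> l%:R <= y <= l.+1%:R ->
     [&& (i <= k.+2)%N, (k <= i.+2)%N, (i' <= k.+2)%N & (k <= i'.+2)%N] &&
     [&& (j <= l.+2)%N, (l <= j.+2)%N, (j' <= l.+2)%N & (l <= j'.+2)%N]) &
   forall w, f x y w = (1 - t') * ((1 - t) * d (qq i j) w + t * d (qq i' j) w) +
      t' * ((1 - t) * d (qq i j') w + t * d (qq i' j') w)].
  have [i [i' [t [im im' tt [ii H] E]]]] := pl_cvx m x.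
  have [j [j' [t' [jm jm' tt' [jj H'] E']]]] := pl_cvx N.+1 y.
  exists i, i', j, j', t, t'; split=> //.
    move=> k l km lN /andP[k1 k2] /andP[l1 l2]; rewrite (H k km k1 k2) /=.
    exact: (H' l (leqW lN) l1 l2).
  by move=> w; rewrite /f E' !E /qq (minn_idPl im) (minn_idPl im').
have fk x y : klip D (f x y).
  have [i [i' [j [j' [t [t' [_ [/andP[t0 t1] /andP[t0' t1']] _ _ E]]]]]]] := fE x y.
  have -> : f x y = fun w => (1 - t') * ((1 - t) * d (qq i j) w + t * d (qq i' j) w) +
      t' * ((1 - t) * d (qq i j') w + t * d (qq i' j') w) by apply/funext.
  by apply: klip_cvx => //; apply: klip_cvx => //; exact: klip_dist.
have fnear x y k l : (k <= m)%N -> (l <= N)%N -> k%:R <= x <= k.+1%:R -> l%:R <= y <= l.+1%:R ->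
    forall w, `|f x y w - d (q k l) w| <= 4 * e.
  move=> km lN kx ly w.
  have [i [i' [j [j' [t [t' [_ [/andP[t0 t1] /andP[t0' t1']] _ H E]]]]]]] := fE x y.
  have /andP[/and4P[a1 a2 a3 a4] /and4P[b1 b2 b3 b4]] := H k l km lN kx ly.
  have Eq : q k l = qq k l by rewrite /qq (minn_idPl km).
  rewrite E Eq; apply: cvx_close => //; apply: cvx_close => //;
    by apply: le_trans (dist_close _ _ _) _; apply: near2.
have fn x y : @knear R X D dl (f x y).
  split=> //; have [i [i' [j [j' [t [t' [_ [/andP[t0 t1] /andP[t0' t1']] [/andP[i1 i2] /andP[j1 j2]] _ E]]]]]]] := fE x y.
  exists (qq i j) => w; apply: (@le_trans _ _ (4 * e)); last by slra.
  rewrite E; apply: cvx_close => //; apply: cvx_close => //;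
    by apply: le_trans (dist_close _ _ _) _; apply: near2; move: i1 i2 j1 j2; clear; lia.
have D0 : 0 <= D by apply: le_trans (dD (q 0%N 0%N) (q 0%N 0%N)); exact: mdist_ge0.
have dnd a b w : `|d a w - d b w| <= D by apply: le_trans (dist_close _ _ _) _; exact: dD.
have bnd x j w : 0 <= pl m (fun i => d (q i j) w) x <= D.
  by apply: pl_bound => i _; rewrite mdist_ge0 dD.
have flip x x' y y' w : `|f x y w - f x' y' w| <= N.+1%:R * D * `|y - y'| + m%:R * D * `|x - x'|.
  have -> : f x y w - f x' y' w = (f x y w - f x y' w) + (f x y' w - f x' y' w) by ring.
  apply: (le_trans (ler_normD _ _)); apply: lerD.
    apply: pl_lip => j _; have /andP[a1 a2] := bnd x j.+1 w; have /andP[b1 b2] := bnd x j w.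
    by rewrite ler_norml; apply/andP; split; slra.
  have [j [j' [t' [_ _ /andP[t0 t1] _ E']]]] := pl_cvx N.+1 y'.
  by rewrite /f !E'; apply: cvx_diff => //; apply: pl_lip => i _; exact: dnd.
exists (fun x y => r (f x y)).
  move=> eta eta0; have [th' th0' H] := ucr eta eta0.
  pose L := (N.+1%:R + m%:R) * D + 1.
  have L0 : 0 < L by rewrite ltr_wpDl // mulr_ge0.
  exists (th' / L); first by rewrite divr_gt0.
  move=> x x' y y' xx yy; apply: H => // w; apply: (le_trans (flip _ _ _ _ _)).
  have p1 : 0 <= N.+1%:R * D by rewrite mulr_ge0.
  have p2 : 0 <= m%:R * D by rewrite mulr_ge0.
  have q0 : 0 < th' / L by rewrite divr_gt0.
  apply: (@le_trans _ _ (N.+1%:R * D * (th' / L) + m%:R * D * (th' / L))).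
    by apply: lerD; apply: ler_wpM2l => //; exact: ltW.
  rewrite -!mulrDl mulrCA ler_piMr ?(ltW th0') // ler_pdivrMr // mul1r /L; slra.
move=> i j x y im jN xi yj.
have n1 := fnear x y i j im jN xi yj.
have kq : @knear R X D dl (d (q i j)).
  by split; [exact: klip_dist|exists (q i j) => w; rewrite subrr normr0 ltW].
have h3 : d (r (f x y)) (r (d (q i j))) < eps / 2.
  by apply: hth => // w; apply: le_trans (n1 w) _; slra.
have := hr (q i j); have := metric_triangle (r (f x y)) (r (d (q i j))) (q i j).
rewrite (metric_sym (r (d (q i j))) (q i j)); slra.
Qed.

(** The convex triangle on d a, d b, d c is used in cone coordinates: x goes from a to the opposite
    side, y along that side. In the sampled grid column 0 is constant, the first and last rows are
    ab and ac, and [lat_path] along the last column bc compares them. *)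
Lemma edge_systemP : @edge_system R X.
Proof.
move=> eps e0; have e2 : 0 < eps / 2 by slra.
have [r [dl [d0 hr ucr]]] := retr e2; have [th th0 hth] := ucr _ e2.
pose de := Num.min dl th / 2.
have m0 : 0 < Num.min dl th by rewrite lt_min d0.
have de0 : 0 < de by rewrite /de; slra.
have edl : de <= dl.
  have : Num.min dl th <= dl by rewrite ge_min lexx.
  by move: m0; rewrite /de; slra.
have eth : de <= th.
  have : Num.min dl th <= th by rewrite ge_min lexx orbT.
  by move: m0; rewrite /de; slra.
pose v a := r (d a).
pose g a b c (x y : R) w := (1 - clamp x) * d a w + clamp x * ((1 - clamp y) * d b w + clamp y * d c w).
have gk a b c x y : klip D (g a b c x y).
  apply: (klip_cvx (klip_dist dD a) _ (clamp_ge0 x) (clamp_le1 x)).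
  exact: (klip_cvx (klip_dist dD b) (klip_dist dD c) (clamp_ge0 y) (clamp_le1 y)).
have gclose a b c x y w : d a b < de -> d a c < de -> `|g a b c x y w - d a w| <= de.
  move=> ab ac; have a0 : `|d a w - d a w| <= de by rewrite subrr normr0 ltW.
  apply: cvx_close; rewrite ?clamp_ge0 ?clamp_le1 //; apply: cvx_close; rewrite ?clamp_ge0 ?clamp_le1 //.
    by apply: le_trans (dist_close _ _ _) _; rewrite metric_sym ltW.
  by apply: le_trans (dist_close _ _ _) _; rewrite metric_sym ltW.
have gn a b c x y : d a b < de -> d a c < de -> @knear R X D dl (g a b c x y).
  by move=> ab ac; split=> //; exists a => w; apply: le_trans (gclose _ _ _ _ _ _ ab ac) edl.
have glip a b c x y x' y' w : `|g a b c x y w - g a b c x' y' w| <= D * (`|x - x'| + `|y - y'|).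
  set bc := (1 - clamp y) * d b w + clamp y * d c w.
  set bc' := (1 - clamp y') * d b w + clamp y' * d c w.
  have bc0 : 0 <= bc <= D.
    have := klip_cvx (klip_dist dD b) (klip_dist dD c) (clamp_ge0 y) (clamp_le1 y); case=> _; exact.
  have E1 : g a b c x y w - g a b c x' y' w = (clamp x - clamp x') * (bc - d a w) +
     clamp x' * ((clamp y - clamp y') * (d c w - d b w)) by rewrite /g /bc; ring.
  have D0 : 0 <= D by apply: le_trans (dD a a); exact: mdist_ge0.
  have k1 : `|bc - d a w| <= D.
    have := mdist_ge0 a w; have := dD a w; case/andP: bc0 => *.
    by rewrite ler_norml; apply/andP; split; slra.
  have k2 : `|d c w - d b w| <= D by apply: le_trans (dist_close _ _ _) _; exact: dD.
  rewrite E1; apply: (le_trans (ler_normD _ _)); rewrite [leRHS]mulrDr; apply: lerD.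
    by rewrite normrM mulrC; apply: ler_pM => //; exact: clamp_lip.
  rewrite normrM (ger0_norm (clamp_ge0 x')); apply: le_trans (ler_piMl _ (clamp_le1 x')) _ => //.
  by rewrite normrM mulrC; apply: ler_pM => //; exact: clamp_lip.
have ucg a b c : d a b < de -> d a c < de -> uc2 (fun x y => r (g a b c x y)).
  move=> ab ac eta eta0; have [th' th0' H] := ucr eta eta0.
  have D1 : 0 < 2 * (D + 1) by have := le_trans (mdist_ge0 a a) (dD a a); slra.
  exists (th' / (2 * (D + 1))); first by rewrite divr_gt0.
  move=> x x' y y'; rewrite !ltr_pdivlMr // => xx yy; apply: H; [exact: gn|exact: gn|] => w.
  apply: (le_trans (glip _ _ _ _ _ _ _ _)).
  have := normr_ge0 (x - x'); have := normr_ge0 (y - y'); have := le_trans (mdist_ge0 a a) (dD a a).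
  by move: xx yy; set p := `|x - x'|; set q := `|y - y'|; clear; nra.
pose E a b t := r (g a b b t 0).
have gbb a b t y : g a b b t y = fun w => (1 - clamp t) * d a w + clamp t * d b w.
  by apply/funext => w; rewrite /g; ring.
exists de => //; exists v, E; split.
  move=> a b ab; split.
  - move=> eta eta0; have [dd dd0 H] := ucg a b b ab ab eta eta0; exists dd => // s t st.
    by apply: H => //; rewrite subrr normr0.
  - by rewrite /E /v gbb clamp0 //; congr r; apply/funext => w; ring.
  - by rewrite /E /v gbb clamp1 //; congr r; apply/funext => w; ring.
  - move=> t; have n0 : @knear R X D dl (d a).
      by split; [exact: klip_dist|exists a => w; rewrite subrr normr0 ltW].
    have h : d (E a b t) (r (d a)) < eps / 2.
      apply: hth => //; first exact: gn.
      by move=> w; apply: le_trans (gclose _ _ _ _ _ _ ab ab) eth.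
    have := hr a; have := metric_triangle (E a b t) (r (d a)) a; rewrite (metric_sym (r (d a)) a); slra.
move=> a b c ab bc ac e e1.
have e3 : 0 < e / 2 by slra.
have [dd dd0 H] := ucg a b c ab ac _ e3.
have [n n0 nd] := inv_below dd0.
have nR : 0 < n%:R :> R by rewrite ltr0n.
pose q j i := r (g a b c (i%:R / n%:R) (j%:R / n%:R)).
have step (i : nat) : `|i%:R / n%:R - i.+1%:R / n%:R| < dd.
  by rewrite -natr1 -mulrBl opprD addrA subrr add0r mulN1r normrN gtr0_norm ?invr_gt0.
have z0 : `|0 : R| < dd by rewrite normr0.
have qv i j : (i < n)%N -> nr (e / 2) (q i j) (q i.+1 j) by move=> _; apply: H; rewrite ?subrr.
have qh i j : (i <= n)%N -> nr (e / 2) (q i j) (q i j.+1) by move=> _; apply: H; rewrite ?subrr.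
have c0 : clamp (0%:R / n%:R) = 0 :> R by rewrite mul0r clamp0.
have cn : clamp (n%:R / n%:R) = 1 :> R by rewrite divff ?lt0r_neq0 // clamp1.
have qc i : (i <= n)%N -> q i 0%N = q 0%N 0%N.
  by move=> _; rewrite /q; congr r; apply/funext => w; rewrite /g c0; ring.
have q0 i : q 0%N i = E a b (i%:R / n%:R).
  by rewrite /q /E gbb; congr r; apply/funext => w; rewrite /g c0; ring.
have qn i : q n i = E a c (i%:R / n%:R).
  by rewrite /q /E gbb; congr r; apply/funext => w; rewrite /g cn; ring.
have qb j : q j n = E b c (j%:R / n%:R).
  by rewrite /q /E gbb; congr r; apply/funext => w; rewrite /g cn; ring.
pose tau (i : nat) : R := i%:R / n%:R.
have tf (P : R -> X) : (forall s t, `|s - t| < dd -> d (P s) (P t) < e / 2) -> forall k, osc_lt e P (tau k) (tau k.+1).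
  move=> hP k; have kk : tau k <= tau k.+1 by rewrite /tau ler_pM2r ?invr_gt0 // ler_nat.
  have := step k; rewrite -/(tau k) -/(tau k.+1) ltr_norml => /andP[s1 s2].
  split=> // x y /andP[x1 x2] /andP[y1 y2].
  have : d (P x) (P y) < e / 2 by apply: hP; rewrite ltr_norml; apply/andP; split; slra.
  slra.
have t0 : tau 0%N = 0 by rewrite /tau mul0r.
have tn : tau n = 1 by rewrite /tau divff // lt0r_neq0.
have smp (P : R -> X) : (forall s t, `|s - t| < dd -> d (P s) (P t) < e / 2) ->
    ht e (ch e P 0 1) [seq P (tau i) | i <- iota 0 n.+1].
  move=> hP; have := ch_ht (part_tau 0 n (tf P hP)); rewrite add0n t0 tn /= t0.
  by rewrite -map_comp.
have sab t : E a b t = r (g a b c t 0).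
  by rewrite /E gbb; congr r; apply/funext => w; rewrite /g (clamp0 (lexx 0)); ring.
have sac t : E a c t = r (g a b c t 1).
  by rewrite /E gbb; congr r; apply/funext => w; rewrite /g (clamp1 (lexx 1)); ring.
have sbc t : E b c t = r (g a b c 1 t).
  by rewrite /E gbb; congr r; apply/funext => w; rewrite /g (clamp1 (lexx 1)); ring.
have hab s t : `|s - t| < dd -> d (E a b s) (E a b t) < e / 2.
  by move=> st; rewrite !sab; apply: H; rewrite ?subrr.
have hac s t : `|s - t| < dd -> d (E a c s) (E a c t) < e / 2.
  by move=> st; rewrite !sac; apply: H; rewrite ?subrr.
have hbc s t : `|s - t| < dd -> d (E b c s) (E b c t) < e / 2.
  by move=> st; rewrite !sbc; apply: H; rewrite ?subrr.
pose col := [seq (j, n) | j <- iota 0 n.+1].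
have K := @lat_path R X (e / 2) n q e3 qv qh qc (0, n)%N col.
have Kall : all (fun b : nat * nat => b.1 <= n)%N col.
  by apply/allP => x /mapP[j]; rewrite mem_iota add0n ltnS => /andP[_ jn] ->.
have Kp : path king (0, n)%N col.
  have aux k j : path king (j, n) [seq (i, n) | i <- iota j.+1 k].
    by elim: k j => [//|k IH] j /=; rewrite IH andbT /king /=; move: (n) (j); clear; lia.
  by rewrite /col /= aux andbT /king /=; move: (n); clear; lia.
have li : last 0%N (iota 1 n) = n.
  by case: (n) => // k; rewrite (last_nth 0%N) size_iota -nth_behead nth_iota.
have Kl : last (0, n)%N col = (n, n) by rewrite /col /= (last_map (fun j => (j, n))) li.
have {K} := K (leq0n n) Kall Kp; rewrite Kl; cbn [fst snd].
have -> : e / 2 + e / 2 = e by slra.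
have -> : pre q 0 n = [seq E a b (tau i) | i <- iota 0 n.+1] by rewrite /pre /mkseq; apply: eq_map => i; exact: q0.
have -> : pre q n n = [seq E a c (tau i) | i <- iota 0 n.+1] by rewrite /pre /mkseq; apply: eq_map => i; exact: qn.
have -> : [seq q x.1 x.2 | x <- col] = [seq E b c (tau i) | i <- iota 0 n.+1].
  by rewrite /col -map_comp; apply: eq_map => i /=; exact: qb.
move=> K; apply: (ht_trans (smp _ hac)); apply: ht_sym.
by apply: ht_trans K; apply: ht_cat; exact: smp.
Qed.

End Fillings.

(** * From a quad to maps of the disk *)

Section QuadMaps.
Context {R : realType} {X : metricType R}.
Local Notation d := (@mdist R X).

Lemma cont_plane (f : R * R -> X) : (forall e, 0 < e -> exists2 dl, 0 < dl &
    forall z y : R * R, `|z.1 - y.1| < dl -> `|z.2 - y.2| < dl -> d (f z) (f y) < e) -> continuous f.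
Proof.
move=> H z B; rewrite /= -nbhs_ballE => -[e /= e0 eB]; have [dl d0 h] := H e e0.
rewrite /fmap /= -nbhs_ballE; exists dl => //= y [b1 b2]; apply: eB; rewrite ballEmdist /=.
by apply: h; [move: b1|move: b2]; rewrite -ball_normE.
Qed.

Lemma cont_real (f : X -> R) (L : R) : 0 < L -> (forall x y, `|f x - f y| <= L * d x y) -> continuous f.
Proof.
move=> L0 H x B; rewrite /= -nbhs_ballE => -[e /= e0 eB].
rewrite /fmap /= -nbhs_ballE; exists (e / L); first by rewrite /= divr_gt0.
move=> y; rewrite ballEmdist /= ltr_pdivlMr // mulrC => h; apply: eB; rewrite -ball_normE /=.
exact: le_lt_trans (H x y) h.
Qed.

(* g o f pushes every point of the disk that is at distance >= 1/4 from an axis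
   inwards along the corresponding coordinate. *)
Lemma quad_maps F (z w : X) (s c k : R) : uc2 F -> 0 < k ->
  (forall t, 0 <= t <= 1 -> [/\ d (F 0 t) w <= c - k, c + k <= d (F 1 t) w,
       d (F t 0) z <= s - k & s + k <= d (F t 1) z]) ->
  exists (f : R * R -> X) (g : X -> R * R),
    [/\ {within @disk2 R, continuous f}, continuous g, (forall x : X, @disk2 R (g x)) &
        exists c : R, c < 1 /\ forall z : R * R, @disk2 R z -> cdist (g (f z)) z <= c].
Proof.
move=> uF k0 H.
(* [al] maps [-1/4, 1/4] onto [0, 1], so [f] lands on a side of the quad as soon as a coordinate is
   at least 1/4 in absolute value; there the matching coordinate of [g] is 1/10 with the right
   sign. *)
pose al (u : R) := clamp ((1 + 4 * u) / 2).
pose cl (u : R) := 2 * clamp ((u + 1) / 2) - 1.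
have allip u v : `|al u - al v| <= 2 * `|u - v|.
  apply: le_trans (clamp_lip _ _) _.
  have -> : (1 + 4 * u) / 2 - (1 + 4 * v) / 2 = 2 * (u - v) by field.
  by rewrite normrM ger0_norm.
have al01 u : 0 <= al u <= 1 by rewrite clamp_ge0 clamp_le1.
have al0 u : u <= - (1 / 4) -> al u = 0 by move=> h; apply: clamp0; slra.
have al1 u : 1 / 4 <= u -> al u = 1 by move=> h; apply: clamp1; slra.
have cllip u v : `|cl u - cl v| <= `|u - v|.
  have -> : cl u - cl v = 2 * (clamp ((u + 1) / 2) - clamp ((v + 1) / 2)) by rewrite /cl; ring.
  rewrite normrM ger0_norm //; have := clamp_lip ((u + 1) / 2) ((v + 1) / 2).
  have -> : (u + 1) / 2 - (v + 1) / 2 = (u - v) / 2 by field.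
  by rewrite normrM [`|2^-1|]ger0_norm // => h; slra.
have clr u : -1 <= cl u <= 1.
  by rewrite /cl; have := clamp_ge0 ((u + 1) / 2); have := clamp_le1 ((u + 1) / 2) => *; apply/andP; split; slra.
have clm u : u <= -1 -> cl u = -1 by move=> h; rewrite /cl clamp0; slra.
have clp u : 1 <= u -> cl u = 1 by move=> h; rewrite /cl clamp1; slra.
pose f (y : R * R) := F (al y.1) (al y.2).
pose gc (p : X) (q : R) x := (1 / 10) * cl ((d x p - q) / k).
have gcc p q : continuous (gc p q).
  have ki : 0 < k^-1 by rewrite invr_gt0.
  apply: (@cont_real _ k^-1) => // x y; rewrite /gc -mulrBr normrM.
  have := cllip ((d x p - q) / k) ((d y p - q) / k).
  have -> : (d x p - q) / k - (d y p - q) / k = (d x p - d y p) * k^-1 by ring.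
  rewrite normrM (ger0_norm (ltW ki)) => h.
  have h2 : `|d x p - d y p| <= d x y.
    have := metric_triangle x y p; have := metric_triangle y x p; rewrite (metric_sym y x).
    by rewrite ler_norml => *; apply/andP; split; slra.
  have h3 : `|d x p - d y p| * k^-1 <= k^-1 * d x y by rewrite mulrC ler_pM2l.
  rewrite ger0_norm; last slra.
  have := normr_ge0 (cl ((d x p - q) / k) - cl ((d y p - q) / k)); slra.
exists f, (fun x => (gc w c x, gc z s x)); split.
- apply: continuous_subspaceT; apply: cont_plane => e e0; have [dl d0 h] := uF e e0.
  exists (dl / 2); first slra.
  move=> u v h1 h2; apply: h.
    by apply: le_lt_trans (allip _ _) _; slra.
  by apply: le_lt_trans (allip _ _) _; slra.
- by move=> x; exact: (cvg_pair (gcc w c x) (gcc z s x)).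
- move=> x; rewrite /disk2 /gc /=; have := clr ((d x w - c) / k); have := clr ((d x z - s) / k).
  by move: (cl _) (cl _) => p q /andP[p1 p2] /andP[q1 q2]; snra.
(* The squared error is at most 1 - 1/10 + 1/50 if both coordinates are at least 1/4 in absolute
   value, (35/100)^2 + (9/10)^2 if only one is, and 2 (35/100)^2 if none is; all these are below
   99/100. *)
exists (Num.sqrt (99 / 100)); split.
  by rewrite -[ltRHS]sqrtr1 ltr_sqrt //; slra.
move=> y Hy; rewrite /cdist ler_wsqrtr //=.
have : y.1 ^+ 2 + y.2 ^+ 2 <= 1 by exact: Hy.
have E1 : (y.1 <= - (1 / 4) -> gc w c (f y) = - (1 / 10)) /\ (1 / 4 <= y.1 -> gc w c (f y) = 1 / 10).
  have [h1 h2 _ _] := H _ (al01 y.2); split=> h; rewrite /gc /f.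
    by rewrite al0 // clm; [slra|rewrite ler_pdivrMr //; slra].
  by rewrite al1 // clp; [slra|rewrite ler_pdivlMr //; slra].
have E2 : (y.2 <= - (1 / 4) -> gc z s (f y) = - (1 / 10)) /\ (1 / 4 <= y.2 -> gc z s (f y) = 1 / 10).
  have [_ _ h1 h2] := H _ (al01 y.1); split=> h; rewrite /gc /f.
    by rewrite (al0 _ h) clm; [slra|rewrite ler_pdivrMr //; slra].
  by rewrite (al1 _ h) clp; [slra|rewrite ler_pdivlMr //; slra].
have B1 : - (1 / 10) <= gc w c (f y) <= 1 / 10.
  by rewrite /gc; have /andP[? ?] := clr ((d (f y) w - c) / k); apply/andP; split; slra.
have B2 : - (1 / 10) <= gc z s (f y) <= 1 / 10.
  by rewrite /gc; have /andP[? ?] := clr ((d (f y) z - s) / k); apply/andP; split; slra.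
move: E1 E2 B1 B2; move: (gc w c (f y)) (gc z s (f y)) (y.1) (y.2) => p q a b; clear.
move=> [a1 a2] [b1 b2] /andP[p1 p2] /andP[q1 q2] ab.
have ca : [\/ a <= - (1 / 4), 1 / 4 <= a | - (1 / 4) < a /\ a < 1 / 4].
  have [h|h] := leP a (- (1 / 4)); first by constructor 1.
  by have [h'|h'] := leP (1 / 4) a; [constructor 2|constructor 3].
have cb : [\/ b <= - (1 / 4), 1 / 4 <= b | - (1 / 4) < b /\ b < 1 / 4].
  have [h|h] := leP b (- (1 / 4)); first by constructor 1.
  by have [h'|h'] := leP (1 / 4) b; [constructor 2|constructor 3].
have a1' : -1 <= a <= 1 by apply/andP; split; snra.
have b1' : -1 <= b <= 1 by apply/andP; split; snra.
case/andP: a1' => ? ?; case/andP: b1' => ? ?.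
have sq (u : R) : - (35 / 100) <= u -> u <= 35 / 100 -> u ^+ 2 <= 1225 / 10000 by clear; move=> *; snra.
have sq' (u : R) : - (9 / 10) <= u -> u <= 9 / 10 -> u ^+ 2 <= 81 / 100 by clear; move=> *; snra.
case: ca => [h|h|[h h']]; [rewrite (a1 h)|rewrite (a2 h)|];
  case: cb => [g|g|[g g']]; rewrite ?(b1 g) ?(b2 g).
- slra.
- slra.
- have [A B] : (q - b) ^+ 2 <= 1225 / 10000 /\ (- (1 / 10) - a) ^+ 2 <= 81 / 100 by split; [apply: sq|apply: sq']; clear ab; slra.
  by move: A B; clear; lra.
- slra.
- slra.
- have [A B] : (q - b) ^+ 2 <= 1225 / 10000 /\ (1 / 10 - a) ^+ 2 <= 81 / 100 by split; [apply: sq|apply: sq']; clear ab; slra.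
  by move: A B; clear; lra.
- have [A B] : (p - a) ^+ 2 <= 1225 / 10000 /\ (- (1 / 10) - b) ^+ 2 <= 81 / 100 by split; [apply: sq|apply: sq']; clear ab; slra.
  by move: A B; clear; lra.
- have [A B] : (p - a) ^+ 2 <= 1225 / 10000 /\ (1 / 10 - b) ^+ 2 <= 81 / 100 by split; [apply: sq|apply: sq']; clear ab; slra.
  by move: A B; clear; lra.
- have [A B] : (p - a) ^+ 2 <= 1225 / 10000 /\ (q - b) ^+ 2 <= 1225 / 10000 by split; [apply: sq|apply: sq]; clear ab; slra.
  by move: A B; clear; lra.
Qed.

End QuadMaps.

Lemma covdim_empty (R : realType) (X : metricType R) n : (X -> False) -> covdim_le X n.
Proof.
move=> e k U _ _; exists 0%N, (fun=> set0); split=> [[]//|x|[]//|x]; by case: (e x).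
Qed.

Lemma bounded_diam (R : realType) (X : metricType R) : compact [set: X] ->
  exists D : R, forall x y : X, @mdist R X x y <= D.
Proof.
move=> cX; have [s hs] := fin_cover cX (fun _ => ltr01).
have [[x0]|no] := pselect (inhabited X); last by exists 0 => x; case: no.
pose S := \sum_(a <- s) @mdist R X x0 a.
have hS a : a \in s -> @mdist R X x0 a <= S.
  move=> aS; rewrite /S (big_rem a) //= lerDl sumr_ge0 // => b _; exact: mdist_ge0.
have b x : @mdist R X x0 x <= S + 1.
  have [a aS ax] := hs x; have := hS a aS; have := metric_triangle x0 a x; lra.
exists (2 * (S + 1)) => x y; have := metric_triangle x x0 y; rewrite (metric_sym x x0).
have := b x; have := b y; lra.
Qed.

Theorem theorem3 (R : realType) (X : metricType R) :
  compact [set: X] -> AANR X -> ~ covdim_le X 1 ->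
  exists (f : R * R -> X) (g : X -> R * R),
    [/\ {within @disk2 R, continuous f},
        continuous g,
        (forall x : X, @disk2 R (g x)) &
        exists c : R, c < 1 /\
          forall z : R * R, @disk2 R z -> cdist (g (f z)) z <= c].
Proof.
move=> cX aX nd; apply: contrapT => no; apply: nd.
have nq : @noquad R X.
  by move=> F uF z w s c k k0 H; apply: no; exact: quad_maps uF k0 H.
have [[x0]|ne] := pselect (inhabited X); last by apply: covdim_empty => x; apply: ne.
have [D dD] := bounded_diam cX.
have retr eps := @retraction R X D cX dD eps x0 aX.
apply: covdim_of_three_split; apply: (three_split_of_edges cX nq).
  exact: (grid_fillingP dD retr).
exact: (edge_systemP dD retr).
Qed.
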